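(* Let $0<\theta<1$, let $\lambda_\theta$ be the lens map of parameter $\theta$, and let $w(z)=(1-\lambda_\theta(z))^{a}$ where $a=\frac12\big(1-\frac1\theta\big)<0$. Then $w\in H^2$ and the weighted composition operator $M_wC_{\lambda_\theta}\colon f\mapsto w\,(f\circ\lambda_\theta)$ is bounded but not compact on $H^2$, although $C_{\lambda_\theta}\colon f\mapsto f\circ\lambda_\theta$ belongs to all Schatten classes $S_p(H^2)$, $p>0$.
   Context: $\mathbb{D}$ is the open unit disk and $H^2$ the Hardy space. The lens map of parameter $\theta\in(0,1)$ is $\lambda_\theta(z)=\dfrac{(1+z)^\theta-(1-z)^\theta}{(1+z)^\theta+(1-z)^\theta}$, $z\in\mathbb{D}$ (principal branches of the powers); it is an analytic self-map of $\mathbb{D}$. Since $\operatorname{Re}(1-\lambda_\theta)>0$, the power $(1-\lambda_\theta)^a$ is defined with the principal branch. $S_p(H^2)$, $p>0$, is the Schatten class of compact operators $T$ on $H^2$ with $\sum_n s_n(T)^p<\infty$. *)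

(* Defs.v *)
From Stdlib Require Import Reals Lra ClassicalEpsilon.
From Coquelicot Require Import Coquelicot.
Open Scope R_scope.

(* Principal argument of a nonzero complex number, with values in (-PI, PI]. *)
Definition Carg (z : C) : R :=
  if Rlt_dec 0 (Re z) then atan (Im z / Re z)
  else if Rlt_dec (Re z) 0 then
    (if Rle_dec 0 (Im z) then atan (Im z / Re z) + PI else atan (Im z / Re z) - PI)
  else if Rlt_dec 0 (Im z) then PI / 2
  else if Rlt_dec (Im z) 0 then - (PI / 2) else 0.

(* Principal branch of the power z^c for real exponent c:
   z^c = exp (c Log z) = |z|^c (cos (c Arg z) + i sin (c Arg z)), z <> 0
   (value 0 at z = 0, never used here). *)
Definition Cpowr (z : C) (c : R) : C :=
  if Req_EM_T (Cmod z) 0 then RtoC 0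
  else (Rpower (Cmod z) c * cos (c * Carg z), Rpower (Cmod z) c * sin (c * Carg z)).

Definition lens (theta : R) (z : C) : C :=
  ((Cpowr (1 + z) theta - Cpowr (1 - z) theta) / (Cpowr (1 + z) theta + Cpowr (1 - z) theta))%C.

Definition inD (z : C) : Prop := Cmod z < 1.

(* ---------- Hardy space H^2 (functions C -> C, only values on D matter) ---------- *)

Definition taylor_coeffs (f : C -> C) (a : nat -> C) : Prop :=
  forall z, inD z -> is_series (fun n => (a n * z ^ n)%C) (f z).

Definition in_H2 (f : C -> C) : Prop :=
  exists a, taylor_coeffs f a /\ ex_series (fun n => Cmod (a n) ^ 2).

(* the coefficient sequence (unique for f analytic on D) *)
Definition H2coef (f : C -> C) : nat -> C :=
  epsilon (inhabits (fun _ : nat => RtoC 0)) (fun a => taylor_coeffs f a).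

Definition H2norm (f : C -> C) : R :=
  sqrt (Series (fun n => Cmod (H2coef f n) ^ 2)).

Definition op := (C -> C) -> (C -> C).

Definition fsub (f g : C -> C) : C -> C := fun z => (f z - g z)%C.

Definition H2_linear (T : op) : Prop :=
  forall f g (c : C), in_H2 f -> in_H2 g ->
    forall z, inD z -> T (fun u => f u + c * g u)%C z = (T f z + c * T g z)%C.

Definition H2_bounded (T : op) : Prop :=
  (forall f, in_H2 f -> in_H2 (T f)) /\
  exists M : R, forall f, in_H2 f -> H2norm (T f) <= M * H2norm f.

Definition H2_compact (T : op) : Prop :=
  H2_bounded T /\
  forall fs : nat -> (C -> C), (forall k, in_H2 (fs k) /\ H2norm (fs k) <= 1) ->
    exists (phi : nat -> nat) (g : C -> C),
      (forall k, (phi k < phi (S k))%nat) /\ in_H2 g /\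
      is_lim_seq (fun k => H2norm (fsub (T (fs (phi k))) g)) 0.

Fixpoint csum (n : nat) (h : nat -> C) : C :=
  match n with O => RtoC 0 | S m => (csum m h + h m)%C end.

Definition H2_rank_le (n : nat) (F : op) : Prop :=
  exists g : nat -> (C -> C), (forall i, in_H2 (g i)) /\
    forall f, in_H2 f -> exists c : nat -> C,
      forall z, inD z -> F f z = csum n (fun i => c i * g i z)%C.

(* n-th singular value s_n(T) (n >= 0), as the n-th approximation number
   inf { ||T - F|| : F linear of rank <= n }  (equal to the singular values
   for compact operators on a Hilbert space). *)
Definition sing_val (T : op) (n : nat) : R :=
  real (Glb_Rbar (fun r => exists F : op,
     H2_linear F /\ H2_rank_le n F /\
     forall f, in_H2 f -> H2norm (fsub (T f) (F f)) <= r * H2norm f)).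

Definition nnpow (x p : R) : R := if Rle_dec x 0 then 0 else Rpower x p.

Definition in_Schatten (p : R) (T : op) : Prop :=
  H2_linear T /\ H2_compact T /\ ex_series (fun n => nnpow (sing_val T n) p).

Definition Comp (phi : C -> C) : op := fun f z => f (phi z).
Definition WComp (w phi : C -> C) : op := fun f z => (w z * f (phi z))%C.

(* Main.v *)
(** Norms in [H^2] are computed without boundary values: by discrete Parseval on the points
    [r e^(i pi (2k+1) / N)], the norm of an analytic [F] is bounded by the quadratic means of
    [|F|] over such points.  Analyticity is handled as locally uniform approximability by
    polynomials, which passes to sums, products, inverses, compositions and, via Euler's method
    for [y' = c v / (1 + t v) y], to the powers [(1 + v)^c].

    Put [U = ((1+z)/(1-z))^theta], which lies in a sector of opening [theta pi]; then
    [lens = (U-1)/(U+1)] and [1 - lens z * conj (lens z')] is comparable to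
    [(|U| + |U'|) / (|1+U| |1+U'|)].  Through the Gram matrix of the reproducing kernels at the
    points [lens z_k], boundedness of the weighted operator becomes a Schur test for a kernel
    homogeneous of degree [-1].  It is not compact because the normalized kernels at
    [lens x], [x -> 1], tend weakly to [0] while the point evaluation at [x] bounds the norms of
    their images from below.

    For the unweighted operator, [1 - |lens|^2 >= c |1-z^2|^theta] gives a Hilbert-Schmidt bound.
    Subtracting the part of [f] interpolated by a Blaschke product [B] of degree [n = 2 J^2] leaves
    [B g] with [|g| <= |f|]; placing the zeros of [B] at [U = 2^j], [-J <= j < J], each with
    multiplicity [J], makes [B o lens] of size [q^J] except near [1] and [-1], where the weight
    is itself exponentially small in [J].  Hence the [n]-th singular value is at most
    [K exp (- d sqrt n)]. *)

Require Import Defs.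
From Stdlib Require Import Reals Lra Lia Psatz Compare_dec ClassicalEpsilon FunctionalExtensionality.
From Coquelicot Require Import Coquelicot.
Open Scope R_scope.

(** * Finite sums and complex series *)

(** The exponent [a] is critical. Near 1 the bound on [|w|^2] is of order [|1-z|^(theta-1)], and the
    pointwise estimate [|f o lens|^2 <= ||f||^2 / (1 - |lens|^2)] costs a further [|1-z|^(-theta)].
    The product [|1-z|^(-1)] just fails to be integrable, so this pointwise route cannot give
    boundedness: a bilinear form has to be estimated, and a Hilbert-type inequality is what survives
    at degree -1. Without the weight only the integrable [|1-z^2|^(-theta)] occurs; the room between
    [theta] and 1 is spent on smallness near 1 and -1, and it feeds both compactness and the
    Schatten bound. The definitions shape the rest. The space is given by Taylor coefficients alone,
    so the image of a function must first be shown to have a Taylor expansion on the whole disc;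
    this is what polynomial approximability is for, with coefficient bounds from Parseval standing
    in for Cauchy's estimates. Coefficients are picked by [epsilon], so uniqueness of the expansion
    must come before any norm is computed. *)

Fixpoint rsum (n : nat) (h : nat -> R) : R :=
  match n with O => 0 | S m => rsum m h + h m end.

Lemma rsum_ext n f g : (forall i, (i < n)%nat -> f i = g i) -> rsum n f = rsum n g.
Proof.
  induction n as [|n IH]; simpl; intros H; [easy|].
  rewrite IH by (intros; apply H; lia). now rewrite H by lia.
Qed.

Lemma rsum_le n f g : (forall i, (i < n)%nat -> f i <= g i) -> rsum n f <= rsum n g.
Proof.
  induction n as [|n IH]; simpl; intros H; [lra|].
  apply Rplus_le_compat; [apply IH; intros; apply H; lia | apply H; lia].
Qed.

Lemma rsum_plus n f g : rsum n (fun i => f i + g i) = rsum n f + rsum n g.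
Proof. induction n as [|n IH]; simpl; [lra|rewrite IH; lra]. Qed.

Lemma rsum_scal n c f : rsum n (fun i => c * f i) = c * rsum n f.
Proof. induction n as [|n IH]; simpl; [lra|rewrite IH; lra]. Qed.

Lemma rsum_const n c : rsum n (fun _ => c) = INR n * c.
Proof. induction n as [|n IH]; simpl rsum; [simpl; lra|rewrite IH, S_INR; lra]. Qed.

Lemma rsum_nonneg n f : (forall i, (i < n)%nat -> 0 <= f i) -> 0 <= rsum n f.
Proof.
  intros H. replace 0 with (rsum n (fun _ => 0)) by (rewrite rsum_const; lra).
  now apply rsum_le.
Qed.

Ltac via t := eapply Rle_trans; [apply t|].

(** Sign goals by recursion on the head symbol. Leaves are left to [lra], so the signs of atoms must
    be in the context; a nonstrict goal of no known shape is reduced to the strict one. *)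
Ltac pos :=
  intros; try assumption; try lra;
  lazymatch goal with
  | |- ?x > 0 => change (0 < x); pos
  | |- _ <> 0 => apply Rgt_not_eq; pos
  | |- 0 < _ * _ => apply Rmult_lt_0_compat; pos
  | |- 0 < _ / _ => apply Rdiv_lt_0_compat; pos
  | |- 0 < / _ => apply Rinv_0_lt_compat; pos
  | |- 0 < _ + _ => apply Rplus_lt_0_compat; pos
  | |- 0 < _ ^ _ => apply pow_lt; pos
  | |- 0 < Rpower _ _ => apply exp_pos
  | |- 0 < exp _ => apply exp_pos
  | |- 0 < sqrt _ => apply sqrt_lt_R0; pos
  | |- 0 < INR _ => apply (lt_INR 0); lia
  | |- 0 < INR _ + _ => apply Rplus_le_lt_0_compat; pos
  | |- 0 <= Cmod _ => apply Cmod_ge_0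
  | |- 0 <= Rabs _ => apply Rabs_pos
  | |- 0 <= sqrt _ => apply sqrt_pos
  | |- 0 <= INR _ => apply pos_INR
  | |- 0 <= H2norm _ => apply sqrt_pos
  | |- 0 <= _ ^ 2 => apply pow2_ge_0
  | |- 0 <= _ ^ _ => apply pow_le; pos
  | |- 0 <= _ * _ => apply Rmult_le_pos; pos
  | |- 0 <= _ / _ => apply Rdiv_le_0_compat; pos
  | |- 0 <= rsum _ _ => apply rsum_nonneg; pos
  | |- 0 <= _ => apply Rlt_le; pos
  end.

Lemma rsum_term_le n f i : (forall j, (j < n)%nat -> 0 <= f j) -> (i < n)%nat -> f i <= rsum n f.
Proof.
  induction n as [|n IH]; simpl; intros H Hi; [lia|].
  assert (0 <= f n) by (apply H; lia).
  destruct (Nat.eq_dec i n) as [->|Hne].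
  - assert (0 <= rsum n f) by (apply rsum_nonneg; intros; apply H; lia). lra.
  - assert (f i <= rsum n f) by (apply IH; [intros; apply H; lia|lia]). lra.
Qed.

Lemma rsum_mono n m f : (forall j, 0 <= f j) -> (n <= m)%nat -> rsum n f <= rsum m f.
Proof.
  intros H Hnm; induction Hnm as [|m Hnm IH]; simpl; [lra|].
  specialize (H m); lra.
Qed.

(** [B] bounds the square of the norm. Stated on partial sums, it involves no convergence and is
    stable under shifts. *)
Definition l2le (x : nat -> C) (B : R) : Prop := forall D, rsum D (fun i => Cmod (x i) ^ 2) <= B.

Lemma rsum_swap n m (f : nat -> nat -> R) :
  rsum n (fun i => rsum m (fun j => f i j)) = rsum m (fun j => rsum n (fun i => f i j)).
Proof.
  induction n as [|n IH]; simpl; [now rewrite rsum_const, Rmult_0_r|].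
  rewrite IH, <- rsum_plus. now apply rsum_ext.
Qed.

Lemma rsum_add n m f : rsum (n + m) f = rsum n f + rsum m (fun i => f (n + i)%nat).
Proof.
  induction m as [|m IH]; [rewrite Nat.add_0_r; simpl; lra|].
  rewrite Nat.add_succ_r; simpl. rewrite IH. lra.
Qed.

Lemma rsum_rev n f : rsum n (fun i => f (n - 1 - i)%nat) = rsum n f.
Proof.
  induction n as [|n IH]; [easy|].
  change (S n) with (1 + n)%nat at 1. rewrite rsum_add. simpl rsum.
  rewrite <- IH. rewrite Rplus_0_l, Rplus_comm. f_equal; [|f_equal; lia].
  apply rsum_ext; intros; f_equal; lia.
Qed.

Lemma rsum_sum_n f n : rsum (S n) f = sum_n f n.
Proof.
  induction n as [|n IH].
  - rewrite sum_O. simpl; lra.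
  - rewrite sum_Sn, <- IH. reflexivity.
Qed.

Lemma ex_series_of_bounded f K :
  (forall n, 0 <= f n) -> (forall n, rsum n f <= K) -> ex_series f /\ Series f <= K.
Proof.
  intros Hp HK.
  assert (Hb : forall n, sum_n f n <= K) by (intros n; rewrite <- rsum_sum_n; apply HK).
  assert (Hex : ex_finite_lim_seq (sum_n f)).
  { apply ex_finite_lim_seq_incr with K; [|exact Hb].
    intros n. rewrite sum_Sn. specialize (Hp (S n)). unfold plus; simpl. lra. }
  destruct Hex as [l Hl]. split.
  - exists l. exact Hl.
  - unfold Series. rewrite (is_lim_seq_unique _ _ Hl). simpl.
    assert (H := is_lim_seq_le (sum_n f) (fun _ => K) l K Hb Hl (is_lim_seq_const K)).
    exact H.
Qed.

Lemma rsum_le_Series f n : (forall n, 0 <= f n) -> ex_series f -> rsum n f <= Series f.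
Proof.
  intros Hp Hex.
  apply Series_correct in Hex.
  assert (H : is_lim_seq (sum_n f) (Series f)) by exact Hex.
  assert (H' := is_lim_seq_incr_compare _ _ H).
  apply Rle_trans with (sum_n f n).
  - rewrite <- rsum_sum_n; simpl. specialize (Hp n); lra.
  - apply H'. intros k. rewrite sum_Sn. specialize (Hp (S k)). unfold plus; simpl. lra.
Qed.

Lemma csum_ext n f g : (forall i, (i < n)%nat -> f i = g i) -> csum n f = csum n g.
Proof.
  induction n as [|n IH]; simpl; intros H; [easy|].
  rewrite IH by (intros; apply H; lia). now rewrite H by lia.
Qed.

Lemma csum_plus n f g : csum n (fun i => f i + g i)%C = (csum n f + csum n g)%C.
Proof. induction n as [|n IH]; simpl; [ring|rewrite IH; ring]. Qed.

Lemma csum_scal n c f : csum n (fun i => c * f i)%C = (c * csum n f)%C.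
Proof. induction n as [|n IH]; simpl; [ring|rewrite IH; ring]. Qed.

Lemma csum_zero n : csum n (fun _ => RtoC 0) = RtoC 0.
Proof. induction n as [|n IH]; simpl; [easy|rewrite IH; ring]. Qed.

Lemma csum_minus n f g : csum n (fun i => f i - g i)%C = (csum n f - csum n g)%C.
Proof. induction n as [|n IH]; simpl; [ring|rewrite IH; ring]. Qed.

Lemma csum_add n m f : csum (n + m) f = (csum n f + csum m (fun i => f (n + i)%nat))%C.
Proof.
  induction m as [|m IH]; [rewrite Nat.add_0_r; simpl; ring|].
  rewrite Nat.add_succ_r; simpl. rewrite IH. ring.
Qed.

Lemma csum_swap n m (f : nat -> nat -> C) :
  csum n (fun i => csum m (fun j => f i j)) = csum m (fun j => csum n (fun i => f i j)).
Proof.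
  induction n as [|n IH]; simpl; [now rewrite csum_zero|].
  rewrite IH, <- csum_plus. now apply csum_ext.
Qed.

Lemma csum_conj n f : Cconj (csum n f) = csum n (fun i => Cconj (f i)).
Proof.
  induction n as [|n IH]; simpl.
  - unfold Cconj, RtoC; simpl. now rewrite Ropp_0.
  - now rewrite Cplus_conj, IH.
Qed.

Lemma csum_RtoC n f : csum n (fun i => RtoC (f i)) = RtoC (rsum n f).
Proof. induction n as [|n IH]; simpl; [easy|now rewrite IH, RtoC_plus]. Qed.

Lemma Cmod_csum n f : Cmod (csum n f) <= rsum n (fun i => Cmod (f i)).
Proof.
  induction n as [|n IH]; simpl; [rewrite Cmod_0; lra|].
  eapply Rle_trans; [apply Cmod_triangle|lra].
Qed.

Lemma Cmult_conj_self z : (z * Cconj z)%C = RtoC (Cmod z ^ 2).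
Proof.
  unfold Cmod. rewrite pow2_sqrt by (generalize (pow2_ge_0 (fst z)) (pow2_ge_0 (snd z)); lra).
  apply injective_projections; simpl; ring.
Qed.

Lemma csum_mul_conj n m f g :
  (csum n f * Cconj (csum m g))%C = csum n (fun i => csum m (fun j => f i * Cconj (g j))%C).
Proof.
  rewrite csum_conj.
  transitivity (csum n (fun i => csum m (fun j => Cconj (g j)) * f i)%C).
  - rewrite csum_scal. ring.
  - apply csum_ext. intros i _. rewrite csum_scal. ring.
Qed.

Lemma rsum_Cauchy_Schwarz n f g :
  (rsum n (fun i => f i * g i)) ^ 2 <= rsum n (fun i => f i ^ 2) * rsum n (fun i => g i ^ 2).
Proof.
  induction n as [|n IH]; [simpl; lra|].
  cbn [rsum].
  set (p := rsum n _) in *. set (X := rsum n (fun i => f i ^ 2)) in *.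
  set (Y := rsum n (fun i => g i ^ 2)) in *. set (a := f n). set (b := g n).
  assert (HX : 0 <= X) by (apply rsum_nonneg; intros; apply pow2_ge_0).
  assert (HY : 0 <= Y) by (apply rsum_nonneg; intros; apply pow2_ge_0).
  assert (H : 2 * (p * (a * b)) <= X * b ^ 2 + a ^ 2 * Y).
  { assert (0 <= X * b ^ 2 + a ^ 2 * Y) by (generalize (pow2_ge_0 a) (pow2_ge_0 b); nra).
    apply Rle_trans with (Rabs (2 * (p * (a * b)))); [apply Rle_abs|].
    rewrite <- (Rabs_pos_eq (X * b ^ 2 + a ^ 2 * Y)) by easy.
    apply Rsqr_le_abs_0. unfold Rsqr.
    assert (p ^ 2 * (a * b) ^ 2 <= X * Y * (a * b) ^ 2)
      by (apply Rmult_le_compat_r; [pos|easy]).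
    generalize (pow2_ge_0 (X * b ^ 2 - a ^ 2 * Y)). nra. }
  nra.
Qed.

Lemma Cmod_csum_Cauchy_Schwarz n f g :
  Cmod (csum n (fun i => f i * g i)%C) ^ 2
  <= rsum n (fun i => Cmod (f i) ^ 2) * rsum n (fun i => Cmod (g i) ^ 2).
Proof.
  eapply Rle_trans; [|apply rsum_Cauchy_Schwarz].
  apply pow_incr; split; [pos|].
  via Cmod_csum.
  apply rsum_le; intros. rewrite Cmod_mult; lra.
Qed.

Lemma Cmod_minus_sym x y : Cmod (x - y) = Cmod (y - x).
Proof. rewrite <- Cmod_opp. f_equal; ring. Qed.

Lemma Cmod_triangle_minus x y : Cmod (x - y) <= Cmod x + Cmod y.
Proof. unfold Cminus. rewrite <- (Cmod_opp y). apply Cmod_triangle. Qed.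

Lemma Cmod_le_minus x y : Cmod x <= Cmod y + Cmod (x - y).
Proof. replace x with (y + (x - y))%C at 1 by ring. apply Cmod_triangle. Qed.

Lemma Cmod_sq z : Cmod z ^ 2 = Re z ^ 2 + Im z ^ 2.
Proof. unfold Cmod, Re, Im. rewrite pow2_sqrt; nra. Qed.

Lemma Cmod_le_2Rmax z : Cmod z <= 2 * Rmax (Rabs (fst z)) (Rabs (snd z)).
Proof.
  via Cmod_2Rmax. apply Rmult_le_compat_r.
  - eapply Rle_trans; [apply Rabs_pos|apply Rmax_l].
  - rewrite <- (sqrt_Rsqr 2) at 2 by lra. apply sqrt_le_1; unfold Rsqr; lra.
Qed.

Lemma Cconj_R (x : R) : Cconj x = RtoC x.
Proof. apply injective_projections; simpl; ring. Qed.

Lemma Cmod_sq_plus_le x y : Cmod (x + y) ^ 2 <= 2 * Cmod x ^ 2 + 2 * Cmod y ^ 2.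
Proof.
  apply Rle_trans with ((Cmod x + Cmod y) ^ 2).
  - apply pow_incr. split; [pos|apply Cmod_triangle].
  - generalize (pow2_ge_0 (Cmod x - Cmod y)). nra.
Qed.

Lemma Cmod_sq_lt_1 z : inD z -> 0 <= Cmod z ^ 2 < 1.
Proof. unfold inD. generalize (Cmod_ge_0 z). simpl; nra. Qed.

Lemma sq_lt_1 a : Rabs a < 1 -> a ^ 2 < 1.
Proof. intros H. rewrite <- pow2_abs. generalize (Rabs_pos a). simpl; nra. Qed.

Lemma csum_tail n m f : (csum (n + m) f - csum n f)%C = csum m (fun i => f (n + i)%nat).
Proof. rewrite csum_add. ring. Qed.

Lemma functional_choice {A B : Type} (P : A -> B -> Prop) :
  (forall x, exists y, P x y) -> exists f, forall x, P x (f x).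
Proof.
  intros H. exists (fun x => proj1_sig (constructive_indefinite_description _ (H x))).
  intros x. exact (proj2_sig (constructive_indefinite_description _ (H x))).
Qed.

Lemma lim_scal_0 (u : nat -> R) c : is_lim_seq u 0 -> is_lim_seq (fun n => c * u n) 0.
Proof. intros H. replace (Finite 0) with (Rbar_mult c 0) by (simpl; f_equal; ring). now apply is_lim_seq_scal_l. Qed.

Lemma lim_inv_INR c : is_lim_seq (fun k => / (INR k + c)) 0.
Proof.
  replace (Finite 0) with (Rbar_inv p_infty) by reflexivity.
  apply is_lim_seq_inv; [|easy].
  apply is_lim_seq_plus with p_infty c; [apply is_lim_seq_INR|apply is_lim_seq_const|easy].
Qed.

(** Convergence of series measured with [Cmod] and with [n] terms in the [n]-th partial sum, to
    avoid the product uniform structure behind [is_series]. *)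
Definition cconv (a : nat -> C) (l : C) : Prop :=
  forall eps, 0 < eps -> exists N, forall n, (N <= n)%nat -> Cmod (csum n a - l) <= eps.

Lemma csum_sum_n (a : nat -> C) n : csum (S n) a = sum_n (a : nat -> C_NormedModule) n.
Proof.
  induction n as [|n IH].
  - rewrite sum_O. simpl; ring.
  - rewrite sum_Sn, <- IH. reflexivity.
Qed.

Lemma is_series_cconv (a : nat -> C) (l : C) :
  is_series (V := C_NormedModule) a l <-> cconv a l.
Proof.
  split.
  - intros H eps Heps.
    (* Balls of [C] are squares; passing from a square to the modulus costs [sqrt 2 <= 2]. *)
    assert (H2 : 0 < eps / 2) by lra.
    destruct (proj1 (filterlim_locally _ _) H (mkposreal _ H2)) as [N HN]. exists (S N). intros [|n] Hn; [lia|].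
    specialize (HN n ltac:(lia)). rewrite csum_sum_n.
    set (s := sum_n _ n) in *.
    apply C_NormedModule_mixin_compat2 in HN.
    change (Cmod (s - l) < sqrt 2 * (eps / 2)) in HN.
    assert (sqrt 2 <= 2) by (rewrite <- (sqrt_Rsqr 2) at 2 by lra; apply sqrt_le_1; unfold Rsqr; lra).
    nra.
  - intros H. apply filterlim_locally. intros [eps Heps].
    destruct (H (eps / 2) ltac:(lra)) as [N HN].
    exists N. intros n Hn. specialize (HN (S n) ltac:(lia)). rewrite csum_sum_n in HN.
    apply C_NormedModule_mixin_compat1. simpl.
    set (s := sum_n _ n) in *.
    change (Cmod (s - l) < eps). lra.
Qed.

Lemma cconv_unique a l l' : cconv a l -> cconv a l' -> l = l'.
Proof.
  intros H H'. apply Ceq_minus, Cmod_eq_0. apply Rle_antisym; [|pos].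
  apply le_epsilon. intros eps Heps.
  destruct (H (eps / 2) ltac:(lra)) as [N HN], (H' (eps / 2) ltac:(lra)) as [N' HN'].
  specialize (HN (N + N')%nat ltac:(lia)). specialize (HN' (N + N')%nat ltac:(lia)).
  replace (l - l')%C with (csum (N + N') a - l' - (csum (N + N') a - l))%C by ring.
  eapply Rle_trans; [apply Cmod_triangle_minus|lra].
Qed.

Lemma cconv_ext a b l : (forall n, a n = b n) -> cconv a l -> cconv b l.
Proof.
  intros E H eps Heps. destruct (H eps Heps) as [N HN]. exists N. intros n Hn.
  rewrite (csum_ext n b a) by (intros; now rewrite E). now apply HN.
Qed.

Lemma cconv_lin a b c l m :
  cconv a l -> cconv b m -> cconv (fun n => a n + c * b n)%C (l + c * m)%C.
Proof.
  intros H H' eps Heps.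
  assert (Hc := Cmod_ge_0 c).
  destruct (H (eps / 2) ltac:(lra)) as [N HN].
  destruct (H' (eps / (2 * (Cmod c + 1)))) as [N' HN'].
  { pos. }
  exists (N + N')%nat. intros n Hn.
  specialize (HN n ltac:(lia)). specialize (HN' n ltac:(lia)).
  rewrite csum_plus, csum_scal.
  replace (csum n a + c * csum n b - (l + c * m))%C
    with ((csum n a - l) + c * (csum n b - m))%C by ring.
  via Cmod_triangle. rewrite Cmod_mult.
  assert (Cmod c * Cmod (csum n b - m) <= eps / 2); [|lra].
  apply Rle_trans with ((Cmod c + 1) * (eps / (2 * (Cmod c + 1)))).
  - apply Rmult_le_compat; try apply Cmod_ge_0; lra.
  - right. field. lra.
Qed.

(** Completeness, through real and imaginary parts separately. The explicit modulus [b] survives in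
    the limit, so errors stay quantitative. *)
Lemma cconv_cauchy a (b : nat -> R) :
  is_lim_seq b 0 ->
  (forall n m, Cmod (csum (n + m) a - csum n a) <= b n) ->
  exists l, cconv a l /\ forall n, Cmod (l - csum n a) <= b n.
Proof.
  intros Hb Hcau.
  assert (Hcs : forall (p : C -> R), (forall u v, Rabs (p u - p v) <= Cmod (u - v)) ->
     ex_finite_lim_seq (fun n => p (csum n a))).
  { intros p Hp. apply ex_lim_seq_cauchy_corr. intros [eps Heps].
    apply is_lim_seq_spec in Hb. destruct (Hb (mkposreal (eps / 3) ltac:(lra))) as [N HN]. simpl in HN.
    exists N. intros n m Hn Hm. simpl.
    assert (HbN : b N <= eps / 3) by (specialize (HN N ltac:(lia)); apply Rabs_def2 in HN; lra).
    assert (H1 : forall k, (N <= k)%nat -> Rabs (p (csum k a) - p (csum N a)) <= eps / 3).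
    { intros k Hk. replace k with (N + (k - N))%nat by lia.
      via Hp. eapply Rle_trans; [apply Hcau|easy]. }
    replace (p (csum n a) - p (csum m a))
      with ((p (csum n a) - p (csum N a)) - (p (csum m a) - p (csum N a))) by ring.
    eapply Rle_lt_trans; [apply Rabs_triang|]. rewrite Rabs_Ropp.
    generalize (H1 n Hn) (H1 m Hm). lra. }
  assert (HRe : forall u v : C, Rabs (Re u - Re v) <= Cmod (u - v)).
  { intros u v. replace (Re u - Re v) with (Re (u - v)) by (unfold Re, Cminus, Cplus, Copp; simpl; ring).
    eapply Rle_trans; [|apply Rmax_Cmod]. apply Rmax_l. }
  assert (HIm : forall u v : C, Rabs (Im u - Im v) <= Cmod (u - v)).
  { intros u v. replace (Im u - Im v) with (Im (u - v)) by (unfold Im, Cminus, Cplus, Copp; simpl; ring).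
    eapply Rle_trans; [|apply Rmax_Cmod]. apply Rmax_r. }
  destruct (Hcs _ HRe) as [x Hx], (Hcs _ HIm) as [y Hy].
  assert (Hconv : cconv a (x, y)).
  { intros eps Heps. apply is_lim_seq_spec in Hx. apply is_lim_seq_spec in Hy.
    destruct (Hx (mkposreal (eps / 2) ltac:(lra))) as [N HN], (Hy (mkposreal (eps / 2) ltac:(lra))) as [N' HN'].
    simpl in HN, HN'. exists (N + N')%nat. intros n Hn.
    specialize (HN n ltac:(lia)). specialize (HN' n ltac:(lia)).
    via Cmod_le_2Rmax.
    apply Rle_trans with (2 * (eps / 2)); [|lra].
    apply Rmult_le_compat_l; [lra|]. apply Rmax_lub; apply Rlt_le; [exact HN|exact HN']. }
  exists (x, y). split; [exact Hconv|]. intros n. apply le_epsilon. intros eps Heps.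
  destruct (Hconv eps Heps) as [N HN]. specialize (HN (n + N)%nat ltac:(lia)).
  replace ((x, y) - csum n a)%C with ((csum (n + N) a - csum n a) - (csum (n + N) a - (x, y)))%C by ring.
  via Cmod_triangle_minus. specialize (Hcau n N). lra.
Qed.

Lemma cconv_block_bound a l n B :
  cconv a l -> (forall m, Cmod (csum (n + m) a - csum n a) <= B) -> Cmod (l - csum n a) <= B.
Proof.
  intros Hc Hb. apply le_epsilon. intros eps Heps.
  destruct (Hc eps Heps) as [N HN]. specialize (HN (n + N)%nat ltac:(lia)).
  replace (l - csum n a)%C with ((csum (n + N) a - csum n a) - (csum (n + N) a - l))%C by ring.
  via Cmod_triangle_minus. specialize (Hb N). lra.
Qed.

Lemma rsum_geom_bound q n : 0 <= q < 1 -> rsum n (fun i => q ^ i) <= / (1 - q).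
Proof.
  intros Hq. assert (H : rsum n (fun i => q ^ i) * (1 - q) = 1 - q ^ n).
  { induction n as [|n IH]; simpl; [lra|]. rewrite Rmult_plus_distr_r, IH. ring. }
  assert (0 <= q ^ n) by pos.
  apply Rmult_le_reg_r with (1 - q); [lra|]. rewrite H, Rinv_l; lra.
Qed.

Lemma csum_geom (q : C) n : ((1 - q) * csum n (fun i => q ^ i))%C = (1 - q ^ n)%C.
Proof. induction n as [|n IH]; simpl csum; [simpl; ring|]. rewrite Cmult_plus_distr_l, IH, Cpow_S. ring. Qed.

(** * Discrete Parseval identity and Hardy norms *)

Definition eis (t : R) : C := (cos t, sin t).

Lemma eis_plus a b : eis (a + b) = (eis a * eis b)%C.
Proof. unfold eis, Cmult; simpl. rewrite cos_plus, sin_plus. f_equal; ring. Qed.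

Lemma eis_0 : eis 0 = RtoC 1.
Proof. unfold eis, RtoC. now rewrite cos_0, sin_0. Qed.

Lemma eis_conj t : Cconj (eis t) = eis (- t).
Proof. unfold eis, Cconj; simpl. now rewrite cos_neg, sin_neg. Qed.

Lemma eis_pow t n : (eis t ^ n)%C = eis (INR n * t).
Proof.
  induction n as [|n IH]; [simpl; now rewrite Rmult_0_l, eis_0|].
  rewrite Cpow_S, IH, <- eis_plus, S_INR. f_equal; ring.
Qed.

Lemma Cmod_eis t : Cmod (eis t) = 1.
Proof.
  unfold Cmod, eis. transitivity (sqrt 1); [|apply sqrt_1]. f_equal.
  assert (H := sin2_cos2 t). unfold Rsqr in H. simpl. nra.
Qed.

Lemma eis_2PI : eis (2 * PI) = RtoC 1.
Proof. unfold eis, RtoC. now rewrite cos_2PI, sin_2PI. Qed.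

Lemma eis_neq_1 x : 0 < Rabs x < 2 * PI -> eis x <> RtoC 1.
Proof.
  intros Hx E. apply (f_equal fst) in E. simpl in E.
  assert (Hs : sin (x / 2) = 0).
  { replace x with (2 * (x / 2)) in E by field. rewrite cos_2a_sin in E. nra. }
  unfold Rabs in Hx. destruct (Rcase_abs x) as [Hn|Hp].
  - assert (0 < sin (- x / 2)) by (apply sin_gt_0; lra).
    replace (- x / 2) with (- (x / 2)) in H by field. rewrite sin_neg in H. lra.
  - assert (0 < sin (x / 2)) by (apply sin_gt_0; lra). lra.
Qed.

(* The half-step offset keeps the nodes away from [1], and also from [-1] when [N] is even. *)
Definition node (r : R) (N k : nat) : C := (r * eis (PI * (2 * INR k + 1) / INR N))%C.

Lemma Cmod_node r N k : 0 <= r -> Cmod (node r N k) = r.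
Proof. intros H. unfold node. rewrite Cmod_mult, Cmod_eis, Cmod_R, Rabs_pos_eq; lra. Qed.

Lemma csum_single n i (f : nat -> C) :
  (i < n)%nat -> (forall j, (j < n)%nat -> j <> i -> f j = RtoC 0) -> csum n f = f i.
Proof.
  induction n as [|n IH]; intros Hi H; [lia|]. simpl.
  destruct (Nat.eq_dec i n) as [->|Hne].
  - rewrite (csum_ext n f (fun _ => RtoC 0)) by (intros; apply H; lia).
    rewrite csum_zero. ring.
  - rewrite IH by (try lia; intros; apply H; lia). rewrite (H n) by lia. ring.
Qed.

(** The terms form a geometric progression whose ratio is an [N]-th root of unity, different from 1
    because [0 < |i - j| < N]; the half-step offset only contributes a constant factor. *)
Lemma node_orthogonal r N i j :
  (i < N)%nat -> (j < N)%nat -> i <> j ->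
  csum N (fun k => node r N k ^ i * Cconj (node r N k ^ j))%C = RtoC 0.
Proof.
  intros Hi Hj Hij.
  assert (HN : 0 < INR N) by pos.
  set (x := (INR i - INR j) * (2 * PI / INR N)).
  set (q := eis x).
  assert (Hq : q <> RtoC 1).
  { apply eis_neq_1. unfold x. rewrite Rabs_mult, (Rabs_pos_eq (2 * PI / INR N)).
    2:{ apply Rlt_le, Rdiv_lt_0_compat; generalize PI_RGT_0; lra. }
    assert (H0 : 0 < 2 * PI / INR N) by (apply Rdiv_lt_0_compat; generalize PI_RGT_0; lra).
    assert (H1 : 0 < Rabs (INR i - INR j)).
    { apply Rabs_pos_lt. intros E. apply Hij, INR_eq. lra. }
    assert (H2 : Rabs (INR i - INR j) < INR N).
    { apply lt_INR in Hi. apply lt_INR in Hj.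
      generalize (pos_INR i) (pos_INR j); intros. apply Rabs_def1; lra. }
    split; [pos|].
    replace (2 * PI) with (INR N * (2 * PI / INR N)) at 2 by (field; lra).
    now apply Rmult_lt_compat_r. }
  assert (HqN : (q ^ N)%C = RtoC 1).
  { unfold q. rewrite eis_pow.
    replace (INR N * x) with (INR i * (2 * PI) + - (INR j * (2 * PI))) by (unfold x; field; lra).
    rewrite eis_plus, <- eis_conj, <- !eis_pow, eis_2PI, !Cpow_1_l.
    apply injective_projections; simpl; ring. }
  transitivity (csum N (fun k => (RtoC r ^ i * RtoC r ^ j * eis ((INR i - INR j) * (PI / INR N))) * q ^ k)%C).
  - apply csum_ext. intros k _. unfold node. rewrite !Cpow_mult_l, !eis_pow.
    rewrite Cmult_conj, Cpow_conj, eis_conj.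
    rewrite (Cconj_R r).
    unfold q. rewrite eis_pow.
    transitivity (RtoC r ^ i * RtoC r ^ j * (eis (INR i * (PI * (2 * INR k + 1) / INR N)) *
       eis (- (INR j * (PI * (2 * INR k + 1) / INR N)))))%C; [ring|].
    rewrite <- eis_plus.
    rewrite <- (Cmult_assoc (RtoC r ^ i * RtoC r ^ j)), <- eis_plus.
    f_equal. f_equal. unfold x. field. lra.
  - rewrite (csum_scal N _ (fun k => (q ^ k)%C)).
    assert (H := csum_geom q N). rewrite HqN in H.
    assert (H1 : csum N (fun k => q ^ k)%C = RtoC 0); [|rewrite H1; ring].
    replace (csum N (fun k => q ^ k)%C) with (/ (1 - q) * ((1 - q) * csum N (fun k => q ^ k)))%C.
    + rewrite H. ring.
    + field. intros E. apply Hq. apply Ceq_minus. rewrite <- Copp_minus_distr, E. ring.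
Qed.

Definition peval (c : nat -> C) (n : nat) (z : C) : C := csum n (fun i => c i * z ^ i)%C.

(** Exact, since the polynomial has as many coefficients as there are nodes: no two exponents
    coincide modulo [N]. *)
Lemma discrete_Parseval r N c :
  0 <= r ->
  rsum N (fun k => Cmod (peval c N (node r N k)) ^ 2)
  = INR N * rsum N (fun i => Cmod (c i) ^ 2 * r ^ (2 * i)).
Proof.
  intros Hr. apply RtoC_inj. rewrite <- csum_RtoC, <- rsum_scal, <- csum_RtoC.
  transitivity (csum N (fun k => csum N (fun i => csum N (fun j =>
     c i * Cconj (c j) * (node r N k ^ i * Cconj (node r N k ^ j))))))%C.
  { apply csum_ext. intros k _. rewrite <- Cmult_conj_self. unfold peval.
    rewrite csum_mul_conj. apply csum_ext. intros i _. apply csum_ext. intros j _.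
    rewrite Cmult_conj. ring. }
  rewrite csum_swap. apply csum_ext. intros i Hi. rewrite csum_swap.
  transitivity (csum N (fun j => c i * Cconj (c j) *
     csum N (fun k => node r N k ^ i * Cconj (node r N k ^ j))))%C.
  { apply csum_ext. intros j _. now rewrite csum_scal. }
  rewrite (csum_single N i); [|easy|].
  - rewrite Cmult_conj_self.
    rewrite (csum_ext N _ (fun _ => RtoC (r ^ (2 * i)))).
    + rewrite csum_RtoC, rsum_const, <- RtoC_mult. f_equal. ring.
    + intros k _. rewrite Cmult_conj_self, Cmod_pow, Cmod_node by easy.
      f_equal. rewrite <- pow_mult. f_equal. lia.
  - intros j Hj Hne. rewrite node_orthogonal by (try easy; now apply not_eq_sym). ring.
Qed.

(** Cauchy's estimate for polynomials, read off from Parseval by keeping a single term. *)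
Lemma coef_le_sup r n c e i :
  0 <= r -> 0 <= e -> (forall z, Cmod z <= r -> Cmod (peval c n z) <= e) ->
  (i < n)%nat -> Cmod (c i) * r ^ i <= e.
Proof.
  intros Hr He Hb Hi.
  assert (HN : 0 < INR n) by pos.
  assert (H := discrete_Parseval r n c Hr).
  assert (H1 : rsum n (fun k => Cmod (peval c n (node r n k)) ^ 2) <= INR n * e ^ 2).
  { rewrite <- rsum_const. apply rsum_le. intros k _. apply pow_incr.
    split; [pos|apply Hb]. rewrite Cmod_node; lra. }
  rewrite H in H1. apply Rmult_le_reg_l in H1; [|easy].
  assert (H2 : Cmod (c i) ^ 2 * r ^ (2 * i) <= e ^ 2).
  { eapply Rle_trans; [|exact H1].
    apply (rsum_term_le n (fun i => Cmod (c i) ^ 2 * r ^ (2 * i))); [|easy].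
    intros j _. pos. }
  replace (r ^ (2 * i)) with ((r ^ i) ^ 2) in H2 by (rewrite <- pow_mult; f_equal; lia).
  rewrite <- Rpow_mult_distr in H2.
  assert (0 <= Cmod (c i) * r ^ i) by pos.
  apply Rsqr_incr_0; unfold Rsqr; nra.
Qed.

Definition tconv (f : C -> C) (a : nat -> C) : Prop :=
  forall z, inD z -> cconv (fun n => a n * z ^ n)%C (f z).

Lemma taylor_tconv f a : taylor_coeffs f a <-> tconv f a.
Proof. split; intros H z Hz; apply is_series_cconv, H, Hz. Qed.

Lemma peval_block_bound c K q n m z :
  0 <= K -> 0 <= q < 1 ->
  (forall i, Cmod (c i * z ^ i) <= K * q ^ i) ->
  Cmod (peval c (n + m) z - peval c n z) <= K * q ^ n / (1 - q).
Proof.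
  intros HK Hq Hc. unfold peval. rewrite csum_tail.
  via Cmod_csum.
  eapply Rle_trans; [apply rsum_le; intros; apply Hc|].
  rewrite (rsum_ext _ _ (fun i => (K * q ^ n) * q ^ i)) by (intros; rewrite pow_add; ring).
  rewrite rsum_scal. apply Rmult_le_compat_l; [|now apply rsum_geom_bound].
  apply Rmult_le_pos; [easy|pos].
Qed.

Lemma lim_geom K q : 0 <= q < 1 -> is_lim_seq (fun n => K * q ^ n / (1 - q)) 0.
Proof.
  intros Hq. apply is_lim_seq_ext with (fun n => (K / (1 - q)) * q ^ n); [intros; field; lra|].
  apply lim_scal_0, is_lim_seq_geom. rewrite Rabs_pos_eq; lra.
Qed.

Lemma lim_le_eps (b : nat -> R) eps : is_lim_seq b 0 -> 0 < eps ->
  exists N, forall n, (N <= n)%nat -> b n <= eps.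
Proof.
  intros Hb Heps. apply is_lim_seq_spec in Hb. destruct (Hb (mkposreal eps Heps)) as [N HN].
  exists N. intros n Hn. specialize (HN n Hn). simpl in HN. apply Rabs_def2 in HN. lra.
Qed.

Lemma cconv_terms_bounded a l : cconv a l -> exists K, 0 < K /\ forall n, Cmod (a n) <= K.
Proof.
  intros H. destruct (H 1 ltac:(lra)) as [N HN].
  assert (0 <= rsum N (fun i => Cmod (a i))) by pos.
  exists (2 + rsum N (fun i => Cmod (a i))). split; [lra|]. intros n.
  destruct (Nat.lt_ge_cases n N) as [Hn|Hn].
  - assert (H1 := rsum_term_le N (fun i => Cmod (a i)) n (fun j _ => Cmod_ge_0 _) Hn). simpl in H1. lra.
  - assert (H1 := HN n Hn). assert (H2 := HN (S n) ltac:(lia)). simpl in H2.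
    replace (a n) with ((csum n a + a n - l) - (csum n a - l))%C by ring.
    via Cmod_triangle_minus. lra.
Qed.

(** Abel's argument: the terms are bounded at the midpoint [r'] of [r] and 1, hence geometric of
    ratio [r / r'] on the smaller disc. *)
Lemma tconv_uniform f a r eps : tconv f a -> 0 <= r < 1 -> 0 < eps ->
  exists N, forall n, (N <= n)%nat -> forall z, Cmod z <= r -> Cmod (f z - peval a n z) <= eps.
Proof.
  intros H Hr Heps.
  set (r' := (1 + r) / 2).
  assert (Hr' : 0 < r' < 1 /\ r < r') by (unfold r'; lra).
  destruct (cconv_terms_bounded _ _ (H r' ltac:(unfold inD; rewrite Cmod_R, Rabs_pos_eq; lra))) as [K [HK HKb]].
  set (q := r / r').
  assert (Hq : 0 <= q < 1).
  { unfold q; split; [pos|apply Rlt_div_l; lra]. }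
  assert (Hb : forall z, Cmod z <= r -> forall i, Cmod (a i * z ^ i) <= K * q ^ i).
  { intros z Hz i. specialize (HKb i). rewrite Cmod_mult, Cmod_pow, Cmod_R, Rabs_pos_eq in HKb by lra.
    rewrite Cmod_mult, Cmod_pow.
    apply Rle_trans with (Cmod (a i) * r ^ i).
    - apply Rmult_le_compat_l; [pos|]. apply pow_incr; split; [pos|easy].
    - replace (Cmod (a i) * r ^ i) with (Cmod (a i) * r' ^ i * q ^ i).
      + apply Rmult_le_compat_r; [pos|easy].
      + rewrite Rmult_assoc, <- Rpow_mult_distr. f_equal. f_equal. unfold q. field. lra. }
  destruct (lim_le_eps _ _ (lim_geom K q Hq) Heps) as [N HN].
  exists N. intros n Hn z Hz. specialize (HN n Hn).
  eapply Rle_trans; [|exact HN].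
  unfold peval. apply cconv_block_bound with (a := fun n => (a n * z ^ n)%C).
  - apply H. unfold inD. lra.
  - intros m. apply peval_block_bound; [lra|easy|now apply Hb].
Qed.

Lemma le_of_le_pow_scal S K n : 0 <= S ->
  (forall r, 1 / 2 <= r < 1 -> S * r ^ n <= K) -> S <= K.
Proof.
  intros HS H.
  (* The shift by 2 makes these radii start at 1/2, where the hypothesis begins. *)
  assert (Hl : is_lim_seq (fun k => S * (1 - / (INR k + 2)) ^ n) (S * 1)).
  { apply is_lim_seq_mult'; [apply is_lim_seq_const|].
    assert (H1 : is_lim_seq (fun k => 1 - / (INR k + 2)) 1).
    { replace (Finite 1) with (Finite (1 - 0)) by (f_equal; ring).
      apply is_lim_seq_minus'; [apply is_lim_seq_const|].
      apply lim_inv_INR. }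
    clear - H1. induction n as [|n IH]; [apply is_lim_seq_const|].
    replace (Finite 1) with (Finite (1 * 1)) by (f_equal; ring).
    simpl. now apply is_lim_seq_mult'. }
  rewrite Rmult_1_r in Hl.
  refine (is_lim_seq_le _ (fun _ => K) S K _ Hl (is_lim_seq_const K)).
  intros k. apply H. generalize (pos_INR k); intros Hk.
  assert (0 < / (INR k + 2)) by pos.
  assert (/ (INR k + 2) <= / 2) by (apply Rinv_le_contravar; lra).
  lra.
Qed.

(** Stands in for the boundary norm. With many nodes, [f] is close on the circle to its Taylor
    polynomial with [2 * M] coefficients, for which Parseval is exact; then [r] tends to 1. The
    number of nodes is even so that later estimates may also be singular at -1. *)
Lemma coef_bound_of_mean f a K : 0 <= K -> tconv f a ->
  (forall r M, 1 / 2 <= r < 1 -> (1 <= M)%nat ->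
     rsum (2 * M) (fun k => Cmod (f (node r (2 * M) k)) ^ 2) <= INR (2 * M) * K) ->
  l2le a K.
Proof.
  intros HK Ht Hmean D.
  apply le_of_le_pow_scal with (2 * D)%nat.
  { pos. }
  intros r Hr.
  apply Rle_trans with (rsum D (fun i => Cmod (a i) ^ 2 * r ^ (2 * i))).
  { rewrite Rmult_comm, <- rsum_scal. apply rsum_le. intros i Hi. rewrite Rmult_comm.
    apply Rmult_le_compat_l; [pos|].

    replace (2 * D)%nat with (2 * i + (2 * D - 2 * i))%nat by lia. rewrite pow_add.
    rewrite <- (Rmult_1_r (r ^ (2 * i))) at 2. apply Rmult_le_compat_l; [pos|].
    rewrite <- (pow1 (2 * D - 2 * i)). apply pow_incr; lra. }
  apply le_epsilon. intros eps Heps.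
  (* Chosen so that [(1 + e) * K + 2 * e <= K + eps]. *)
  set (e := Rmin 1 (eps / (K + 2))).
  assert (He : 0 < e <= 1 /\ e * (K + 2) <= eps).
  { unfold e. assert (0 < eps / (K + 2)) by pos.
    split; [split; [apply Rmin_pos; lra|apply Rmin_l]|].
    apply Rle_trans with (eps / (K + 2) * (K + 2)); [apply Rmult_le_compat_r; [lra|apply Rmin_r]|].
    right; field; lra. }
  destruct (tconv_uniform f a r e Ht) as [N0 HN0]; [lra|lra|].
  set (M := (N0 + D + 1)%nat).
  assert (HM : 0 < INR (2 * M)) by pos.
  apply Rle_trans with (rsum (2 * M) (fun i => Cmod (a i) ^ 2 * r ^ (2 * i))).
  { apply rsum_mono; [|lia]. intros; apply Rmult_le_pos; [pos|pos]. }
  apply Rmult_le_reg_l with (INR (2 * M)); [easy|].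
  rewrite <- discrete_Parseval by lra.
  apply Rle_trans with (rsum (2 * M) (fun k => (1 + e) * Cmod (f (node r (2 * M) k)) ^ 2 + 2 * e)).
  { apply rsum_le. intros k _. set (z := node r (2 * M) k).
    specialize (HN0 (2 * M)%nat ltac:(lia) z). unfold z in HN0 at 1. rewrite Cmod_node in HN0 by lra.
    rewrite Cmod_minus_sym in HN0.
    assert (H1 := Cmod_le_minus (peval a (2 * M) z) (f z)).
    assert (H2 := Cmod_ge_0 (peval a (2 * M) z)).
    set (x := Cmod (f z)) in *.
    apply Rle_trans with ((x + e) ^ 2); [apply pow_incr; lra|].
    (* For [e <= 1] this square gives [(x + e)^2 <= (1 + e) * x^2 + 2 * e], which leaves only the
       mean of [x^2]. *)
    assert (0 <= e * (x - 1) ^ 2) by pos. nra. }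
  rewrite rsum_plus, rsum_scal, rsum_const.
  specialize (Hmean r M Hr ltac:(lia)).
  nra.
Qed.

(** The difference of the sequences expands the zero function, so the mean bound with [K = 0] kills
    every coefficient. *)
Lemma tconv_unique f a b : tconv f a -> tconv f b -> a = b.
Proof.
  intros Ha Hb. apply functional_extensionality. intros n.
  assert (Ht : tconv (fun _ => RtoC 0) (fun n => a n + (-1) * b n)%C).
  { intros z Hz. replace (RtoC 0) with (f z + (-1) * f z)%C by ring.
    apply cconv_ext with (fun n => a n * z ^ n + (-1) * (b n * z ^ n))%C; [intros; ring|].
    apply cconv_lin; auto. }
  assert (H := coef_bound_of_mean _ _ 0 (Rle_refl 0) Ht).
  specialize (H ltac:(intros r M _ _; right; rewrite (rsum_ext _ _ (fun _ => 0)), rsum_const; [ring|intros; rewrite Cmod_0; ring])).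
  specialize (H (S n)).
  assert (H1 := rsum_term_le (S n) (fun i => Cmod (a i + (-1) * b i) ^ 2) n (fun j _ => pow2_ge_0 _) ltac:(lia)).
  simpl in H1.
  assert (H2 : Cmod (a n + (-1) * b n) = 0) by (simpl in H; nra).
  apply Cmod_eq_0 in H2. apply Ceq_minus. rewrite <- H2. ring.
Qed.

Lemma H2coef_eq f a : tconv f a -> H2coef f = a.
Proof.
  intros H. apply (tconv_unique f); [|easy]. apply taylor_tconv.
  unfold H2coef. apply epsilon_spec. exists a. now apply taylor_tconv.
Qed.

Lemma H2norm_le f a K : 0 <= K -> tconv f a -> l2le a K ->
  in_H2 f /\ H2norm f <= sqrt K.
Proof.
  intros HK Ht Hb.
  destruct (ex_series_of_bounded _ K (fun n => pow2_ge_0 (Cmod (a n))) Hb) as [H1 H2].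
  split.
  - exists a. split; [now apply taylor_tconv|easy].
  - unfold H2norm. rewrite (H2coef_eq f a Ht). now apply sqrt_le_1_alt.
Qed.

Lemma in_H2_coef f : in_H2 f ->
  tconv f (H2coef f) /\ l2le (H2coef f) (H2norm f ^ 2).
Proof.
  intros [a [Ht Hs]]. apply taylor_tconv in Ht. rewrite (H2coef_eq f a Ht). split; [easy|].
  intros D. unfold H2norm. rewrite (H2coef_eq f a Ht), pow2_sqrt.
  - apply (rsum_le_Series (fun n => Cmod (a n) ^ 2)); [pos|easy].
  - apply Rle_trans with (rsum 0 (fun n => Cmod (a n) ^ 2)); [simpl; lra|].
    apply (rsum_le_Series (fun n => Cmod (a n) ^ 2)); [pos|easy].
Qed.

Lemma H2norm_ge_0 f : 0 <= H2norm f.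
Proof. pos. Qed.

Lemma in_H2_ext f g : (forall z, inD z -> f z = g z) -> in_H2 f -> in_H2 g /\ H2norm g = H2norm f.
Proof.
  intros E [a [Ht Hs]].
  assert (Ht' : taylor_coeffs g a) by (intros z Hz; rewrite <- E by easy; now apply Ht).
  split; [now exists a|].
  unfold H2norm. apply taylor_tconv in Ht, Ht'. now rewrite (H2coef_eq _ _ Ht), (H2coef_eq _ _ Ht').
Qed.

Lemma in_H2_lin f g c : in_H2 f -> in_H2 g ->
  in_H2 (fun z => f z + c * g z)%C /\
  H2coef (fun z => f z + c * g z)%C = (fun n => H2coef f n + c * H2coef g n)%C.
Proof.
  intros Hf Hg. destruct (in_H2_coef f Hf) as [Tf Bf], (in_H2_coef g Hg) as [Tg Bg].
  assert (Ht : tconv (fun z => f z + c * g z)%C (fun n => H2coef f n + c * H2coef g n)%C).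
  { intros z Hz. apply cconv_ext with (fun n => H2coef f n * z ^ n + c * (H2coef g n * z ^ n))%C; [intros; ring|].
    apply cconv_lin; auto. }
  split; [|now apply H2coef_eq].
  set (K := 2 * H2norm f ^ 2 + 2 * (Cmod c ^ 2 * H2norm g ^ 2)).
  refine (proj1 (H2norm_le _ _ K _ Ht _)).
  - unfold K. generalize (pow2_ge_0 (H2norm f)) (pow2_ge_0 (H2norm g)) (pow2_ge_0 (Cmod c)); nra.
  - intros D. apply Rle_trans with (rsum D (fun i => 2 * Cmod (H2coef f i) ^ 2 + 2 * (Cmod c ^ 2 * Cmod (H2coef g i) ^ 2))).
    + apply rsum_le. intros i _. rewrite <- Rpow_mult_distr, <- Cmod_mult. apply Cmod_sq_plus_le.
    + rewrite rsum_plus, !rsum_scal. unfold K. specialize (Bf D).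
      generalize (pow2_ge_0 (Cmod c)); intros.
      assert (Cmod c ^ 2 * rsum D (fun i => Cmod (H2coef g i) ^ 2) <= Cmod c ^ 2 * H2norm g ^ 2)
        by now apply Rmult_le_compat_l.
      lra.
Qed.

Lemma in_H2_fsub f g : in_H2 f -> in_H2 g -> in_H2 (fsub f g).
Proof.
  intros Hf Hg. destruct (in_H2_lin f g (-1) Hf Hg) as [H _].
  refine (proj1 (in_H2_ext _ _ _ H)). intros z _. unfold fsub. ring.
Qed.

(** [N = 0] is the bound by the reproducing kernel; large [N] is what gains smallness away from 1
    and -1 in the compactness proof. *)
Lemma tail_Cauchy_Schwarz f a B z N : tconv f a -> l2le a B ->
  inD z -> Cmod (f z - peval a N z) ^ 2 <= B * (Cmod z ^ 2) ^ N / (1 - Cmod z ^ 2).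
Proof.
  intros Ht HB Hz. unfold inD in Hz. assert (Hz0 := Cmod_ge_0 z).
  assert (HB0 : 0 <= B) by (specialize (HB 0%nat); simpl in HB; easy).
  assert (Hz2 : 0 <= Cmod z ^ 2 < 1) by (simpl; nra).
  set (Q := B * (Cmod z ^ 2) ^ N / (1 - Cmod z ^ 2)).
  assert (HQ : 0 <= Q).
  { unfold Q. apply Rdiv_le_0_compat; [|lra]. pos. }
  rewrite <- (pow2_sqrt Q) by easy. apply pow_incr. split; [pos|].
  apply cconv_block_bound with (a := fun n => (a n * z ^ n)%C); [now apply Ht|].
  intros m. rewrite csum_tail.
  rewrite <- (sqrt_pow2 (Cmod _)) by apply Cmod_ge_0. apply sqrt_le_1_alt.
  via Cmod_csum_Cauchy_Schwarz.
  unfold Q, Rdiv. rewrite Rmult_assoc. apply Rmult_le_compat.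
  - pos.
  - pos.
  - eapply Rle_trans; [|apply (HB (N + m)%nat)]. rewrite rsum_add.
    assert (0 <= rsum N (fun i => Cmod (a i) ^ 2)) by pos. lra.
  - rewrite (rsum_ext _ _ (fun i => (Cmod z ^ 2) ^ N * (Cmod z ^ 2) ^ i)).
    + rewrite rsum_scal. apply Rmult_le_compat_l; [pos|now apply rsum_geom_bound].
    + intros i _. rewrite Cmod_pow, <- !pow_mult, <- pow_add. f_equal. lia.
Qed.

Lemma tconv_point f a B z : tconv f a -> l2le a B -> inD z -> Cmod (f z) ^ 2 <= B / (1 - Cmod z ^ 2).
Proof.
  intros Ht HB Hz. assert (H := tail_Cauchy_Schwarz f a B z 0 Ht HB Hz).
  unfold peval in H. simpl csum in H. rewrite pow_O, Rmult_1_r in H.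
  replace (f z - 0)%C with (f z) in H by ring. exact H.
Qed.

Lemma point_evaluation f z : in_H2 f -> inD z -> Cmod (f z) ^ 2 <= H2norm f ^ 2 / (1 - Cmod z ^ 2).
Proof.
  intros Hf Hz. destruct (in_H2_coef f Hf) as [Ht HB]. exact (tconv_point f _ _ z Ht HB Hz).
Qed.

(** * Locally uniform limits of polynomials *)

Definition ispoly (f : C -> C) : Prop := exists n c, forall z, f z = peval c n z.

Lemma peval_pad c n m z : (n <= m)%nat ->
  peval (fun i => if lt_dec i n then c i else RtoC 0) m z = peval c n z.
Proof.
  intros H. replace m with (n + (m - n))%nat by lia. unfold peval. rewrite csum_add.
  rewrite (csum_ext (m - n) _ (fun _ => RtoC 0)).
  - rewrite csum_zero, Cplus_0_r. apply csum_ext. intros i Hi. now destruct (lt_dec i n).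
  - intros i Hi. destruct (lt_dec (n + i) n); [lia|ring].
Qed.

Lemma ispoly_const c : ispoly (fun _ => c).
Proof. exists 1%nat, (fun _ => c). intros z. unfold peval; simpl. ring. Qed.

Lemma ispoly_plus f g : ispoly f -> ispoly g -> ispoly (fun z => f z + g z)%C.
Proof.
  intros [n [c Hf]] [m [d Hg]].
  exists (n + m)%nat, (fun i => (if lt_dec i n then c i else RtoC 0) + (if lt_dec i m then d i else RtoC 0))%C.
  intros z. rewrite Hf, Hg, <- (peval_pad c n (n + m)), <- (peval_pad d m (n + m)) by lia.
  unfold peval. rewrite <- csum_plus. apply csum_ext. intros i _. ring.
Qed.

Lemma ispoly_scal c f : ispoly f -> ispoly (fun z => c * f z)%C.
Proof.
  intros [n [d Hf]]. exists n, (fun i => c * d i)%C. intros z. rewrite Hf.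
  unfold peval. rewrite <- csum_scal. apply csum_ext. intros; ring.
Qed.

Lemma ispoly_mulX f : ispoly f -> ispoly (fun z => z * f z)%C.
Proof.
  intros [n [d Hf]].
  exists (1 + n)%nat, (fun i => match i with O => RtoC 0 | S j => d j end). intros z. rewrite Hf.
  unfold peval. rewrite csum_add. simpl csum at 2. rewrite <- csum_scal.
  transitivity (0 + csum n (fun i => z * (d i * z ^ i)))%C; [ring|]. f_equal; [simpl; ring|].
  apply csum_ext. intros. simpl Nat.add. rewrite Cpow_S. ring.
Qed.

Lemma ispoly_ext f g : (forall z, f z = g z) -> ispoly f -> ispoly g.
Proof. intros E [n [c H]]. exists n, c. intros z. now rewrite <- E. Qed.

Lemma ispoly_mult f g : ispoly f -> ispoly g -> ispoly (fun z => f z * g z)%C.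
Proof.
  intros [n [c Hf]] Hg.
  apply ispoly_ext with (fun z => csum n (fun i => c i * (z ^ i * g z)))%C.
  { intros z. rewrite Hf. unfold peval. rewrite Cmult_comm, <- csum_scal.
    apply csum_ext. intros; ring. }
  clear f Hf. induction n as [|n IH]; [exact (ispoly_const 0)|].
  apply (ispoly_plus (fun z => csum n (fun i => c i * (z ^ i * g z)))%C (fun z => c n * (z ^ n * g z))%C); [exact IH|]. apply ispoly_scal.
  clear IH. induction n as [|n IH].
  - apply ispoly_ext with g; [|easy]. intros; simpl; ring.
  - apply ispoly_ext with (fun z => z * (z ^ n * g z))%C; [intros; rewrite Cpow_S; ring|].
    now apply ispoly_mulX.
Qed.

Lemma ispoly_bounded f : ispoly f -> exists B, 0 < B /\ forall z, Cmod z <= 1 -> Cmod (f z) <= B.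
Proof.
  intros [n [c H]].
  assert (0 <= rsum n (fun i => Cmod (c i))) by pos.
  exists (rsum n (fun i => Cmod (c i)) + 1). split; [lra|].
  intros z Hz. rewrite H. apply Rle_trans with (rsum n (fun i => Cmod (c i))); [|lra].
  via Cmod_csum. apply rsum_le. intros i _.
  rewrite Cmod_mult, Cmod_pow. rewrite <- (Rmult_1_r (Cmod (c i))) at 2.
  apply Rmult_le_compat_l; [pos|]. rewrite <- (pow1 i). apply pow_incr.
  split; [pos|easy].
Qed.

(* Analyticity on the disc, in Runge form. *)
Definition papp (F : C -> C) : Prop :=
  forall r eps, 0 < r < 1 -> 0 < eps ->
    exists p, ispoly p /\ forall z, Cmod z <= r -> Cmod (F z - p z) <= eps.

Lemma papp_lim F :
  (forall r eps, 0 < r < 1 -> 0 < eps ->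
    exists G, papp G /\ forall z, Cmod z <= r -> Cmod (F z - G z) <= eps) -> papp F.
Proof.
  intros H r eps Hr He.
  destruct (H r (eps / 2) Hr ltac:(lra)) as [G [HG HFG]].
  destruct (HG r (eps / 2) Hr ltac:(lra)) as [p [Hp HGp]].
  exists p. split; [easy|]. intros z Hz. specialize (HFG z Hz). specialize (HGp z Hz).
  replace (F z - p z)%C with ((F z - G z) + (G z - p z))%C by ring.
  eapply Rle_trans; [apply Cmod_triangle|lra].
Qed.

Lemma papp_poly p : ispoly p -> papp p.
Proof.
  intros Hp r eps _ He. exists p. split; [easy|]. intros z _.
  replace (p z - p z)%C with (RtoC 0) by ring. rewrite Cmod_0. lra.
Qed.

Lemma papp_const c : papp (fun _ => c).
Proof. apply papp_poly, ispoly_const. Qed.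

Lemma papp_id : papp (fun z => z).
Proof.
  apply papp_poly. apply ispoly_ext with (fun z => z * RtoC 1)%C; [intros; ring|].
  apply (ispoly_mulX (fun _ => RtoC 1)), ispoly_const.
Qed.

Lemma papp_ext F G : (forall z, inD z -> F z = G z) -> papp F -> papp G.
Proof.
  intros E H r eps Hr He. destruct (H r eps Hr He) as [p [Hp HFp]]. exists p. split; [easy|].
  intros z Hz. rewrite <- E by (unfold inD; lra). now apply HFp.
Qed.

Lemma papp_plus F G : papp F -> papp G -> papp (fun z => F z + G z)%C.
Proof.
  intros HF HG r eps Hr He.
  destruct (HF r (eps / 2) Hr ltac:(lra)) as [p [Hp HFp]].
  destruct (HG r (eps / 2) Hr ltac:(lra)) as [q [Hq HGq]].
  exists (fun z => p z + q z)%C. split; [now apply ispoly_plus|].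
  intros z Hz. specialize (HFp z Hz). specialize (HGq z Hz).
  replace (F z + G z - (p z + q z))%C with ((F z - p z) + (G z - q z))%C by ring.
  eapply Rle_trans; [apply Cmod_triangle|lra].
Qed.

Lemma papp_bounded F r : papp F -> 0 < r < 1 -> exists B, 0 < B /\ forall z, Cmod z <= r -> Cmod (F z) <= B.
Proof.
  intros HF Hr. destruct (HF r 1 Hr ltac:(lra)) as [p [Hp HFp]].
  destruct (ispoly_bounded p Hp) as [B [HB HpB]].
  exists (B + 1). split; [lra|]. intros z Hz. specialize (HFp z Hz). specialize (HpB z ltac:(lra)).
  generalize (Cmod_le_minus (F z) (p z)). lra.
Qed.

Lemma papp_mult F G : papp F -> papp G -> papp (fun z => F z * G z)%C.
Proof.
  intros HF HG r eps Hr He.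
  destruct (papp_bounded F r HF Hr) as [B [HB HFB]].
  destruct (HG r (eps / (2 * B)) Hr) as [q [Hq HGq]]; [pos|].
  destruct (ispoly_bounded q Hq) as [B' [HB' HqB]].
  destruct (HF r (eps / (2 * B')) Hr) as [p [Hp HFp]]; [pos|].
  exists (fun z => p z * q z)%C. split; [now apply ispoly_mult|].
  intros z Hz. specialize (HFp z Hz). specialize (HGq z Hz). specialize (HqB z ltac:(lra)). specialize (HFB z Hz).
  replace (F z * G z - p z * q z)%C with (F z * (G z - q z) + (F z - p z) * q z)%C by ring.
  via Cmod_triangle. rewrite !Cmod_mult.
  assert (Cmod (F z) * Cmod (G z - q z) <= B * (eps / (2 * B)))
    by (apply Rmult_le_compat; try apply Cmod_ge_0; easy).
  assert (Cmod (F z - p z) * Cmod (q z) <= eps / (2 * B') * B')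
    by (apply Rmult_le_compat; try apply Cmod_ge_0; easy).
  replace (B * (eps / (2 * B))) with (eps / 2) in H by (field; lra).
  replace (eps / (2 * B') * B') with (eps / 2) in H0 by (field; lra). lra.
Qed.

Lemma papp_minus F G : papp F -> papp G -> papp (fun z => F z - G z)%C.
Proof.
  intros HF HG. apply papp_ext with (fun z => F z + (-1) * G z)%C; [intros; ring|].
  apply papp_plus; [easy|]. apply papp_mult; [apply papp_const|easy].
Qed.

Lemma papp_csum n (F : nat -> C -> C) : (forall i, (i < n)%nat -> papp (F i)) -> papp (fun z => csum n (fun i => F i z)).
Proof.
  induction n as [|n IH]; intros H; [exact (papp_const 0)|].
  apply (papp_plus (fun z => csum n (fun i => F i z)) (F n)); [apply IH; intros; apply H; lia|apply H; lia].
Qed.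

Lemma papp_pow F n : papp F -> papp (fun z => F z ^ n)%C.
Proof.
  intros H. induction n as [|n IH]; [exact (papp_const 1)|].
  apply papp_ext with (fun z => F z * F z ^ n)%C; [intros; now rewrite Cpow_S|].
  now apply papp_mult.
Qed.

(** Polynomials approximate [G] uniformly only on smaller discs, hence the condition that [L] map
    each of these into another one. *)
Lemma papp_comp G L : papp G -> papp L ->
  (forall r, 0 < r < 1 -> exists rho, 0 < rho < 1 /\ forall z, Cmod z <= r -> Cmod (L z) <= rho) ->
  papp (fun z => G (L z)).
Proof.
  intros HG HL Hrho. apply papp_lim. intros r eps Hr He.
  destruct (Hrho r Hr) as [rho [Hr' HLr]].
  destruct (HG rho eps Hr' He) as [p [[n [c Hp]] HGp]].
  exists (fun z => peval c n (L z)). split.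
  - apply papp_csum. intros i _. apply papp_mult; [apply papp_const|now apply papp_pow].
  - intros z Hz. rewrite <- Hp. apply HGp. now apply HLr.
Qed.

Lemma Cmod_one_minus_geom q n : Cmod q < 1 ->
  Cmod (/ (1 - q) - csum n (fun i => q ^ i))%C <= Cmod q ^ n / (1 - Cmod q).
Proof.
  intros Hq.
  assert (H1 : 1 - Cmod q <= Cmod (1 - q)).
  { generalize (Cmod_le_minus 1 (1 - q)). replace (1 - (1 - q))%C with q by ring. rewrite Cmod_1. lra. }
  assert (Hne : (1 - q)%C <> RtoC 0) by (apply Cmod_gt_0; lra).
  replace (/ (1 - q) - csum n (fun i => q ^ i))%C with (q ^ n / (1 - q))%C.
  - rewrite Cmod_div, Cmod_pow by easy. apply Rmult_le_compat_l; [pos|].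
    apply Rinv_le_contravar; lra.
  - assert (H := csum_geom q n).
    replace (q ^ n)%C with (1 - (1 - q) * csum n (fun i => q ^ i))%C by (rewrite H; ring).
    field. easy.
Qed.

(* On a bounded set in [Re Q >= m > 0] the values lie in a disc of centre [c] and radius [< c] for [c] large,
   where the Neumann series of [1/Q] around [c] converges uniformly. *)
Lemma papp_inv Q : papp Q ->
  (forall r, 0 < r < 1 -> exists m, 0 < m /\ forall z, Cmod z <= r -> m <= Re (Q z)) ->
  papp (fun z => / Q z)%C.
Proof.
  intros HQ Hre. apply papp_lim. intros r eps Hr He.
  destruct (Hre r Hr) as [m [Hm HmQ]].
  destruct (papp_bounded Q r HQ Hr) as [B0 [HB0 HQB0]].
  set (B := B0 + m).
  assert (HB : m < B) by (unfold B; lra).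
  assert (HQB : forall z, Cmod z <= r -> Cmod (Q z) <= B) by (intros z Hz; specialize (HQB0 z Hz); unfold B; lra).
  (* [|c - Q|^2 = c^2 - 2 c Re Q + |Q|^2 <= c^2 - 2 c m + B^2], and this choice turns the right side
     into [c^2 - B^2]. Enlarging the bound to [B > m] ensures [c > B]. *)
  set (c := B ^ 2 / m).
  assert (Hcm : c * m = B ^ 2) by (unfold c; field; lra).
  assert (HcB : B < c) by nra.
  set (q0 := sqrt (1 - B ^ 2 / c ^ 2)).
  assert (Hb : 0 < B ^ 2 / c ^ 2 < 1).
  { split; [pos|].
    apply Rlt_div_l; [pos|nra]. }
  assert (Hq0 : 0 <= q0 < 1).
  { split; [apply sqrt_pos|]. rewrite <- sqrt_1. unfold q0. apply sqrt_lt_1_alt. lra. }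
  assert (Hq : forall z, Cmod z <= r -> Cmod (1 - Q z / c) <= q0).
  { intros z Hz. specialize (HmQ z Hz). specialize (HQB z Hz).
    rewrite <- (sqrt_pow2 (Cmod _)) by apply Cmod_ge_0. apply sqrt_le_1_alt.
    replace (1 - Q z / c)%C with (/ c * (c - Q z))%C by (field; intros E; apply RtoC_inj in E; lra).
    rewrite <- RtoC_inv by lra. rewrite Cmod_mult, Cmod_R, Rpow_mult_distr, (Rabs_pos_eq (/ c)) by pos.
    rewrite Cmod_sq.
    assert (HQ2 : Re (Q z) ^ 2 + Im (Q z) ^ 2 <= B ^ 2).
    { rewrite <- Cmod_sq. apply pow_incr. split; [pos|easy]. }
    replace (Re (c - Q z)) with (c - Re (Q z)) by (unfold Re, Cminus, Cplus, Copp, RtoC; simpl; ring).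
    replace (Im (c - Q z)) with (- Im (Q z)) by (unfold Im, Cminus, Cplus, Copp, RtoC; simpl; ring).
    replace (1 - B ^ 2 / c ^ 2) with ((/ c) ^ 2 * (c ^ 2 - B ^ 2)) by (field; lra).
    apply Rmult_le_compat_l; [pos|]. nra. }
  destruct (lim_le_eps _ _ (lim_geom (/ c) q0 Hq0) He) as [n Hn].
  exists (fun z => / c * csum n (fun i => (1 - Q z / c) ^ i))%C. split.
  - apply papp_mult; [apply papp_const|]. apply (papp_csum n (fun i z => (1 - Q z / c) ^ i)%C).
    intros i _. apply papp_pow. apply papp_minus; [apply papp_const|]. apply papp_mult; [easy|apply papp_const].
  - intros z Hz. specialize (Hq z Hz). specialize (Hn n (le_n n)). specialize (HmQ z Hz).
    assert (HQ0 : Q z <> RtoC 0) by (intros E; rewrite E in HmQ; unfold Re, RtoC in HmQ; simpl in HmQ; lra).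
    assert (Hc0 : RtoC c <> RtoC 0) by (intros E; apply RtoC_inj in E; lra).
    set (q := (1 - Q z / c)%C) in *.
    replace (/ Q z)%C with (/ c * / (1 - q))%C by (unfold q; field; split; [easy|]; replace (c - (c - Q z))%C with (Q z) by ring; easy).
    replace (/ c * / (1 - q) - / c * csum n (fun i => q ^ i))%C with (/ c * (/ (1 - q) - csum n (fun i => q ^ i)))%C by ring.
    rewrite Cmod_mult, <- RtoC_inv, Cmod_R, Rabs_pos_eq by pos.
    eapply Rle_trans; [|exact Hn]. unfold Rdiv. rewrite Rmult_assoc.
    apply Rmult_le_compat_l; [pos|].
    eapply Rle_trans; [apply Cmod_one_minus_geom; lra|].
    apply Rmult_le_compat; [pos|pos| |].
    + apply pow_incr. split; [pos|easy].
    + apply Rinv_le_contravar; lra.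
Qed.

Lemma papp_of_tconv f a : tconv f a -> papp f.
Proof.
  intros H r eps Hr He. destruct (tconv_uniform f a r eps H ltac:(lra) He) as [N HN].
  exists (peval a N). split; [now exists N, a|]. apply (HN N (le_n N)).
Qed.

Lemma papp_of_in_H2 f : in_H2 f -> papp f.
Proof. intros H. exact (papp_of_tconv f _ (proj1 (in_H2_coef f H))). Qed.

Lemma clim_of_cauchy (c : nat -> C) (b : nat -> R) :
  is_lim_seq b 0 -> (forall k l, (k <= l)%nat -> Cmod (c l - c k) <= b k) ->
  exists x, forall k, Cmod (x - c k) <= b k.
Proof.
  intros Hb Hc.
  set (d := fun n => match n with O => c O | S m => (c (S m) - c m)%C end).
  assert (Hd : forall n, csum (S n) d = c n).
  { induction n as [|n IH]; [simpl; ring|]. simpl csum in *. rewrite IH. unfold d. ring. }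
  destruct (cconv_cauchy d (fun n => match n with O => Cmod (c O) + b O | S m => b m end)) as [l [_ Hl]].
  - apply is_lim_seq_incr_1. exact Hb.
  - intros [|n] m.
    + simpl Nat.add. destruct m as [|m].
      * simpl. replace (0 - 0)%C with (RtoC 0) by ring. rewrite Cmod_0.
        generalize (Cmod_ge_0 (c O)) (Hc O O (le_n O)) (Cmod_ge_0 (c O - c O)). lra.
      * rewrite Hd. simpl csum. replace (c m - 0)%C with (c m) by ring.
        generalize (Cmod_le_minus (c m) (c O)) (Hc O m ltac:(lia)). lra.
    + simpl Nat.add. rewrite !Hd. apply Hc. lia.
  - exists l. intros k. specialize (Hl (S k)). now rewrite Hd in Hl.
Qed.

(** The coefficients of the approximating polynomials are Cauchy by [coef_le_sup]; their limits are
    the Taylor coefficients, with an error explicit enough to be summed against [z^i]. *)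
Lemma papp_taylor F : papp F -> exists a, tconv F a.
Proof.
  (* [e k] is at once the approximation error and the distance of the [k]-th circle to the unit
     circle. *)
  intros HF. set (e := fun k : nat => / (INR k + 2)).
  assert (He : forall k, 0 < e k <= / 2).
  { intros k. unfold e. generalize (pos_INR k); intros. split; [pos|apply Rinv_le_contravar; lra]. }
  assert (Hem : forall k l, (k <= l)%nat -> e l <= e k).
  { intros k l H. unfold e. apply le_INR in H. generalize (pos_INR k); intros. apply Rinv_le_contravar; lra. }
  assert (Hel : is_lim_seq e 0) by apply lim_inv_INR.
  (* Coefficients are padded by zeros so that two polynomials can be compared at a common length
     [m]. *)
  assert (Hp : forall k, exists nc : nat * (nat -> C), forall m z, (fst nc <= m)%nat -> Cmod z <= 1 - e k ->
     Cmod (F z - peval (snd nc) m z) <= e k).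
  { intros k. specialize (He k). destruct (HF (1 - e k) (e k)) as [p [[n [c Hp]] Hb]]; [lra|lra|].
    exists (n, fun i => if lt_dec i n then c i else RtoC 0). simpl. intros m z Hm Hz.
    rewrite peval_pad, <- Hp by easy. now apply Hb. }
  destruct (functional_choice _ Hp) as [nc Hnc]. clear Hp.
  set (c := fun k => snd (nc k)). set (N := fun k => fst (nc k)).
  assert (Hcau : forall i k l, (k <= l)%nat -> Cmod (c l i - c k i) <= 2 * e k * / (1 - e k) ^ i).
  { intros i k l Hkl. specialize (Hem k l Hkl). assert (Hk := He k).
    assert (Hpos : 0 < (1 - e k) ^ i) by pos.
    apply Rle_div_r; [easy|].
    apply (coef_le_sup (1 - e k) (N k + N l + i + 1) (fun j => c l j - c k j)%C); [lra|lra| |lia].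
    intros z Hz. set (m := (N k + N l + i + 1)%nat).
    replace (peval _ m z) with ((F z - peval (c k) m z) - (F z - peval (c l) m z))%C.
    - via Cmod_triangle_minus.
      assert (H1 := Hnc k m z ltac:(unfold m, N; lia) Hz). assert (H2 := Hnc l m z ltac:(unfold m, N; lia) ltac:(lra)).
      unfold c. lra.
    - unfold peval. transitivity (csum m (fun j => c l j * z ^ j) - csum m (fun j => c k j * z ^ j))%C; [ring|].
      rewrite <- csum_minus. apply csum_ext. intros; ring. }
  assert (Hlim : forall i, exists x, forall k, Cmod (x - c k i) <= 2 * e k * / (1 - e k) ^ i).
  { intros i. apply clim_of_cauchy; [|now apply Hcau].
    apply is_lim_seq_le_le with (u := fun _ => 0) (w := fun k => 2 * 2 ^ i * e k).
    - intros k. assert (Hk := He k). split; [apply Rlt_le; assert (0 < (1 - e k) ^ i) by pos; pos|].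
      replace (2 * 2 ^ i * e k) with (2 * e k * 2 ^ i) by ring. apply Rmult_le_compat_l; [lra|].
      rewrite <- pow_inv. apply pow_incr. split; [pos|].
      rewrite <- (Rinv_inv 2). apply Rinv_le_contravar; lra.
    - apply is_lim_seq_const.
    - now apply lim_scal_0. }
  destruct (functional_choice _ Hlim) as [a Ha].
  exists a. intros z Hz eps Heps. unfold inD in Hz.
  (* Once [1 - e k >= rho], the factor [|z|^i / (1 - e k)^i] is at most [q^i] with
     [q = |z| / rho < 1]. *)
  set (rho := (1 + Cmod z) / 2). assert (Hz0 := Cmod_ge_0 z).
  assert (Hrho : 0 < rho < 1 /\ Cmod z < rho) by (unfold rho; lra).
  destruct (lim_le_eps _ (1 - rho) Hel ltac:(lra)) as [k0 Hk0].
  set (q := Cmod z / rho).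
  assert (Hq : 0 <= q < 1) by (unfold q; split; [pos|apply Rlt_div_l; lra]).
  destruct (lim_le_eps _ eps (lim_scal_0 e (1 + 2 / (1 - q)) Hel) Heps) as [k1 Hk1].
  set (k := (k0 + k1)%nat). specialize (Hk0 k ltac:(lia)). specialize (Hk1 k ltac:(lia)). assert (Hk := He k).
  exists (N k). intros n Hn. eapply Rle_trans; [|exact Hk1].
  change (csum n (fun n => a n * z ^ n)%C) with (peval a n z).
  assert (H1 := Hnc k n z Hn ltac:(lra)). fold (c k) in H1.
  assert (H2 : Cmod (peval a n z - peval (c k) n z) <= 2 * e k * / (1 - q)).
  { unfold peval. rewrite <- csum_minus. via Cmod_csum.
    apply Rle_trans with (rsum n (fun i => (2 * e k) * q ^ i)).
    - apply rsum_le. intros i _. replace (a i * z ^ i - c k i * z ^ i)%C with ((a i - c k i) * z ^ i)%C by ring.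
      rewrite Cmod_mult, Cmod_pow.
      apply Rle_trans with (2 * e k * / (1 - e k) ^ i * Cmod z ^ i); [apply Rmult_le_compat_r; [pos|apply Ha]|].
      rewrite Rmult_assoc, <- pow_inv, <- Rpow_mult_distr. apply Rmult_le_compat_l; [lra|].
      apply pow_incr. rewrite Rmult_comm. split; [pos|].
      apply Rmult_le_compat_l; [easy|]. apply Rinv_le_contravar; lra.
    - rewrite rsum_scal. apply Rmult_le_compat_l; [lra|now apply rsum_geom_bound]. }
  replace (peval a n z - F z)%C with ((peval a n z - peval (c k) n z) - (F z - peval (c k) n z))%C by ring.
  via Cmod_triangle_minus.
  replace ((1 + 2 / (1 - q)) * e k) with (e k + 2 * e k * / (1 - q)) by (field; lra). lra.
Qed.

(** The membership and norm criterion for images under the operators: analyticity together with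
    uniformly bounded node means. *)
Lemma in_H2_of_mean F K : 0 <= K -> papp F ->
  (forall r M, 1 / 2 <= r < 1 -> (1 <= M)%nat ->
     rsum (2 * M) (fun k => Cmod (F (node r (2 * M) k)) ^ 2) <= INR (2 * M) * K) ->
  in_H2 F /\ H2norm F <= sqrt K.
Proof.
  intros HK HF Hm. destruct (papp_taylor F HF) as [a Ha].
  apply (H2norm_le F a K HK Ha). now apply (coef_bound_of_mean F).
Qed.

(** * Complex powers *)

Lemma Re_pos_neq_0 z : 0 < Re z -> z <> RtoC 0.
Proof. intros H E. rewrite E in H. unfold Re, RtoC in H; simpl in H; lra. Qed.

Lemma Cpowr_eis z c : z <> RtoC 0 -> Cpowr z c = (RtoC (Rpower (Cmod z) c) * eis (c * Carg z))%C.
Proof.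
  intros Hz. unfold Cpowr. destruct (Req_EM_T (Cmod z) 0) as [E|E].
  - now apply Cmod_eq_0 in E.
  - apply injective_projections; simpl; ring.
Qed.

Lemma Cmod_Cpowr z c : z <> RtoC 0 -> Cmod (Cpowr z c) = Rpower (Cmod z) c.
Proof.
  intros Hz. rewrite Cpowr_eis, Cmod_mult, Cmod_eis, Cmod_R, Rabs_pos_eq by pos. ring.
Qed.

Lemma Carg_Re_pos z : 0 < Re z -> Carg z = atan (Im z / Re z).
Proof. intros H. unfold Carg. destruct (Rlt_dec 0 (Re z)); easy. Qed.

Lemma Cmod_Re_Im z : Cmod z = sqrt (Re z ^ 2 + Im z ^ 2).
Proof. reflexivity. Qed.

Lemma Carg_bound z : 0 < Re z -> - (PI / 2) < Carg z < PI / 2.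
Proof. intros H. rewrite Carg_Re_pos by easy. generalize (atan_bound (Im z / Re z)). lra. Qed.

Lemma Cmod_eis_Carg z : 0 < Re z -> z = (RtoC (Cmod z) * eis (Carg z))%C.
Proof.
  intros H. assert (Hm : Cmod z = Re z * sqrt (1 + (Im z / Re z)²)).
  { rewrite Cmod_Re_Im. rewrite <- (sqrt_pow2 (Re z)) at 2 by lra. rewrite <- sqrt_mult_alt by apply pow2_ge_0.
    f_equal. unfold Rsqr. field. lra. }
  assert (0 < sqrt (1 + (Im z / Re z)²)).
  { apply sqrt_lt_R0. generalize (Rle_0_sqr (Im z / Re z)). lra. }
  rewrite Carg_Re_pos by easy. unfold eis. rewrite cos_atan, sin_atan, Hm.
  apply injective_projections; simpl; unfold Rsqr in *.
  - change (fst z) with (Re z). field. split; lra.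
  - change (snd z) with (Im z). field. split; lra.
Qed.

(** The real mean value theorem is applied to [Re] and [Im] at possibly different points; the factor
    2 pays for recombining them. *)
Lemma complex_mean_value (Y D : R -> C) w E t u :
  t <= u -> 0 <= E ->
  (forall s, t <= s <= u -> is_derive (fun s => Re (Y s)) s (Re (D s)) /\ is_derive (fun s => Im (Y s)) s (Im (D s))) ->
  (forall s, t <= s <= u -> Cmod (D s - w) <= E) ->
  Cmod (Y u - Y t - (u - t)%R * w) <= 2 * E * (u - t).
Proof.
  intros Htu HE HD HB.
  assert (Hp : forall p : C -> R, (forall a b, p (a - b)%C = p a - p b) -> (forall (x : R) a, p (x * a)%C = x * p a) ->
    (forall a, Rabs (p a) <= Cmod a) ->
    (forall s, t <= s <= u -> is_derive (fun s => p (Y s)) s (p (D s))) ->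
    Rabs (p (Y u - Y t - (u - t)%R * w)%C) <= E * (u - t)).
  { intros p Hm Hs Ha Hd.
    destruct (MVT_gen (fun s => p (Y s)) t u (fun s => p (D s))) as [x [Hx Hxe]].
    - intros x Hx. rewrite Rmin_left, Rmax_right in Hx by lra. apply Hd. lra.
    - intros x Hx. rewrite Rmin_left, Rmax_right in Hx by lra. apply continuity_pt_filterlim.
      apply (ex_derive_continuous (fun s => p (Y s))). eexists. apply Hd. lra.
    - rewrite Rmin_left, Rmax_right in Hx by lra.
      rewrite !Hm, Hs, Hxe. replace (p (D x) * (u - t) - (u - t) * p w) with (p (D x - w)%C * (u - t)) by (rewrite Hm; ring).
      rewrite Rabs_mult, (Rabs_pos_eq (u - t)) by lra. apply Rmult_le_compat_r; [lra|].
      via Ha. apply HB. lra. }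
  via Cmod_le_2Rmax.
  assert (Hr := Hp Re). assert (Hi := Hp Im).
  specialize (Hr ltac:(intros; unfold Re, Cminus, Cplus, Copp; simpl; ring) ltac:(intros; apply re_scal_l)
     re_le_Cmod ltac:(intros; now apply HD)).
  specialize (Hi ltac:(intros; unfold Im, Cminus, Cplus, Copp; simpl; ring) ltac:(intros; apply im_scal_l)
     ltac:(intros a; eapply Rle_trans; [apply Rmax_r|apply Rmax_Cmod]) ltac:(intros; now apply HD)).
  rewrite Rmult_assoc. apply Rmult_le_compat_l; [lra|]. apply Rmax_lub; [exact Hr|exact Hi].
Qed.

(** In the right half-plane the power is explicit in [exp], [ln] and [atan]. The logarithmic modulus
    and the argument have as derivatives [c] times the real and imaginary parts of
    [v / (1 + t v)]. *)
Lemma is_derive_Cpowr_ray v c t : 0 < 1 + t * Re v ->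
  let Y (s : R) := Cpowr (1 + s * v) c in
  let D := (c * (v / (1 + t * v)) * Cpowr (1 + t * v) c)%C in
  is_derive (fun s => Re (Y s)) t (Re D) /\ is_derive (fun s => Im (Y s)) t (Im D).
Proof.
  intros Hx Y D.
  set (p := Re v) in *. set (s0 := Im v).
  assert (Hloc : locally t (fun s => 0 < 1 + s * p)).
  { apply (open_comp (fun s => 1 + s * p) (fun y => 0 < y)); [|apply open_gt|exact Hx].
    intros y _. apply (continuous_plus (fun _ => 1) (fun s => s * p)); [apply continuous_const|].
    apply (continuous_mult (fun s => s) (fun _ => p)); [apply continuous_id|apply continuous_const]. }
  assert (Hre : forall s : R, Re (1 + s * v) = 1 + s * p).
  { intros s. unfold p, Re, Cplus, Cmult, RtoC; simpl; ring. }
  assert (Him : forall s : R, Im (1 + s * v) = s * s0).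
  { intros s. unfold s0, Im, Cplus, Cmult, RtoC; simpl; ring. }
  assert (HY : forall s, 0 < 1 + s * p ->
     Y s = (exp (c * ln (sqrt ((1 + s * p) ^ 2 + (s * s0) ^ 2))) * cos (c * atan (s * s0 / (1 + s * p))),
            exp (c * ln (sqrt ((1 + s * p) ^ 2 + (s * s0) ^ 2))) * sin (c * atan (s * s0 / (1 + s * p))))).
  { intros s Hs. unfold Y. rewrite <- Hre in Hs. rewrite Cpowr_eis by now apply Re_pos_neq_0.
    rewrite Carg_Re_pos by easy. rewrite Hre, Him, Cmod_Re_Im, Hre, Him. unfold Rpower.
    apply injective_projections; simpl; ring. }
  set (R2 := (1 + t * p) ^ 2 + (t * s0) ^ 2).
  assert (HR2 : 0 < R2) by (unfold R2; generalize (pow2_ge_0 (t * s0)); nra).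
  assert (Hq : (v / (1 + t * v))%C = ((p * (1 + t * p) + s0 * (t * s0)) / R2, (s0 * (1 + t * p) - p * (t * s0)) / R2)).
  { unfold Cdiv, Cinv.
    change (fst (1 + t * v)%C) with (Re (1 + t * v)). change (snd (1 + t * v)%C) with (Im (1 + t * v)).
    rewrite Hre, Him. fold R2. unfold p, s0, Re, Im.
    apply injective_projections; unfold Cmult; simpl; field; lra. }
  assert (Hsq : sqrt R2 * sqrt R2 = R2) by (apply sqrt_sqrt; lra).
  assert (Hs0 : 0 < sqrt R2) by now apply sqrt_lt_R0.
  assert (Hat : 1 + t * s0 / (1 + t * p) * (t * s0 / (1 + t * p)) = R2 / (1 + t * p) ^ 2).
  { unfold R2. field. lra. }
  assert (HL : is_derive (fun s => c * ln (sqrt ((1 + s * p) ^ 2 + (s * s0) ^ 2))) t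
     (c * ((p * (1 + t * p) + s0 * (t * s0)) / R2))).
  { auto_derive.
    - replace ((1 + t * p) * ((1 + t * p) * 1) + t * s0 * (t * s0 * 1)) with R2 by (unfold R2; ring). easy.
    - replace ((1 + t * p) * ((1 + t * p) * 1) + t * s0 * (t * s0 * 1)) with R2 by (unfold R2; ring).
      rewrite <- Hsq at 3. unfold R2. field. fold R2. lra. }
  assert (HA : is_derive (fun s => c * atan (s * s0 / (1 + s * p))) t
     (c * ((s0 * (1 + t * p) - p * (t * s0)) / R2))).
  { auto_derive; [lra|]. rewrite <- ?Rmult_assoc.
    replace (R2) with ((1 + t * p) ^ 2 + (t * s0) ^ 2) by reflexivity. unfold Rsqr. field.
    unfold R2 in HR2. split; lra. }
  assert (HD : D = Cmult (c * ((p * (1 + t * p) + s0 * (t * s0)) / R2), c * ((s0 * (1 + t * p) - p * (t * s0)) / R2)) (Y t))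
    by (unfold D; rewrite Hq; f_equal; apply injective_projections; simpl; ring).
  set (L := fun s => c * ln (sqrt ((1 + s * p) ^ 2 + (s * s0) ^ 2))) in *.
  set (A := fun s => c * atan (s * s0 / (1 + s * p))) in *.
  assert (HYt : Y t = (exp (L t) * cos (A t), exp (L t) * sin (A t))) by exact (HY t Hx).
  rewrite HD, HYt.
  split.
  - apply is_derive_ext_loc with (fun s => exp (L s) * cos (A s)).
    { apply filter_imp with (2 := Hloc). intros s Hs. now rewrite HY. }
    evar_last.
    + apply (is_derive_mult (fun s => exp (L s)) (fun s => cos (A s))).
      * apply (is_derive_comp exp L); [apply is_derive_exp|exact HL].
      * apply (is_derive_comp cos A); [apply is_derive_cos|exact HA].
      * intros; apply Rmult_comm.
    + unfold Re, plus, scal, mult; simpl. unfold mult; simpl. ring.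
  - apply is_derive_ext_loc with (fun s => exp (L s) * sin (A s)).
    { apply filter_imp with (2 := Hloc). intros s Hs. now rewrite HY. }
    evar_last.
    + apply (is_derive_mult (fun s => exp (L s)) (fun s => sin (A s))).
      * apply (is_derive_comp exp L); [apply is_derive_exp|exact HL].
      * apply (is_derive_comp sin A); [apply is_derive_sin|exact HA].
      * intros; apply Rmult_comm.
    + unfold Im, plus, scal, mult; simpl. unfold mult; simpl. ring.
Qed.

Fixpoint euler (c h : R) (n : nat) (v : C) : C :=
  match n with
  | O => RtoC 1
  | S m => (euler c h m v * (1 + h * c * (v / (1 + (INR m * h)%R * v))))%C
  end.

Lemma papp_one_plus_inv t : 0 <= t <= 1 -> papp (fun v => v / (1 + t * v))%C.
Proof.
  intros Ht. apply papp_mult; [apply papp_id|]. apply papp_inv.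
  - apply papp_plus; [apply papp_const|]. apply papp_mult; [apply papp_const|apply papp_id].
  - intros r Hr. exists (1 - r). split; [lra|]. intros z Hz.
    replace (Re (1 + t * z)) with (1 + t * Re z) by (unfold Re, Cplus, Cmult, RtoC; simpl; ring).
    assert (H := re_le_Cmod z). assert (Rabs (Re z) <= r) by lra.
    apply Rabs_le_between in H0. nra.
Qed.

Lemma papp_euler c h n : 0 <= h -> INR n * h <= 1 -> papp (euler c h n).
Proof.
  intros Hh. induction n as [|n IH]; intros Hn; [exact (papp_const 1)|].
  rewrite S_INR in Hn. generalize (pos_INR n); intros.
  apply (papp_mult (euler c h n)); [apply IH; nra|].
  apply papp_plus; [apply papp_const|]. apply papp_mult; [apply papp_const|].
  apply papp_one_plus_inv. nra.
Qed.

Lemma ray_bound r v t : Cmod v <= r -> r < 1 -> 0 <= t <= 1 ->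
  0 < 1 + t * Re v /\ 1 - r <= Cmod (1 + t * v) <= 2.
Proof.
  intros Hv Hr Ht.
  assert (H := re_le_Cmod v). assert (H0 : Rabs (Re v) <= r) by lra.
  apply Rabs_le_between in H0. split; [nra|].
  assert (Htv : Cmod (t * v) <= r).
  { rewrite Cmod_mult, Cmod_R, Rabs_pos_eq by lra. generalize (Cmod_ge_0 v). nra. }
  split.
  - generalize (Cmod_le_minus 1 (1 + t * v)). replace (1 - (1 + t * v))%C with (- (t * v))%C by ring.
    rewrite Cmod_opp, Cmod_1. lra.
  - via Cmod_triangle. rewrite Cmod_1. lra.
Qed.

Lemma Rpower_le_exp_bound x c r : 0 < r <= 1 -> r <= x <= 2 -> Rpower x c <= exp (Rabs c * (2 - ln r)).
Proof.
  intros Hr Hx. unfold Rpower.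
  assert (H1 : Rabs (ln x) <= 2 - ln r).
  { assert (ln r <= ln x) by (apply ln_le; lra). assert (ln x <= ln 2) by (apply ln_le; lra).
    assert (ln 2 <= 1). { rewrite <- (ln_exp 1). apply ln_le; [lra|]. generalize (exp_ineq1_le 1). lra. }
    apply Rabs_le. lra. }
  destruct (Rle_lt_dec (c * ln x) (Rabs c * (2 - ln r))) as [H|H].
  - destruct H as [H|H]; [apply Rlt_le, exp_increasing, H|rewrite H; lra].
  - exfalso. assert (c * ln x <= Rabs c * Rabs (ln x)) by (rewrite <- Rabs_mult; apply Rle_abs).
    assert (Rabs c * Rabs (ln x) <= Rabs c * (2 - ln r)) by (apply Rmult_le_compat_l; [pos|easy]). lra.
Qed.

(** The two inputs of Euler's method, uniform in [v]: the growth rate [K1] and the local truncation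
    error [K2 (u - t)^2]. The second follows from a Lipschitz bound on the derivative, obtained from
    one on the solution. *)
Lemma Cpowr_ray_step r (c : R) : 0 < r < 1 -> exists K1 K2, 0 < K1 /\ 0 < K2 /\
  forall v, Cmod v <= r -> forall t u : R, 0 <= t -> t <= u -> u <= 1 ->
   Cmod (c * (v / (1 + t * v))) <= K1 /\
   Cmod (Cpowr (1 + u * v) c - Cpowr (1 + t * v) c
         - (u - t)%R * (c * (v / (1 + t * v)) * Cpowr (1 + t * v) c)) <= K2 * (u - t) ^ 2.
Proof.
  intros Hr. set (B := exp (Rabs c * (2 - ln (1 - r)))).
  assert (HB : 0 < B) by apply exp_pos.
  set (m := / (1 - r)). assert (Hm : 0 < m) by (apply Rinv_0_lt_compat; lra).
  set (k := (Rabs c + 1) * m). assert (Hc := Rabs_pos c).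
  assert (Hk : 0 < k) by (unfold k; nra).
  exists k, (2 * (k * m * B + k * (2 * (k * B)))).
  split; [easy|]. split; [assert (0 < k * m * B) by pos; assert (0 < k * (2 * (k * B))) by pos; lra|].
  intros v Hv t u Ht Htu Hu.
  assert (Hq : forall s : R, 0 <= s <= 1 -> Cmod (v / (1 + s * v)) <= m).
  { intros s Hs. destruct (ray_bound r v s Hv ltac:(lra) Hs) as [_ H].
    rewrite Cmod_div by (apply Cmod_gt_0; lra). unfold m.
    rewrite <- (Rmult_1_l (/ (1 - r))). unfold Rdiv. apply Rmult_le_compat.
    - pos.
    - apply Rlt_le, Rinv_0_lt_compat. lra.
    - lra.
    - apply Rinv_le_contravar; lra. }
  assert (Hcq : forall s : R, 0 <= s <= 1 -> Cmod (c * (v / (1 + s * v))) <= k).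
  { intros s Hs. rewrite Cmod_mult, Cmod_R. specialize (Hq s Hs). unfold k.
    apply Rmult_le_compat; try apply Rabs_pos; try apply Cmod_ge_0; lra. }
  assert (HY : forall s : R, 0 <= s <= 1 -> Cmod (Cpowr (1 + s * v) c) <= B).
  { intros s Hs. destruct (ray_bound r v s Hv ltac:(lra) Hs) as [_ H].
    rewrite Cmod_Cpowr by (apply Cmod_gt_0; lra). apply Rpower_le_exp_bound; lra. }
  split; [apply Hcq; lra|].
  set (Y := fun s : R => Cpowr (1 + s * v) c).
  set (D := fun s : R => (c * (v / (1 + s * v)) * Cpowr (1 + s * v) c)%C).
  assert (HDer : forall s : R, 0 <= s <= 1 -> is_derive (fun s => Re (Y s)) s (Re (D s)) /\ is_derive (fun s => Im (Y s)) s (Im (D s))).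
  { intros s Hs. apply (is_derive_Cpowr_ray v c s). now apply (ray_bound r v s Hv ltac:(lra)). }
  assert (HLip : forall s, t <= s <= u -> Cmod (Y s - Y t) <= 2 * (k * B) * (s - t)).
  { intros s Hs. replace (Y s - Y t)%C with (Y s - Y t - (s - t)%R * 0)%C by ring.
    apply (complex_mean_value Y D).
    - lra.
    - pos.
    - intros x Hx. apply HDer. lra.
    - intros x Hx. replace (D x - 0)%C with (D x) by ring. unfold D. rewrite Cmod_mult.
      apply Rmult_le_compat; try apply Cmod_ge_0; [apply Hcq; lra|apply HY; lra]. }
  assert (HDL : forall s, t <= s <= u -> Cmod (D s - D t) <= (k * m * B + k * (2 * (k * B))) * (u - t)).
  { intros s Hs.
    destruct (ray_bound r v s Hv ltac:(lra) ltac:(lra)) as [_ H1].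
    destruct (ray_bound r v t Hv ltac:(lra) ltac:(lra)) as [_ H2].
    (* Splits the change of the coefficient, [v/(1+sv) - v/(1+tv) = (t-s) v^2 / ((1+sv)(1+tv))],
       from the change of the solution. *)
    replace (D s - D t)%C with ((t - s)%R * (c * (v / (1 + s * v))) * (v / (1 + t * v)) * Y s
       + c * (v / (1 + t * v)) * (Y s - Y t))%C.
    2:{ unfold D, Y. rewrite RtoC_minus. field. split; apply Cmod_gt_0; lra. }
    via Cmod_triangle. rewrite !Cmod_mult, (Cmod_R (t - s)).
    assert (Hts : Rabs (t - s) <= u - t) by (apply Rabs_le; lra).
    specialize (HLip s Hs).
    assert (P1 : Rabs (t - s) * (Cmod c * Cmod (v / (1 + s * v))) * Cmod (v / (1 + t * v)) * Cmod (Y s) <= (u - t) * k * m * B).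
    { rewrite <- (Cmod_mult c). repeat apply Rmult_le_compat;
        repeat apply Rmult_le_pos; try apply Rabs_pos; try apply Cmod_ge_0; try easy.
      - apply Hcq; lra.
      - apply Hq; lra.
      - apply HY; lra. }
    assert (P2 : Cmod c * Cmod (v / (1 + t * v)) * Cmod (Y s - Y t) <= k * (2 * (k * B) * (u - t))).
    { rewrite <- Cmod_mult. apply Rmult_le_compat; try apply Cmod_ge_0; [apply Hcq; lra|].
      via HLip. apply Rmult_le_compat_l; [|lra].
      apply Rlt_le, Rmult_lt_0_compat; [lra|pos]. }
    lra. }
  eapply Rle_trans.
  - apply (complex_mean_value Y D (D t) ((k * m * B + k * (2 * (k * B))) * (u - t)) t u Htu).
    + apply Rmult_le_pos; [|lra]. assert (0 < k * m * B) by pos.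
      assert (0 < k * (2 * (k * B))) by pos. lra.
    + intros s Hs. apply HDer. lra.
    + exact HDL.
  - right. ring.
Qed.

Lemma exp_pow_INR x n : exp x ^ n = exp (INR n * x).
Proof.
  induction n as [|n IH]; [simpl; now rewrite Rmult_0_l, exp_0|].
  rewrite S_INR, Rmult_plus_distr_r, exp_plus, <- IH, Rmult_1_l. simpl; ring.
Qed.

(* [t |-> (1 + t v)^c] solves [y' = c v / (1 + t v) y]; its Euler polygons are rational in [v]
   and converge uniformly on smaller discs. *)
Lemma papp_Cpowr c : papp (fun v => Cpowr (1 + v) c).
Proof.
  apply papp_lim. intros r eps Hr He.
  destruct (Cpowr_ray_step r c Hr) as [K1 [K2 [HK1 [HK2 Hstep]]]].
  (* The global error is at most [n * K2 h^2 * (1 + h K1)^n <= K2 * exp K1 * h], with [h = 1/n]. *)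
  destruct (nfloor_ex (K2 * exp K1 / eps)) as [n0 [_ Hn0]].
  { apply Rdiv_le_0_compat; [|easy]. pos. }
  set (n := S n0). set (h := / INR n).
  assert (Hn : 0 < INR n) by (apply (lt_INR 0); unfold n; lia).
  assert (Hh : 0 < h) by now apply Rinv_0_lt_compat.
  assert (Hnh : INR n * h = 1) by (unfold h; field; lra).
  exists (euler c h n). split; [apply papp_euler; lra|].
  intros v Hv.
  set (Y := fun s : R => Cpowr (1 + s * v) c).
  (* Error recursion: the error after a step is at most [1 + h K1] times the previous one plus
     [K2 h^2]. *)
  assert (Herr : forall j, (j <= n)%nat ->
    Cmod (Y (INR j * h) - euler c h j v) <= INR j * (K2 * h ^ 2) * (1 + h * K1) ^ j).
  { induction j as [|j IH]; intros Hj.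
    - unfold Y. simpl. rewrite Rmult_0_l.
      replace (Cpowr (1 + 0 * v) c) with (RtoC 1).
      + replace (1 - 1)%C with (RtoC 0) by ring. rewrite Cmod_0. lra.
      + replace (1 + 0 * v)%C with (RtoC 1) by ring.
        assert (Ha : Carg 1 = 0).
        { rewrite Carg_Re_pos by (simpl; lra). simpl. unfold Rdiv. now rewrite Rmult_0_l, atan_0. }
        rewrite Cpowr_eis by apply C1_nz. rewrite Cmod_1, Ha, Rmult_0_r, eis_0.
        unfold Rpower. rewrite ln_1, Rmult_0_r, exp_0. ring.
    - specialize (IH ltac:(lia)).
      assert (Hjh : 0 <= INR j * h) by pos.
      assert (HSj : INR (S j) * h <= 1).
      { rewrite <- Hnh. apply Rmult_le_compat_r; [lra|]. now apply le_INR. }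
      destruct (Hstep v Hv (INR j * h) (INR (S j) * h)) as [S1 S2]; [easy|rewrite S_INR; nra|easy|].
      replace (INR (S j) * h - INR j * h) with h in S2 by (rewrite S_INR; ring).
      cbn [euler]. set (q := (c * (v / (1 + (INR j * h)%R * v)))%C) in *.
      fold (Y (INR (S j) * h)) (Y (INR j * h)) in S2.
      set (y := Y (INR j * h)) in *. set (e := euler c h j v) in *.
      set (y1 := Y (INR (S j) * h)) in *.
      replace (y1 - e * (1 + h * c * (v / (1 + (INR j * h)%R * v))))%C
        with ((y1 - y - h * (q * y)) + (y - e) * (1 + h * q))%C by (unfold q; ring).
      via Cmod_triangle. rewrite Cmod_mult.
      assert (S3 : Cmod (1 + h * q) <= 1 + h * K1).
      { via Cmod_triangle. rewrite Cmod_1, Cmod_mult, Cmod_R, Rabs_pos_eq by lra. nra. }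
      assert (H1p : 1 <= 1 + h * K1) by nra.
      set (p := 1 + h * K1) in *.
      assert (Hp1 : 1 <= p ^ S j) by now apply pow_R1_Rle.
      assert (S4 : Cmod (y - e) * Cmod (1 + h * q) <= INR j * (K2 * h ^ 2) * p ^ j * p)
        by (apply Rmult_le_compat; try apply Cmod_ge_0; easy).
      rewrite S_INR. assert (0 < K2 * h ^ 2) by pos.
      simpl pow in Hp1 |- *. simpl pow in S2, S4, H. nra. }
  specialize (Herr n (le_n n)). rewrite Hnh in Herr. unfold Y in Herr.
  replace (1 + 1 * v)%C with (1 + v)%C in Herr by ring.
  via Herr.
  assert (Hexp : (1 + h * K1) ^ n <= exp K1).
  { replace (exp K1) with (exp (h * K1) ^ n).
    - apply pow_incr. split; [nra|apply exp_ineq1_le].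
    - rewrite exp_pow_INR, <- Rmult_assoc, Hnh. f_equal; ring. }
  apply Rle_trans with (INR n * (K2 * h ^ 2) * exp K1).
  { apply Rmult_le_compat_l; [|easy]. apply Rmult_le_pos; [lra|]. pos. }
  replace (INR n * (K2 * h ^ 2) * exp K1) with (K2 * exp K1 * h) by (replace (K2 * exp K1 * h) with (K2 * exp K1 * h * (INR n * h)) by (rewrite Hnh; ring); ring).
  apply Rle_div_l; [easy|].
  rewrite <- S_INR in Hn0. fold n in Hn0.
  replace (K2 * exp K1) with (eps * (K2 * exp K1 / eps)) by (field; lra).
  apply Rmult_le_compat_l; lra.
Qed.

(** * The lens map *)

Lemma Rpower_pos x y : 0 < Rpower x y.
Proof. pos. Qed.

Lemma Rpower_anti_l a b c : a <= 0 -> 0 < b <= c -> Rpower c a <= Rpower b a.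
Proof.
  intros Ha Hbc. replace a with (- - a) by ring. rewrite !(Rpower_Ropp _ (- a)).
  apply Rinv_le_contravar; [pos|]. apply Rle_Rpower_l; lra.
Qed.

Lemma Rpower_le_1 x a : 0 <= a -> 0 < x <= 1 -> Rpower x a <= 1.
Proof. intros Ha Hx. replace 1 with (Rpower 1 a) by (unfold Rpower; now rewrite ln_1, Rmult_0_r, exp_0). apply Rle_Rpower_l; lra. Qed.

Lemma Rpower_1_l a : Rpower 1 a = 1.
Proof. unfold Rpower. now rewrite ln_1, Rmult_0_r, exp_0. Qed.

Lemma Rpower_ge_1 x a : 0 <= a -> 1 <= x -> 1 <= Rpower x a.
Proof. intros Ha Hx. apply Rle_trans with (Rpower 1 a); [rewrite Rpower_1_l; lra|apply Rle_Rpower_l; lra]. Qed.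

(** The distances to -1 and to 1 carry all size estimates. [kap] is the cosine of the largest phase,
    [th * PI / 2], that can occur in the relevant products of powers. *)
Definition sg (z : C) : R := Cmod (1 + z).
Definition de (z : C) : R := Cmod (1 - z).
Definition kap (th : R) : R := cos (th * (PI / 2)).

Lemma kap_bounds th : 0 < th < 1 -> 0 < kap th <= 1.
Proof.
  intros H. generalize PI_RGT_0; intros. split; [|apply COS_bound].
  apply cos_gt_0; nra.
Qed.

Lemma cos_ge_kap th x : 0 < th < 1 -> Rabs x <= th * (PI / 2) -> kap th <= cos x.
Proof.
  intros H Hx. generalize PI_RGT_0; intros. unfold kap.
  replace (cos x) with (cos (Rabs x)) by (unfold Rabs; destruct (Rcase_abs x); [apply cos_neg|easy]).
  generalize (Rabs_pos x); intros. apply cos_decr_1; nra.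
Qed.

Lemma Re_one_pm z : inD z -> 0 < Re (1 + z) /\ 0 < Re (1 - z).
Proof.
  intros H. unfold inD in H. assert (H1 := re_le_Cmod z).
  assert (H2 : Rabs (Re z) < 1) by lra. apply Rabs_def2 in H2.
  unfold Re, Cminus, Cplus, Copp, RtoC in *; simpl in *. lra.
Qed.

Lemma sg_de_bounds z : inD z -> 0 < sg z <= 2 /\ 0 < de z <= 2 /\ 2 <= sg z + de z.
Proof.
  intros H. destruct (Re_one_pm z H) as [H1 H2]. unfold inD in H. unfold sg, de.
  apply Re_pos_neq_0, Cmod_gt_0 in H1. apply Re_pos_neq_0, Cmod_gt_0 in H2.
  repeat split; try easy.
  - via Cmod_triangle. rewrite Cmod_1. lra.
  - via Cmod_triangle_minus. rewrite Cmod_1. lra.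
  - eapply Rle_trans; [|apply Cmod_triangle]. replace (1 + z + (1 - z))%C with (RtoC 2) by (ring).
    rewrite Cmod_R, Rabs_pos_eq; lra.
Qed.

Lemma sg_de_ge r z : Cmod z <= r -> 1 - r <= sg z /\ 1 - r <= de z.
Proof.
  intros H. split.
  - generalize (Cmod_le_minus 1 (1 + z)). replace (1 - (1 + z))%C with (- z)%C by ring. rewrite Cmod_opp, Cmod_1. unfold sg. lra.
  - generalize (Cmod_le_minus 1 (1 - z)). replace (1 - (1 - z))%C with z by ring. rewrite Cmod_1. unfold de. lra.
Qed.

(** The bound on [al - be] is the one that uses the disc: [Re ((1+z) conj(1-z)) = 1 - |z|^2 > 0].
    The phases do not depend on [th]. *)
Lemma one_pm_phases z : inD z -> exists al be,
  Rabs al < PI / 2 /\ Rabs be < PI / 2 /\ Rabs (al - be) < PI / 2 /\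
  forall th, Cpowr (1 + z) th = (RtoC (Rpower (sg z) th) * eis (th * al))%C /\
             Cpowr (1 - z) th = (RtoC (Rpower (de z) th) * eis (th * be))%C.
Proof.
  intros H. destruct (Re_one_pm z H) as [H1 H2].
  destruct (sg_de_bounds z H) as [Hs [Hd _]].
  exists (Carg (1 + z)), (Carg (1 - z)).
  assert (B1 := Carg_bound _ H1). assert (B2 := Carg_bound _ H2).
  repeat split; try (apply Rabs_def1; lra).
  - assert (E1 := Cmod_eis_Carg _ H1). assert (E2 := Cmod_eis_Carg _ H2).
    set (al := Carg (1 + z)) in *. set (be := Carg (1 - z)) in *.
    fold (sg z) in E1. fold (de z) in E2.
    assert (Hc : 0 < cos (al - be)).
    { assert (E : ((1 + z) * Cconj (1 - z))%C = (RtoC (sg z * de z) * eis (al - be))%C).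
      { rewrite E1, E2, Cmult_conj, eis_conj. unfold Rminus. rewrite eis_plus, RtoC_mult.
        rewrite (Cconj_R (de z)). ring. }
      apply (f_equal Re) in E. rewrite re_scal_l in E. unfold eis, Re in E. simpl fst in E.
      unfold inD in H.
      assert (Hz : Re z ^ 2 + Im z ^ 2 < 1) by (rewrite <- Cmod_sq; generalize (Cmod_ge_0 z); simpl; nra).
      assert (Hp : 0 < sg z * de z) by pos.
      unfold Cconj, Cminus, Cplus, Copp, Cmult, RtoC, Re, Im in *. simpl in *. nra. }
    apply Rnot_le_lt. intros Hge. revert Hc. apply Rle_not_lt.
    replace (cos (al - be)) with (cos (Rabs (al - be))) by (unfold Rabs; destruct (Rcase_abs (al - be)); [apply cos_neg|easy]).
    assert (Rabs (al - be) < PI) by (apply Rabs_def1; lra).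
    apply cos_le_0; lra.
  - apply Cpowr_eis. now apply Re_pos_neq_0.
  - apply Cpowr_eis. now apply Re_pos_neq_0.
Qed.

Lemma Re_le_Cmod z : Re z <= Cmod z.
Proof. eapply Rle_trans; [apply Rle_abs|apply re_le_Cmod]. Qed.

Lemma Rabs_scal_le th x B : 0 < th -> Rabs x < B -> Rabs (th * x) <= th * B.
Proof. intros Ht Hx. rewrite Rabs_mult, Rabs_pos_eq by lra. apply Rmult_le_compat_l; lra. Qed.

Lemma papp_comp_opp F : papp F -> papp (fun z => F (- z)%C).
Proof.
  intros HF. apply (papp_comp F (fun z => - z)%C); [easy| |].
  - apply papp_ext with (fun z => 0 - z)%C; [intros; ring|]. apply papp_minus; [apply papp_const|apply papp_id].
  - intros r Hr. exists r. split; [easy|]. intros z Hz. now rewrite Cmod_opp.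
Qed.

Section Lens.

Context (th : R) (Hth : 0 < th < 1).

Notation P z := (Cpowr (1 + z) th).
Notation M z := (Cpowr (1 - z) th).

Lemma Cmod_P z : inD z -> Cmod (P z) = Rpower (sg z) th.
Proof. intros H. apply Cmod_Cpowr, Re_pos_neq_0, Re_one_pm, H. Qed.

Lemma Cmod_M z : inD z -> Cmod (M z) = Rpower (de z) th.
Proof. intros H. apply Cmod_Cpowr, Re_pos_neq_0, Re_one_pm, H. Qed.

Lemma pow_sg_le_2 x : 0 < x <= 2 -> Rpower x th <= 2.
Proof.
  intros Hx. apply Rle_trans with (Rpower 2 th); [apply Rle_Rpower_l; lra|].
  rewrite <- (Rpower_1 2) at 2 by lra. apply Rle_Rpower; lra.
Qed.

Lemma Re_P_M z : inD z -> kap th * Rpower (sg z) th <= Re (P z) /\ kap th * Rpower (de z) th <= Re (M z).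
Proof.
  intros H. destruct (one_pm_phases z H) as [al [be [Ha [Hb [_ E]]]]].
  destruct (E th) as [-> ->]. rewrite !re_scal_l. unfold eis, Re; simpl fst.
  rewrite !(Rmult_comm (kap th)).
  split; apply Rmult_le_compat_l; try (apply Rlt_le, Rpower_pos); apply cos_ge_kap; try easy; apply Rabs_scal_le; lra.
Qed.

Lemma PM_neq_0 z : inD z -> (P z + M z)%C <> RtoC 0.
Proof.
  intros H. apply Re_pos_neq_0. rewrite re_plus. destruct (Re_P_M z H) as [H1 H2].
  generalize (kap_bounds th Hth) (Rpower_pos (sg z) th) (Rpower_pos (de z) th). nra.
Qed.

Lemma PM_le_4 z : inD z -> Cmod (P z + M z) <= 4.
Proof.
  intros H. via Cmod_triangle. rewrite Cmod_P, Cmod_M by easy.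
  destruct (sg_de_bounds z H) as [Hs [Hd _]]. generalize (pow_sg_le_2 _ Hs) (pow_sg_le_2 _ Hd). lra.
Qed.

(** No cancellation occurs between the two terms: up to a common rotation both lie in the sector of
    half-opening [th * PI / 2]. *)
Lemma PM_cross z z' : inD z -> inD z' ->
  kap th * (Rpower (sg z) th * Rpower (de z') th + Rpower (de z) th * Rpower (sg z') th)
  <= Cmod (P z * Cconj (M z') + M z * Cconj (P z')).
Proof.
  intros H H'. destruct (one_pm_phases z H) as [a [b [_ [_ [Hab E]]]]].
  destruct (one_pm_phases z' H') as [a' [b' [_ [_ [Hab' E']]]]].
  destruct (E th) as [-> ->]. destruct (E' th) as [-> ->].
  set (p := Rpower (sg z) th). set (m := Rpower (de z) th).
  set (p' := Rpower (sg z') th). set (m' := Rpower (de z') th).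
  assert (Hp : 0 < p) by apply Rpower_pos. assert (Hm : 0 < m) by apply Rpower_pos.
  assert (Hp' : 0 < p') by apply Rpower_pos. assert (Hm' : 0 < m') by apply Rpower_pos.
  set (Z := (_ + _)%C).
  (* This rotation leaves the phases [th (a - b)] and [- th (a' - b')], each controlled by
     [one_pm_phases]. *)
  assert (EZ : (Z * eis (th * b' - th * b))%C
     = (RtoC (p * m') * eis (th * (a - b)) + RtoC (m * p') * eis (- (th * (a' - b'))))%C).
  { unfold Z. rewrite !Cmult_conj, !eis_conj.
    rewrite (Cconj_R m').
    rewrite (Cconj_R p').
    replace (th * (a - b)) with (th * a + (- (th * b') + (th * b' - th * b))) by ring.
    replace (- (th * (a' - b'))) with (th * b + (- (th * a') + (th * b' - th * b))) by ring.
    rewrite (eis_plus (th * a)), (eis_plus (th * b)), !(eis_plus (- _)), !RtoC_mult. ring. }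
  apply (f_equal Cmod) in EZ. rewrite Cmod_mult, Cmod_eis, Rmult_1_r in EZ. rewrite EZ.
  eapply Rle_trans; [|apply Re_le_Cmod]. rewrite re_plus, !re_scal_l. unfold eis, Re; simpl fst.
  assert (kap th <= cos (th * (a - b))) by (apply cos_ge_kap; [easy|apply Rabs_scal_le; lra]).
  assert (kap th <= cos (- (th * (a' - b')))) by (rewrite cos_neg; apply cos_ge_kap; [easy|apply Rabs_scal_le; lra]).
  assert (0 < p * m') by nra. assert (0 < m * p') by nra. nra.
Qed.

Lemma Re_PM_conj z : inD z -> kap th * (Rpower (sg z) th * Rpower (de z) th) <= Re (P z * Cconj (M z)).
Proof.
  intros H. destruct (one_pm_phases z H) as [a [b [_ [_ [Hab E]]]]]. destruct (E th) as [-> ->].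
  set (p := Rpower (sg z) th). set (m := Rpower (de z) th).
  assert (Hp : 0 < p) by apply Rpower_pos. assert (Hm : 0 < m) by apply Rpower_pos.
  replace (p * eis (th * a) * Cconj (m * eis (th * b)))%C with (RtoC (p * m) * eis (th * (a - b)))%C.
  - rewrite re_scal_l. unfold eis, Re; simpl fst.
    assert (kap th <= cos (th * (a - b))) by (apply cos_ge_kap; [easy|apply Rabs_scal_le; lra]).
    assert (0 < p * m) by nra. nra.
  - rewrite Cmult_conj, eis_conj. replace (th * (a - b)) with (th * a + - (th * b)) by ring.
    rewrite (Cconj_R m).
    rewrite eis_plus, RtoC_mult. ring.
Qed.

(* The pseudo-hyperbolic factor of [lens] at the real point [(A - 1) / (A + 1)]. *)
Lemma Blaschke_factor_sq A z : 0 < A -> inD z ->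
  Cmod ((P z - A * M z) / (P z + A * M z)) ^ 2
  <= 1 - 4 * A * kap th * (Rpower (sg z) th * Rpower (de z) th) / (Rpower (sg z) th + A * Rpower (de z) th) ^ 2.
Proof.
  intros HA H.
  assert (HR := Re_PM_conj z H). destruct (Re_P_M z H) as [H1 H2].
  destruct (kap_bounds th Hth) as [Hk _].
  assert (Hp := Rpower_pos (sg z) th). assert (Hm := Rpower_pos (de z) th).
  assert (Ep := Cmod_P z H). assert (Em := Cmod_M z H).
  set (p := Rpower (sg z) th) in *. set (m := Rpower (de z) th) in *.
  set (X := P z) in *. set (Y := M z) in *.
  assert (Hne : (X + A * Y)%C <> RtoC 0).
  { apply Re_pos_neq_0. rewrite re_plus, re_scal_l. assert (0 < kap th * m) by nra. nra. }
  assert (Hpos : 0 < Cmod (X + A * Y)) by now apply Cmod_gt_0.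
  rewrite Cmod_div by easy. unfold Rdiv at 1. rewrite Rpow_mult_distr, pow_inv.
  assert (E : Cmod (X - A * Y) ^ 2 = Cmod (X + A * Y) ^ 2 - 4 * A * Re (X * Cconj Y)).
  { rewrite !Cmod_sq. unfold Cconj, Cminus, Cplus, Copp, Cmult, RtoC, Re, Im. simpl. ring. }
  assert (Hle : Cmod (X + A * Y) <= p + A * m).
  { via Cmod_triangle. rewrite Cmod_mult, Cmod_R, (Rabs_pos_eq A), Ep, Em; lra. }
  rewrite E. set (S := Cmod (X + A * Y)) in *. set (rho := Re (X * Cconj Y)) in *.
  assert (HpS : 0 < S ^ 2) by pos.
  replace ((S ^ 2 - 4 * A * rho) * / S ^ 2) with (1 - 4 * A * (rho / S ^ 2)) by (field; lra).
  assert (Hq : kap th * (p * m) / (p + A * m) ^ 2 <= rho / S ^ 2).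
  { unfold Rdiv. apply Rmult_le_compat.
    - apply Rmult_le_pos; [lra|]. pos.
    - apply Rlt_le, Rinv_0_lt_compat, pow_lt. nra.
    - easy.
    - apply Rinv_le_contravar; [easy|]. apply pow_incr. lra. }
  replace (4 * A * kap th * (p * m) / (p + A * m) ^ 2) with (4 * A * (kap th * (p * m) / (p + A * m) ^ 2))
    by (unfold Rdiv; ring).
  nra.
Qed.

(** The case [A = 1] of the Blaschke factor; both powers are at most 2, so the denominator is at
    most 16. *)
Lemma lens_defect z : inD z -> kap th / 4 * Rpower (sg z * de z) th <= 1 - Cmod (lens th z) ^ 2.
Proof.
  intros H. destruct (sg_de_bounds z H) as [Hs [Hd _]].
  rewrite <- Rpower_mult_distr by lra.
  assert (B := Blaschke_factor_sq 1 z Rlt_0_1 H).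
  replace (1 * M z)%C with (M z) in B by ring. rewrite !Rmult_1_l, Rmult_1_r in B.
  fold (lens th z) in B.
  generalize (pow_sg_le_2 _ Hs) (pow_sg_le_2 _ Hd) (kap_bounds th Hth). intros.
  assert (Hp := Rpower_pos (sg z) th). assert (Hm := Rpower_pos (de z) th).
  set (p := Rpower (sg z) th) in *. set (m := Rpower (de z) th) in *.
  assert (kap th / 4 * (p * m) <= 4 * kap th * (p * m) / (p + m) ^ 2); [|lra].
  replace (kap th / 4 * (p * m)) with (4 * kap th * (p * m) * / 16) by field.
  unfold Rdiv. apply Rmult_le_compat_l.
  - apply Rmult_le_pos; [lra|]. pos.
  - apply Rinv_le_contravar; [pos|]. nra.
Qed.

Lemma lens_inD z : inD z -> inD (lens th z).
Proof.
  intros H. assert (B := lens_defect z H). unfold inD.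
  assert (0 < kap th / 4 * Rpower (sg z * de z) th).
  { apply Rmult_lt_0_compat; [generalize (kap_bounds th Hth); lra|pos]. }
  generalize (Cmod_ge_0 (lens th z)). simpl in B. nra.
Qed.

(** With [P], [M] the powers of [1+z], [1-z], the left factor in the modulus is [2 (P conj M' + M
    conj P') / ((P+M) conj(P'+M'))]. [PM_cross] handles the numerator, and the denominator is at
    most 16. *)
Lemma lens_kernel z z' : inD z -> inD z' ->
  kap th / 8 * (Rpower (sg z) th * Rpower (de z') th + Rpower (de z) th * Rpower (sg z') th)
  <= Cmod (1 - lens th z * Cconj (lens th z')).
Proof.
  intros H H'. assert (B := PM_cross z z' H H').
  assert (N := PM_neq_0 z H). assert (N' := PM_neq_0 z' H').
  assert (L := PM_le_4 z H). assert (L' := PM_le_4 z' H').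
  unfold lens. rewrite Cdiv_conj by easy.
  assert (Nc : Cconj (P z' + M z') <> RtoC 0).
  { apply Cmod_gt_0. rewrite Cmod_conj. now apply Cmod_gt_0. }
  rewrite Cminus_conj, Cplus_conj. rewrite Cplus_conj in Nc.
  replace (1 - (P z - M z) / (P z + M z) * ((Cconj (P z') - Cconj (M z')) / (Cconj (P z') + Cconj (M z'))))%C
    with (2 * (P z * Cconj (M z') + M z * Cconj (P z')) / ((P z + M z) * (Cconj (P z') + Cconj (M z'))))%C
    by (field; now split).
  rewrite Cmod_div by now apply Cmult_neq_0.
  rewrite <- Cplus_conj, !Cmod_mult, Cmod_conj, Cmod_R, (Rabs_pos_eq 2) by lra.
  apply Cmod_gt_0 in N. apply Cmod_gt_0 in N'.
  set (s := _ + _) in *.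
  assert (Hs : 0 < s).
  { unfold s. generalize (Rpower_pos (sg z) th) (Rpower_pos (de z) th) (Rpower_pos (sg z') th) (Rpower_pos (de z') th). intros.
    apply Rplus_lt_0_compat; apply Rmult_lt_0_compat; easy. }
  replace (kap th / 8 * s) with (2 * (kap th * s) * / 16) by field.
  destruct (kap_bounds th Hth) as [Hk _].
  unfold Rdiv. apply Rmult_le_compat; try lra.
  - apply Rmult_le_pos; [lra|]. pos.
  - apply Rinv_le_contravar; [pos|]. nra.
Qed.

Lemma papp_lens : papp (lens th).
Proof.
  assert (HP : papp (fun z => P z)) by apply papp_Cpowr.
  assert (HM : papp (fun z => M z)).
  { apply papp_ext with (fun z => Cpowr (1 + - z) th); [intros; f_equal; ring|].
    apply (papp_comp_opp (fun v => Cpowr (1 + v) th)), papp_Cpowr. }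
  apply (papp_mult (fun z => P z - M z)%C); [now apply papp_minus|].
  apply papp_inv; [now apply papp_plus|].
  intros r Hr. destruct (kap_bounds th Hth) as [Hk _].
  exists (kap th * Rpower (1 - r) th). split; [pos|].
  intros z Hz. assert (HD : inD z) by (unfold inD; lra).
  destruct (Re_P_M z HD) as [H1 H2]. rewrite re_plus.
  destruct (sg_de_ge r z Hz) as [Hs _].
  assert (Rpower (1 - r) th <= Rpower (sg z) th) by (apply Rle_Rpower_l; lra).
  generalize (Rpower_pos (de z) th). intros.
  assert (0 < kap th * Rpower (de z) th) by now apply Rmult_lt_0_compat.
  assert (kap th * Rpower (1 - r) th <= kap th * Rpower (sg z) th) by (apply Rmult_le_compat_l; lra).
  lra.
Qed.

Lemma lens_compact_range r : 0 < r < 1 -> exists rho, 0 < rho < 1 /\ forall z, Cmod z <= r -> Cmod (lens th z) <= rho.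
Proof.
  intros Hr. destruct (kap_bounds th Hth) as [Hk Hk1].
  set (e := kap th / 4 * Rpower ((1 - r) * (1 - r)) th).
  assert (Hp : Rpower ((1 - r) * (1 - r)) th <= 1) by (apply Rpower_le_1; nra).
  assert (He : 0 < e < 1).
  { split; [apply Rmult_lt_0_compat; [lra|apply Rpower_pos]|].
    unfold e. generalize (Rpower_pos ((1 - r) * (1 - r)) th). nra. }
  exists (sqrt (1 - e)). split.
  - split; [pos|]. rewrite <- sqrt_1 at 2. apply sqrt_lt_1_alt. lra.
  - intros z Hz. assert (HD : inD z) by (unfold inD; lra).
    rewrite <- (sqrt_pow2 (Cmod _)) by apply Cmod_ge_0. apply sqrt_le_1_alt.
    assert (B := lens_defect z HD). destruct (sg_de_ge r z Hz) as [Hs Hd].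
    assert (e <= kap th / 4 * Rpower (sg z * de z) th); [|lra].
    apply Rmult_le_compat_l; [lra|]. apply Rle_Rpower_l; [lra|]. nra.
Qed.

Lemma papp_comp_lens G : papp G -> papp (fun z => G (lens th z)).
Proof. intros HG. apply papp_comp; [easy|apply papp_lens|apply lens_compact_range]. Qed.

Lemma one_minus_lens z : inD z -> (1 - lens th z)%C = (2 * M z / (P z + M z))%C.
Proof. intros H. unfold lens. field. now apply PM_neq_0. Qed.

Lemma papp_weight a : papp (fun z => Cpowr (1 - lens th z) a).
Proof.
  apply papp_ext with (fun z => Cpowr (1 + - lens th z) a); [intros; f_equal; ring|].
  apply (papp_comp_lens (fun v => Cpowr (1 + - v) a)).
  apply (papp_comp_opp (fun v => Cpowr (1 + v) a)), papp_Cpowr.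
Qed.

(** As [a <= 0], a lower bound [|1 - lens| >= de^th / 2] is needed, which [1 - lens = 2 M / (P + M)]
    provides. *)
Lemma weight_bound a z : a <= 0 -> inD z ->
  Cmod (Cpowr (1 - lens th z) a) <= Rpower 2 (- a) * Rpower (de z) (th * a).
Proof.
  intros Ha H. assert (N := PM_neq_0 z H). destruct (sg_de_bounds z H) as [_ [Hd _]].
  assert (Hlow : Rpower (de z) th / 2 <= Cmod (1 - lens th z)).
  { rewrite one_minus_lens, Cmod_div, Cmod_mult, Cmod_R, (Rabs_pos_eq 2), Cmod_M by (try easy; lra).
    assert (L := PM_le_4 z H). apply Cmod_gt_0 in N.
    replace (Rpower (de z) th / 2) with (2 * Rpower (de z) th * / 4) by field.
    apply Rmult_le_compat_l; [generalize (Rpower_pos (de z) th); lra|]. now apply Rinv_le_contravar. }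
  assert (Hp : 0 < Rpower (de z) th / 2) by (generalize (Rpower_pos (de z) th); lra).
  rewrite Cmod_Cpowr by (apply Cmod_gt_0; lra).
  eapply Rle_trans; [apply Rpower_anti_l; [easy|split; [exact Hp|exact Hlow]]|].
  right. unfold Rdiv. rewrite <- Rpower_mult_distr by pos.
  rewrite Rpower_mult, Rmult_comm. f_equal. unfold Rpower. rewrite ln_Rinv by lra. f_equal. ring.
Qed.

End Lens.

(** * Means over the nodes *)

Lemma is_derive_Rpower_l x y : 0 < x -> is_derive (fun x => Rpower x y) x (y * Rpower x (y - 1)).
Proof.
  intros Hx. unfold Rpower. auto_derive; [easy|].
  replace ((y - 1) * ln x) with (y * ln x + - ln x) by ring.
  rewrite exp_plus, exp_Ropp, exp_ln by easy. field. lra.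
Qed.

(** Integral comparison without integrals: terms of a sum are dominated by increments of a
    primitive, which telescope. *)
Lemma increment_ge (f df : R -> R) x m : 0 < x ->
  (forall t, x <= t <= x + 1 -> is_derive f t (df t)) -> (forall t, x <= t <= x + 1 -> m <= df t) ->
  m <= f (x + 1) - f x.
Proof.
  intros Hx Hd Hm. destruct (MVT_gen f x (x + 1) df) as [t [Ht E]].
  - intros t Ht. rewrite Rmin_left, Rmax_right in Ht by lra. apply Hd. lra.
  - intros t Ht. rewrite Rmin_left, Rmax_right in Ht by lra. apply continuity_pt_filterlim.
    apply (ex_derive_continuous f). exists (df t). apply Hd. lra.
  - rewrite Rmin_left, Rmax_right in Ht by lra. rewrite E.
    replace (x + 1 - x) with 1 by ring. specialize (Hm t Ht). lra.
Qed.

Lemma power_sum s N : 0 < s < 1 ->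
  rsum N (fun i => Rpower (INR (i + 1)) (- s)) <= Rpower (INR N) (1 - s) / (1 - s).
Proof.
  intros Hs. destruct N as [|N].
  { simpl. pos. }
  induction N as [|N IH].
  - simpl. rewrite !Rpower_1_l. rewrite Rplus_0_l. apply Rle_div_r; lra.
  - set (n := S N) in *. cbn [rsum].
    assert (Hn : 0 < INR n) by (apply (lt_INR 0); unfold n; lia).
    rewrite S_INR. replace (INR (n + 1)) with (INR n + 1) by (rewrite plus_INR; simpl; ring).
    assert (H : (1 - s) * Rpower (INR n + 1) (- s) <= Rpower (INR n + 1) (1 - s) - Rpower (INR n) (1 - s)).
    { apply (increment_ge (fun x => Rpower x (1 - s)) (fun x => (1 - s) * Rpower x (1 - s - 1))); [easy| |].
      - intros t Ht. apply is_derive_Rpower_l. lra.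
      - intros t Ht. apply Rmult_le_compat_l; [lra|]. replace (1 - s - 1) with (- s) by ring.
        apply Rpower_anti_l; lra. }
    apply Rle_div_r in IH; [|lra]. apply Rle_div_r; lra.
Qed.

Lemma sin_ge_quarter x : 0 <= x <= PI / 2 -> x / 4 <= sin x.
Proof.
  intros Hx. set (y := x / 2). assert (Hy : 0 <= y <= PI / 4) by (unfold y; lra).
  assert (Hc : forall t, 0 <= t <= PI / 4 -> 1 / 2 <= cos t).
  { intros t Ht. rewrite <- cos_PI3. apply cos_decr_1; lra. }
  destruct (MVT_gen sin 0 y cos) as [t [Ht E]].
  - intros t _. apply is_derive_sin.
  - intros t _. apply continuity_sin.
  - rewrite Rmin_left, Rmax_right in Ht by lra. rewrite sin_0 in E.
    replace x with (2 * y) by (unfold y; field). rewrite sin_2a.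
    assert (H1 := Hc t ltac:(lra)). assert (H2 := Hc y Hy). assert (y / 2 <= sin y) by nra. nra.
Qed.

(** Rank of the [k]-th node by angular distance to 1 on its side of the circle, counted from 1. *)
Definition dd (N k : nat) : nat := Nat.min (k + 1) (N - k).

Lemma node_sq r N k : (0 < N)%nat ->
  de (node r N k) ^ 2 = (1 - r) ^ 2 + 4 * r * sin (PI * (2 * INR k + 1) / (2 * INR N)) ^ 2 /\
  sg (node r N k) ^ 2 = (1 - r) ^ 2 + 4 * r * cos (PI * (2 * INR k + 1) / (2 * INR N)) ^ 2.
Proof.
  intros HN. apply lt_INR in HN. simpl in HN. unfold de, sg, node. rewrite !Cmod_sq.
  set (x := PI * (2 * INR k + 1) / (2 * INR N)).
  replace (PI * (2 * INR k + 1) / INR N) with (2 * x) by (unfold x; field; lra).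
  assert (H := sin2_cos2 x). unfold Rsqr in H.
  unfold eis. rewrite cos_2a, sin_2a. unfold Cminus, Cplus, Copp, Cmult, RtoC, Re, Im. simpl.
  set (s := sin x) in *. set (c := cos x) in *.
  assert (Hs : s * s = 1 - c * c) by lra. clearbody s c.
  split; ring_simplify; replace (s ^ 4) with ((s * s) * (s * s)) by ring; replace (s ^ 2) with (s * s) by ring; rewrite Hs; ring.
Qed.

(** Shared by the upper and lower arcs near 1 and near -1: [x] is the half-angle to the singular
    point, and [4 r >= 2] makes [sin x] bound [s] from below. *)
Lemma half_angle_lower r s x m N : 1 / 2 <= r -> (0 < N)%nat -> 0 <= s ->
  s ^ 2 = (1 - r) ^ 2 + 4 * r * sin x ^ 2 -> x <= PI / 2 ->
  0 <= m -> x = PI * m / (2 * INR N) -> m / (4 * INR N) <= s.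
Proof.
  intros Hr HN Hs0 Hs Hx Hm E. apply lt_INR in HN. simpl in HN. generalize PI2_1; intros HPI.
  assert (Hx0 : 0 <= x).
  { rewrite E. apply Rdiv_le_0_compat; [|lra]. pos. }
  assert (H := sin_ge_quarter x (conj Hx0 Hx)).
  assert (H2 : sin x <= s * sqrt (1 / 2)).
  { apply Rsqr_incr_0_var; [|pos].
    unfold Rsqr. replace (s * sqrt (1 / 2) * (s * sqrt (1 / 2))) with (s ^ 2 * (sqrt (1 / 2) * sqrt (1 / 2))) by ring.
    rewrite sqrt_sqrt, Hs by lra. generalize (pow2_ge_0 (1 - r)) (pow2_ge_0 (sin x)). nra. }
  assert (H3 : sqrt (1 / 2) <= 1) by (rewrite <- sqrt_1 at 2; apply sqrt_le_1_alt; lra).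
  assert (H4 : x / 4 <= s) by nra.
  eapply Rle_trans; [|exact H4]. rewrite E.
  replace (m / (4 * INR N)) with (2 * (m / (8 * INR N))) by (field; lra).
  replace (PI * m / (2 * INR N) / 4) with (PI * (m / (8 * INR N))) by (field; lra).
  apply Rmult_le_compat_r; [pos|lra].
Qed.

Lemma node_de_ge r M k : 1 / 2 <= r -> (k < 2 * M)%nat ->
  INR (dd (2 * M) k) / (4 * INR (2 * M)) <= de (node r (2 * M) k).
Proof.
  intros Hr Hk. set (N := (2 * M)%nat) in *. assert (HN : (0 < N)%nat) by lia.
  assert (HNr : 0 < INR N) by now apply (lt_INR 0).
  destruct (node_sq r N k HN) as [E _]. set (s := de (node r N k)) in *.
  assert (Hs : 0 <= s) by apply Cmod_ge_0. generalize PI_RGT_0; intros HPI.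
  set (x := PI * (2 * INR k + 1) / (2 * INR N)) in *.
  assert (HM : INR N = 2 * INR M) by (unfold N; rewrite mult_INR; simpl; ring).
  destruct (Nat.lt_ge_cases k M) as [H|H].
  - apply Rle_trans with ((2 * INR k + 1) / (4 * INR N)).
    + apply Rmult_le_compat_r; [pos|].
      apply Rle_trans with (INR (k + 1)); [apply le_INR; unfold dd; lia|].
      rewrite plus_INR. simpl. generalize (pos_INR k). lra.
    + apply (half_angle_lower r s x); try easy.
      * unfold x. apply Rle_div_l; [lra|].
        apply le_INR in H. rewrite S_INR in H. nra.
      * generalize (pos_INR k). lra.
  - apply Rle_trans with ((2 * INR N - 2 * INR k - 1) / (4 * INR N)).
    + apply Rmult_le_compat_r; [pos|].
      apply Rle_trans with (INR (N - k)); [apply le_INR; unfold dd; lia|].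
      rewrite minus_INR by lia. apply le_INR in Hk. rewrite S_INR in Hk. lra.
    + apply (half_angle_lower r s (PI - x)); try easy.
      * rewrite sin_PI_x. exact E.
      * assert (PI / 2 <= x); [|lra]. unfold x. apply (proj1 (Rle_div_r (PI / 2) _ (2 * INR N) ltac:(lra))).
        apply le_INR in H. replace (PI / 2 * (2 * INR N)) with (PI * INR N) by field. apply Rmult_le_compat_l; lra.
      * apply le_INR in Hk. rewrite S_INR in Hk. lra.
      * unfold x. field. lra.
Qed.

(** With [2 * M] nodes, -1 lies midway in angle between nodes [M - 1] and [M]; the index counts
    outwards from there. *)
Lemma node_sg_ge r M k : 1 / 2 <= r -> (k < 2 * M)%nat ->
  INR (if lt_dec k M then M - k else k - M + 1) / (4 * INR (2 * M)) <= sg (node r (2 * M) k).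
Proof.
  intros Hr Hk. set (N := (2 * M)%nat) in *. assert (HN : (0 < N)%nat) by lia.
  assert (HNr : 0 < INR N) by now apply (lt_INR 0).
  destruct (node_sq r N k HN) as [_ E]. set (s := sg (node r N k)) in *.
  assert (Hs : 0 <= s) by apply Cmod_ge_0. generalize PI_RGT_0; intros HPI.
  set (x := PI * (2 * INR k + 1) / (2 * INR N)) in *.
  assert (HM : INR N = 2 * INR M) by (unfold N; rewrite mult_INR; simpl; ring).
  assert (Hx : 0 < x).
  { unfold x. generalize (pos_INR k); intros. pos. }
  assert (Hx1 : x < PI).
  { unfold x. apply Rlt_div_l; [lra|].
    apply le_INR in Hk. rewrite S_INR in Hk. nra. }
  destruct (lt_dec k M) as [H|H].
  - apply Rle_trans with ((INR N - 2 * INR k - 1) / (4 * INR N)).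
    + apply Rmult_le_compat_r; [pos|].
      rewrite minus_INR by lia. apply le_INR in H. rewrite S_INR in H. lra.
    + apply (half_angle_lower r s (PI / 2 - x)); try easy.
      * rewrite sin_shift. exact E.
      * lra.
      * apply le_INR in H. rewrite S_INR in H. lra.
      * unfold x. field. lra.
  - apply Rle_trans with ((2 * INR k + 1 - INR N) / (4 * INR N)).
    + apply Rmult_le_compat_r; [pos|].
      rewrite plus_INR, minus_INR by lia. simpl. assert (H' : (M <= k)%nat) by lia. apply le_INR in H'. lra.
    + apply (half_angle_lower r s (x - PI / 2)); try easy.
      * replace (x - PI / 2) with (- (PI / 2 - x)) by ring. rewrite sin_neg, sin_shift.
        replace ((- cos x) ^ 2) with (cos x ^ 2) by ring. exact E.
      * lra.
      * assert (H' : (M <= k)%nat) by lia. apply le_INR in H'. lra.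
      * unfold x. field. lra.
Qed.

Lemma rsum_dd N (phi : nat -> R) : (forall m, 0 <= phi m) ->
  rsum N (fun k => phi (dd N k)) <= 2 * rsum N (fun i => phi (i + 1)%nat).
Proof.
  intros Hp. apply Rle_trans with (rsum N (fun k => phi (k + 1)%nat + phi (N - k)%nat)).
  - apply rsum_le. intros k Hk. unfold dd.
    generalize (Hp (k + 1)%nat) (Hp (N - k)%nat).
    destruct (Nat.min_dec (k + 1) (N - k)) as [-> | ->]; lra.
  - rewrite rsum_plus. rewrite (rsum_ext N (fun k => phi (N - k)%nat) (fun k => phi ((N - 1 - k) + 1)%nat))
      by (intros; f_equal; lia).
    rewrite (rsum_rev N (fun k => phi (k + 1)%nat)). lra.
Qed.

Lemma rsum_sg_index M (phi : nat -> R) : (forall m, 0 <= phi m) ->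
  rsum (2 * M) (fun k => phi (if lt_dec k M then M - k else k - M + 1)%nat)
  <= 2 * rsum (2 * M) (fun i => phi (i + 1)%nat).
Proof.
  intros Hp. apply Rle_trans with (2 * rsum M (fun i => phi (i + 1)%nat)).
  - replace (2 * M)%nat with (M + M)%nat by lia. rewrite rsum_add.
    set (T := rsum M (fun i => phi (i + 1)%nat)). replace (2 * T) with (T + T) by ring.
    apply Rplus_le_compat; right; unfold T.
    + rewrite <- (rsum_rev M (fun k => phi (k + 1)%nat)). apply rsum_ext.
      intros k Hk. destruct (lt_dec k M); [|lia]. f_equal. lia.
    + apply rsum_ext. intros k Hk. destruct (lt_dec (M + k) M); [lia|]. f_equal. lia.
  - apply Rmult_le_compat_l; [lra|]. apply rsum_mono; [easy|lia].
Qed.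

(** Each rank is taken at most twice, so the sum compares with that of [i^(-s)], of order [N^(1-s)]
    as [s < 1]. The scale [N^s] of the distances restores the factor [N]. *)
Lemma mean_power_bound s (f : nat -> R) (ix : nat -> nat) N : 0 < s < 1 -> (0 < N)%nat ->
  (forall k, (k < N)%nat -> (1 <= ix k)%nat) ->
  (forall phi : nat -> R, (forall m, 0 <= phi m) -> rsum N (fun k => phi (ix k)) <= 2 * rsum N (fun i => phi (i + 1)%nat)) ->
  (forall k, (k < N)%nat -> INR (ix k) / (4 * INR N) <= f k) ->
  rsum N (fun k => Rpower (f k) (- s)) <= INR N * (2 * Rpower 4 s / (1 - s)).
Proof.
  intros Hs HN Hix Hsum Hf.
  assert (HNr : 0 < INR N) by now apply (lt_INR 0).
  apply Rle_trans with (rsum N (fun k => Rpower (4 * INR N) s * Rpower (INR (ix k)) (- s))).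
  - apply rsum_le. intros k Hk. specialize (Hf k Hk). specialize (Hix k Hk).
    apply (le_INR 1) in Hix. simpl in Hix.
    eapply Rle_trans.
    + apply Rpower_anti_l with (b := INR (ix k) / (4 * INR N)); [lra|]. split; [|easy].
      apply Rdiv_lt_0_compat; lra.
    + right. unfold Rdiv. rewrite <- Rpower_mult_distr by pos.
      rewrite Rmult_comm. f_equal. unfold Rpower. rewrite ln_Rinv by lra. f_equal. ring.
  - rewrite rsum_scal.
    assert (H1 := Hsum (fun m => Rpower (INR m) (- s)) (fun m => Rlt_le _ _ (Rpower_pos _ _))).
    assert (H2 := power_sum s N Hs).
    apply Rle_trans with (Rpower (4 * INR N) s * (2 * (Rpower (INR N) (1 - s) / (1 - s)))).
    + apply Rmult_le_compat_l; [pos|]. lra.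
    + right. rewrite <- Rpower_mult_distr by lra.
      assert (E : Rpower (INR N) s * Rpower (INR N) (1 - s) = INR N).
      { rewrite <- Rpower_plus. replace (s + (1 - s)) with 1 by ring. now apply Rpower_1. }
      rewrite <- E at 3. field. lra.
Qed.

Lemma dd_pos N k : (k < N)%nat -> (1 <= dd N k)%nat.
Proof. unfold dd. lia. Qed.

Lemma mean_de s r M : 0 < s < 1 -> 1 / 2 <= r -> (1 <= M)%nat ->
  rsum (2 * M) (fun k => Rpower (de (node r (2 * M) k)) (- s)) <= INR (2 * M) * (2 * Rpower 4 s / (1 - s)).
Proof.
  intros Hs Hr HM. apply (mean_power_bound s _ (dd (2 * M))); [easy|lia| | |].
  - intros; now apply dd_pos.
  - intros; now apply rsum_dd.
  - intros; now apply node_de_ge.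
Qed.

Lemma mean_sg s r M : 0 < s < 1 -> 1 / 2 <= r -> (1 <= M)%nat ->
  rsum (2 * M) (fun k => Rpower (sg (node r (2 * M) k)) (- s)) <= INR (2 * M) * (2 * Rpower 4 s / (1 - s)).
Proof.
  intros Hs Hr HM. apply (mean_power_bound s _ (fun k => if lt_dec k M then M - k else k - M + 1)%nat); [easy|lia| | |].
  - intros k Hk. destruct (lt_dec k M); lia.
  - intros; now apply rsum_sg_index.
  - intros; now apply node_sg_ge.
Qed.

Lemma node_inD r N k : 0 <= r < 1 -> inD (node r N k).
Proof. intros Hr. unfold inD. rewrite Cmod_node; lra. Qed.

(** As [sg + de >= 2], one of the distances is at least 1 and its negative power at most 1: the
    singularities decouple. *)
Lemma split_power s t z : 0 <= s -> 0 <= t -> inD z ->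
  Rpower (de z) (- s) * Rpower (sg z) (- t) <= Rpower (de z) (- s) + Rpower (sg z) (- t).
Proof.
  intros Hs Ht Hz. destruct (sg_de_bounds z Hz) as [H1 [H2 H3]].
  assert (P1 := Rpower_pos (de z) (- s)). assert (P2 := Rpower_pos (sg z) (- t)).
  assert (H : forall x u, 0 <= u -> 1 <= x -> Rpower x (- u) <= 1).
  { intros x u Hu Hx. rewrite <- (Rpower_1_l (- u)). apply Rpower_anti_l; lra. }
  destruct (Rle_lt_dec 1 (de z)) as [Hd|Hd].
  - specialize (H (de z) s Hs Hd). nra.
  - specialize (H (sg z) t Ht ltac:(lra)). nra.
Qed.

Lemma mean_sg_de s t : 0 < s < 1 -> 0 < t < 1 -> exists K, 0 < K /\ forall r M, 1 / 2 <= r < 1 -> (1 <= M)%nat ->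
  rsum (2 * M) (fun k => Rpower (de (node r (2 * M) k)) (- s) * Rpower (sg (node r (2 * M) k)) (- t)) <= INR (2 * M) * K.
Proof.
  intros Hs Ht. exists (2 * Rpower 4 s / (1 - s) + 2 * Rpower 4 t / (1 - t)). split.
  { generalize (Rpower_pos 4 s) (Rpower_pos 4 t); intros. pos. }
  intros r M Hr HM.
  eapply Rle_trans.
  - apply rsum_le. intros k _. apply split_power; [lra|lra|]. apply node_inD. lra.
  - rewrite rsum_plus. assert (H1 := mean_de s r M Hs ltac:(lra) HM). assert (H2 := mean_sg t r M Ht ltac:(lra) HM). lra.
Qed.

(** This is [|1 - z^2|^(-s)], whose node means stay bounded for [0 < s < 1]. *)
Definition Vwt (s : R) (z : C) : R := Rpower (sg z * de z) (- s).

Lemma in_H2_of_Vwt s : 0 < s < 1 -> exists K0, 0 < K0 /\ forall F K, 0 <= K -> papp F ->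
  (forall z, inD z -> Cmod (F z) ^ 2 <= K * Vwt s z) -> in_H2 F /\ H2norm F <= sqrt (K0 * K).
Proof.
  intros Hs. destruct (mean_sg_de s s Hs Hs) as [K0 [HK0 HM]]. exists K0. split; [easy|].
  intros F K HK HF HV. apply in_H2_of_mean; [nra|easy|].
  intros r M Hr HM1. specialize (HM r M Hr HM1).
  apply Rle_trans with (rsum (2 * M) (fun k => K * (Rpower (de (node r (2 * M) k)) (- s) * Rpower (sg (node r (2 * M) k)) (- s)))).
  - apply rsum_le. intros k _. assert (HD : inD (node r (2 * M) k)) by (apply node_inD; lra).
    specialize (HV _ HD). unfold Vwt in HV. destruct (sg_de_bounds _ HD) as [H1 [H2 _]].
    rewrite <- Rpower_mult_distr in HV by lra. rewrite (Rmult_comm (Rpower (de _) _)). exact HV.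
  - rewrite rsum_scal. nra.
Qed.

(** * Boundedness of the weighted operator *)

(** From [2 x_j x_k <= x_j^2 p_k / p_j + x_k^2 p_j / p_k]; by symmetry of [K] both halves give the
    same sum [T]. *)
Lemma Schur_test N (K : nat -> nat -> R) (p x : nat -> R) Cst :
  (forall j k, (j < N)%nat -> (k < N)%nat -> 0 <= K j k /\ K j k = K k j) ->
  (forall j, (j < N)%nat -> 0 < p j) ->
  (forall j, (j < N)%nat -> rsum N (fun k => K j k * p k) <= Cst * p j) ->
  rsum N (fun j => rsum N (fun k => x j * x k * K j k)) <= Cst * rsum N (fun j => x j ^ 2).
Proof.
  intros HK Hp Hs.
  set (T := rsum N (fun j => rsum N (fun k => x j ^ 2 * (K j k * p k) / p j))).
  assert (HT : T <= Cst * rsum N (fun j => x j ^ 2)).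
  { rewrite <- rsum_scal. apply rsum_le. intros j Hj.
    rewrite (rsum_ext N _ (fun k => (x j ^ 2 / p j) * (K j k * p k))) by (intros; field; generalize (Hp j Hj); lra).
    rewrite rsum_scal. specialize (Hs j Hj). specialize (Hp j Hj).
    replace (Cst * x j ^ 2) with (x j ^ 2 / p j * (Cst * p j)) by (field; lra).
    apply Rmult_le_compat_l; [|easy]. pos. }
  assert (E : rsum N (fun j => rsum N (fun k => x k ^ 2 * (K k j * p j) / p k)) = T).
  { rewrite rsum_swap. reflexivity. }
  apply Rle_trans with (1 / 2 * (T + T)); [|lra].
  rewrite <- E at 2. unfold T. rewrite <- rsum_plus, <- rsum_scal.
  apply rsum_le. intros j Hj. rewrite <- rsum_plus, <- rsum_scal. apply rsum_le. intros k Hk.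
  destruct (HK j k Hj Hk) as [K0 Ks]. rewrite <- Ks. assert (Pj := Hp j Hj). assert (Pk := Hp k Hk).
  replace (1 / 2 * (x j ^ 2 * (K j k * p k) / p j + x k ^ 2 * (K j k * p j) / p k))
    with (1 / 2 * K j k * / (p j * p k) * ((x j * p k) ^ 2 + (x k * p j) ^ 2)) by (field; lra).
  replace (x j * x k * K j k) with (1 / 2 * K j k * / (p j * p k) * (2 * (x j * p k) * (x k * p j))) by (field; lra).
  apply Rmult_le_compat_l.
  - apply Rmult_le_pos; [lra|]. apply Rlt_le, Rinv_0_lt_compat. now apply Rmult_lt_0_compat.
  - generalize (pow2_ge_0 (x j * p k - x k * p j)). lra.
Qed.

(** With [u = th / 2], this is the kernel [Hker] at [(d, x)] times the Schur weight ratio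
    [(d / x)^(1/2)]. *)
Definition phi (u d x : R) : R := Rpower d u * Rpower x (u - 1) / (Rpower d u ^ 2 + Rpower x u ^ 2).

(* [u * phi u d] is the derivative of [x |-> atan ((x / d)^u)], so the sum telescopes. *)
Lemma phi_sum u d N : 0 < u < 1 -> 0 < d ->
  rsum N (fun i => phi u d (INR (i + 1))) <= 1 + PI / (2 * u).
Proof.
  intros Hu Hd. set (D := Rpower d u). assert (HD : 0 < D) by apply Rpower_pos.
  set (T := fun x => atan (Rpower x u * / D)).
  assert (Hphi0 : forall x, 0 < phi u d x).
  { intros x. unfold phi. fold D. generalize (Rpower_pos x u) (Rpower_pos x (u - 1)); intros.
    apply Rdiv_lt_0_compat; [pos|]. nra. }
  assert (HTd : forall x, 0 < x -> is_derive T x (u * phi u d x)).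
  { intros x Hx. unfold T.
    assert (Hy : is_derive (fun x => Rpower x u * / D) x (u * Rpower x (u - 1) * / D)).
    { apply (is_derive_ext (fun x => scal (/ D) (Rpower x u))).
      - intros t. unfold scal; simpl. unfold mult; simpl. ring.
      - replace (u * Rpower x (u - 1) * / D) with (scal (/ D) (u * Rpower x (u - 1))) by (unfold scal; simpl; unfold mult; simpl; ring).
        apply is_derive_scal. now apply is_derive_Rpower_l. }
    evar_last; [apply (is_derive_comp atan); [apply is_derive_atan|exact Hy]|].
    unfold scal; simpl; unfold mult; simpl. unfold phi. fold D. generalize (Rpower_pos x u); intros.
    unfold Rsqr. field. split; nra. }
  assert (Hmono : forall x y, 0 < x -> x <= y -> phi u d y <= phi u d x).
  { intros x y Hx Hxy. unfold phi. fold D.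
    assert (P1 := Rpower_pos x u). assert (P2 : Rpower x u <= Rpower y u) by (apply Rle_Rpower_l; lra).
    unfold Rdiv. apply Rmult_le_compat.
    - generalize (Rpower_pos y (u - 1)). nra.
    - apply Rlt_le, Rinv_0_lt_compat. nra.
    - apply Rmult_le_compat_l; [lra|]. apply Rpower_anti_l; lra.
    - apply Rinv_le_contravar; nra. }
  assert (HT1 : 0 < T 1).
  { unfold T. rewrite <- atan_0. apply atan_increasing. rewrite Rpower_1_l, Rmult_1_l. now apply Rinv_0_lt_compat. }
  assert (Hphi1 : phi u d 1 <= 1).
  { unfold phi. fold D. rewrite !Rpower_1_l. apply Rle_div_l; nra. }
  assert (Hb : T (INR N) < PI / 2) by apply atan_bound.
  apply Rle_trans with (1 + / u * (PI / 2)).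
  2:{ right. field. lra. }
  destruct N as [|N].
  { simpl. generalize PI_RGT_0; intros. assert (0 < / u) by pos. nra. }
  (* The first term is bounded by 1 on its own, so that the increments of [T] start at 1, away from
     the singularity at 0. *)
  assert (Hind : forall n, rsum (S n) (fun i => phi u d (INR (i + 1))) <= 1 + / u * (T (INR (S n)) - T 1)).
  { induction n as [|n IH].
    - cbn [rsum]. simpl INR. rewrite Rminus_diag_eq by easy. lra.
    - set (m := S n) in *. cbn [rsum].
      assert (Hm : 0 < INR m) by (apply (lt_INR 0); unfold m; lia).
      rewrite (S_INR m). replace (INR (m + 1)) with (INR m + 1) by (rewrite plus_INR; simpl; ring).
      assert (H : u * phi u d (INR m + 1) <= T (INR m + 1) - T (INR m)).
      { apply (increment_ge T (fun x => u * phi u d x)); [easy| |].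
        - intros t Ht. apply HTd. lra.
        - intros t Ht. apply Rmult_le_compat_l; [lra|]. apply Hmono; lra. }
      apply Rmult_le_compat_l with (r := / u) in H; [|pos].
      rewrite <- Rmult_assoc, Rinv_l, Rmult_1_l in H by lra. lra. }
  specialize (Hind N). via Hind.
  apply Rplus_le_compat_l, Rmult_le_compat_l; [pos|lra].
Qed.

Section Weighted.

Context (th : R) (Hth : 0 < th < 1).

(** Bound for the weighted kernel near 1 in terms of the distances to 1. The choice of [a] makes the
    exponents [(1-th)/2], [(1-th)/2] and [th] add up to 1. *)
Definition Hker (x y : R) : R :=
  Rpower x (- ((1 - th) / 2)) * Rpower y (- ((1 - th) / 2)) / (Rpower x th + Rpower y th).

Lemma Hker_pos x y : 0 < Hker x y.
Proof.
  unfold Hker. pos.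
Qed.

Lemma Hker_sym x y : Hker x y = Hker y x.
Proof. unfold Hker. rewrite (Rplus_comm (Rpower y th)). f_equal. ring. Qed.

Lemma Hker_anti x y x' y' : 0 < x <= x' -> 0 < y <= y' -> Hker x' y' <= Hker x y.
Proof.
  intros Hx Hy. unfold Hker, Rdiv. apply Rmult_le_compat.
  - pos.
  - pos.
  - apply Rmult_le_compat; try (apply Rlt_le, Rpower_pos); apply Rpower_anti_l; lra.
  - apply Rinv_le_contravar; [pos|].
    apply Rplus_le_compat; apply Rle_Rpower_l; lra.
Qed.

Lemma Hker_scal c x y : 0 < c -> 0 < x -> 0 < y -> Hker (x / c) (y / c) = c * Hker x y.
Proof.
  intros Hc Hx Hy. unfold Hker, Rdiv.
  assert (Hi : 0 < / c) by now apply Rinv_0_lt_compat.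
  rewrite <- !Rpower_mult_distr by easy.
  set (e := - ((1 - th) * / 2)).
  assert (E : Rpower (/ c) e * Rpower (/ c) e * / Rpower (/ c) th = c).
  { rewrite <- Rpower_Ropp, <- !Rpower_plus. replace (e + e + - th) with (- (1)) by (unfold e; field).
    rewrite Rpower_Ropp, Rpower_1 by easy. apply Rinv_inv. }
  transitivity ((Rpower (/ c) e * Rpower (/ c) e * / Rpower (/ c) th) *
     (Rpower x e * Rpower y e * / (Rpower x th + Rpower y th))); [|now rewrite E].
  rewrite <- Rmult_plus_distr_r, Rinv_mult. ring.
Qed.

(** The Schur weight [d^(-1/2)] is the one of Hilbert's inequality, natural for degree -1; the
    constant does not depend on [N]. *)
Lemma Hker_Schur N : (0 < N)%nat -> forall x : nat -> R,
  rsum N (fun j => rsum N (fun k => x j * x k * Hker (INR (dd N j)) (INR (dd N k))))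
  <= 2 * (1 + PI / th) * rsum N (fun j => x j ^ 2).
Proof.
  intros HN x.
  assert (Hd : forall k, (k < N)%nat -> 0 < INR (dd N k)) by (intros k Hk; apply (lt_INR 0), dd_pos, Hk).
  apply Schur_test with (p := fun k => Rpower (INR (dd N k)) (- (1 / 2))).
  - intros j k _ _. split; [apply Rlt_le, Hker_pos|apply Hker_sym].
  - intros; apply Rpower_pos.
  - intros j Hj. set (d := INR (dd N j)). assert (Hd0 := Hd j Hj). fold d in Hd0.
    rewrite (rsum_ext N _ (fun k => Rpower d (- (1 / 2)) * phi (th / 2) d (INR (dd N k)))).
    + rewrite rsum_scal, Rmult_comm. apply Rmult_le_compat_r; [pos|].
      eapply Rle_trans; [apply (rsum_dd N (fun m => phi (th / 2) d (INR m)))|].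
      * intros m. unfold phi. generalize (Rpower_pos d (th / 2)) (Rpower_pos (INR m) (th / 2)) (Rpower_pos (INR m) (th / 2 - 1)); intros.
        apply Rlt_le, Rdiv_lt_0_compat; nra.
      * apply Rmult_le_compat_l; [lra|]. replace (PI / th) with (PI / (2 * (th / 2))) by (field; lra).
        apply phi_sum; lra.
    + intros k Hk. set (y := INR (dd N k)) in *.
      unfold Hker, phi. rewrite <- !(Rpower_pow 2) by apply Rpower_pos. rewrite !Rpower_mult.
      replace (th / 2 * INR 2) with th by (simpl; field).
      assert (E1 : Rpower d (- ((1 - th) / 2)) = Rpower d (- (1 / 2)) * Rpower d (th / 2))
        by (rewrite <- Rpower_plus; f_equal; field).
      assert (E2 : Rpower y (th / 2 - 1) = Rpower y (- ((1 - th) / 2)) * Rpower y (- (1 / 2)))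
        by (rewrite <- Rpower_plus; f_equal; field).
      rewrite E1, E2. unfold Rdiv. ring.
Qed.

(** Here [de z >= 1]. If [z'] is also near -1, the sum dominates [a^2 + b^2], with [a], [b] the half
    powers; otherwise [b >= 1 >= a] and [b^2] suffices. *)
Lemma cross_lower z z' : inD z -> inD z' -> sg z < 1 ->
  1 / 2 * (Rpower (sg z) (th / 2) * Rpower (sg z') (th / 2))
  <= Rpower (sg z) th * Rpower (de z') th + Rpower (de z) th * Rpower (sg z') th.
Proof.
  intros H H' Hs. destruct (sg_de_bounds z H) as [S1 [D1 SD1]]. destruct (sg_de_bounds z' H') as [S2 [D2 SD2]].
  assert (Hde : 1 <= Rpower (de z) th) by (apply Rpower_ge_1; lra).
  assert (Hsq : forall x, Rpower x th = Rpower x (th / 2) ^ 2).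
  { intros x. rewrite <- (Rpower_pow 2) by apply Rpower_pos. rewrite Rpower_mult. f_equal. simpl; field. }
  assert (Ha : Rpower (sg z) (th / 2) <= 1) by (apply Rpower_le_1; lra).
  assert (Hd0 := Rpower_pos (de z') th).
  rewrite !(Hsq (sg _)). set (a := Rpower (sg z) (th / 2)) in *. set (b := Rpower (sg z') (th / 2)) in *.
  destruct (Rle_lt_dec 1 (sg z')) as [Hs'|Hs'].
  - assert (1 <= b) by (apply Rpower_ge_1; lra). nra.
  - assert (Hde' : 1 <= Rpower (de z') th) by (apply Rpower_ge_1; lra).
    generalize (pow2_ge_0 (a - b)). nra.
Qed.

(** Majorant, up to a constant, of [|w(z) w(z')| / |1 - lens z conj(lens z')|]. *)
Definition Wker (z z' : C) : R :=
  Rpower (de z) (- ((1 - th) / 2)) * Rpower (de z') (- ((1 - th) / 2))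
   / (Rpower (sg z) th * Rpower (de z') th + Rpower (de z) th * Rpower (sg z') th).

(** Factor of the rank-one majorant. Its square has exponents [1 - th] at 1 and [th] at -1, both
    below 1, hence bounded means. *)
Definition qw (z : C) : R := Rpower (de z) (- ((1 - th) / 2)) * Rpower (sg z) (- (th / 2)).

Lemma qw_pos z : 0 < qw z.
Proof. apply Rmult_lt_0_compat; apply Rpower_pos. Qed.

(* Only near [1] is the kernel genuinely of Hilbert type; elsewhere a rank-one majorant suffices. *)
Lemma kernel_split z z' : inD z -> inD z' ->
  Wker z z' <= Hker (de z) (de z') + 2 * (qw z * qw z').
Proof.
  intros H H'. destruct (sg_de_bounds z H) as [S1 [D1 SD1]]. destruct (sg_de_bounds z' H') as [S2 [D2 SD2]].
  unfold Wker.
  set (w := Rpower (de z) (- ((1 - th) / 2)) * Rpower (de z') (- ((1 - th) / 2))).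
  assert (Hw : 0 < w) by (apply Rmult_lt_0_compat; apply Rpower_pos).
  assert (HH := Hker_pos (de z) (de z')).
  assert (Hq : 0 < qw z * qw z') by (apply Rmult_lt_0_compat; apply qw_pos).
  set (X := _ + _ : R).
  assert (Hrank1 : 1 / 2 * (Rpower (sg z) (th / 2) * Rpower (sg z') (th / 2)) <= X -> w / X <= 2 * (qw z * qw z')).
  { intros HX.
    assert (Hp : 0 < Rpower (sg z) (th / 2) * Rpower (sg z') (th / 2)) by pos.
    replace (2 * (qw z * qw z')) with (w * / (1 / 2 * (Rpower (sg z) (th / 2) * Rpower (sg z') (th / 2)))).
    - apply Rmult_le_compat_l; [lra|]. apply Rinv_le_contravar; lra.
    - unfold qw, w. rewrite !(Rpower_Ropp (sg _)). field. split; apply Rgt_not_eq, Rpower_pos. }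
  destruct (Rlt_le_dec (sg z) 1) as [Hs|Hs].
  - assert (w / X <= 2 * (qw z * qw z')) by now apply Hrank1, cross_lower. lra.
  - destruct (Rlt_le_dec (sg z') 1) as [Hs'|Hs'].
    + assert (w / X <= 2 * (qw z * qw z')).
      { apply Hrank1. unfold X. rewrite (Rmult_comm (Rpower (sg z) (th / 2))).
        rewrite Rplus_comm, (Rmult_comm (Rpower (de z) th)), (Rmult_comm (Rpower (sg z) th)).
        now apply cross_lower. }
      lra.
    + assert (w / X <= Hker (de z) (de z')); [|lra].
      unfold Hker. fold w. apply Rmult_le_compat_l; [lra|].
      assert (P1 := Rpower_pos (de z) th). assert (P2 := Rpower_pos (de z') th).
      apply Rinv_le_contravar; [lra|]. unfold X.
      assert (1 <= Rpower (sg z) th) by (apply Rpower_ge_1; lra).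
      assert (1 <= Rpower (sg z') th) by (apply Rpower_ge_1; lra).
      nra.
Qed.

Lemma kernel_form_bound : exists K, 0 < K /\ forall r M, 1 / 2 <= r < 1 -> (1 <= M)%nat ->
  forall x : nat -> R, (forall k, 0 <= x k) ->
  let zz := node r (2 * M) in
  rsum (2 * M) (fun j => rsum (2 * M) (fun k => x j * x k *
   Wker (zz j) (zz k)))
  <= INR (2 * M) * K * rsum (2 * M) (fun j => x j ^ 2).
Proof.
  destruct (mean_sg_de (1 - th) th ltac:(lra) Hth) as [K1 [HK1 Hq]].
  assert (HPI := PI_RGT_0). assert (Hpt : 0 < PI / th) by pos.
  exists (4 * (2 * (1 + PI / th)) + 2 * K1). split; [lra|].
  intros r M Hr HM x Hx zz. specialize (Hq r M Hr HM). fold zz in Hq.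
  set (N := (2 * M)%nat) in *. assert (HN : (0 < N)%nat) by lia.
  assert (HNr : 0 < INR N) by now apply (lt_INR 0).
  assert (HD : forall k, inD (zz k)) by (intros k; apply node_inD; lra).
  apply Rle_trans with (rsum N (fun j => rsum N (fun k =>
     4 * INR N * (x j * x k * Hker (INR (dd N j)) (INR (dd N k))) + 2 * ((x j * qw (zz j)) * (x k * qw (zz k)))))).
  { apply rsum_le. intros j Hj. apply rsum_le. intros k Hk.
    assert (Hxx : 0 <= x j * x k) by now apply Rmult_le_pos.
    eapply Rle_trans; [apply Rmult_le_compat_l; [easy|apply kernel_split; apply HD]|].
    assert (Hdj := node_de_ge r M j ltac:(lra) Hj). assert (Hdk := node_de_ge r M k ltac:(lra) Hk).
    fold N in Hdj, Hdk. fold (zz j) in Hdj. fold (zz k) in Hdk.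
    assert (Pj : 0 < INR (dd N j)) by (apply (lt_INR 0), dd_pos, Hj).
    assert (Pk : 0 < INR (dd N k)) by (apply (lt_INR 0), dd_pos, Hk).
    (* Degree -1 turns the scale [1 / (4 N)] of the distances into a factor [4 N], exactly what a
       mean over [N] nodes allows. *)
    assert (HH : Hker (de (zz j)) (de (zz k)) <= 4 * INR N * Hker (INR (dd N j)) (INR (dd N k))).
    { rewrite <- Hker_scal by lra. apply Hker_anti; split; try easy; apply Rdiv_lt_0_compat; lra. }
    assert (x j * x k * Hker (de (zz j)) (de (zz k)) <= x j * x k * (4 * INR N * Hker (INR (dd N j)) (INR (dd N k))))
      by now apply Rmult_le_compat_l.
    lra. }
  rewrite (rsum_ext N _ (fun j => 4 * INR N * rsum N (fun k => x j * x k * Hker (INR (dd N j)) (INR (dd N k)))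
     + 2 * rsum N (fun k => x k * qw (zz k)) * (x j * qw (zz j)))).
  2:{ intros j _. rewrite rsum_plus, rsum_scal. f_equal. rewrite rsum_scal, rsum_scal. ring. }
  rewrite rsum_plus, !rsum_scal.
  assert (H1 := Hker_Schur N HN x).
  assert (H2 := rsum_Cauchy_Schwarz N x (fun k => qw (zz k))).
  assert (H3 : rsum N (fun k => qw (zz k) ^ 2) <= INR N * K1).
  { eapply Rle_trans; [|exact Hq]. apply rsum_le. intros k _. right. unfold qw.
    rewrite Rpow_mult_distr, <- !(Rpower_pow 2) by apply Rpower_pos. rewrite !Rpower_mult.
    f_equal; f_equal; simpl; field. }
  set (X2 := rsum N (fun j => x j ^ 2)) in *.
  assert (HX : 0 <= X2) by (apply rsum_nonneg; intros; apply pow2_ge_0).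
  nra.
Qed.

(** The [T T*] argument for [T c = (w_j c(lam_j))_j]: the matrix of [T T*] is the Gram matrix of the
    reproducing kernels, truncated at degree [D] so that all sums are finite. *)
Lemma Gram_bound N D (w lam : nat -> C) (G : nat -> nat -> R) Cst :
  (forall j k, (j < N)%nat -> (k < N)%nat -> Cmod (w j * Cconj (w k) * csum D (fun n => (lam j * Cconj (lam k)) ^ n)%C) <= G j k) ->
  (forall x : nat -> R, (forall k, 0 <= x k) ->
     rsum N (fun j => rsum N (fun k => x j * x k * G j k)) <= Cst * rsum N (fun j => x j ^ 2)) ->
  0 <= Cst ->
  forall c : nat -> C, rsum N (fun j => Cmod (w j * peval c D (lam j)) ^ 2) <= Cst * rsum D (fun n => Cmod (c n) ^ 2).
Proof.
  intros HG HQ HC c.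
  set (A := fun j => (w j * peval c D (lam j))%C).
  (* [y] is the conjugate of [T* A] with [A = T c], so that [|A|^2] pairs [c] with [y] and [|y|^2]
     is the Gram form at [A]. *)
  set (y := fun n => csum N (fun j => Cconj (A j) * w j * lam j ^ n)%C).
  set (S := rsum N (fun j => Cmod (A j) ^ 2)).
  assert (HS : 0 <= S) by (apply rsum_nonneg; intros; apply pow2_ge_0).
  assert (E1 : RtoC S = csum D (fun n => c n * y n)%C).
  { unfold S. rewrite <- csum_RtoC.
    transitivity (csum N (fun j => csum D (fun n => Cconj (A j) * w j * (c n * lam j ^ n)))%C).
    - apply csum_ext. intros j _. rewrite csum_scal, <- Cmult_conj_self.
      change (csum D (fun n => c n * lam j ^ n)%C) with (peval c D (lam j)). unfold A. ring.
    - rewrite csum_swap. apply csum_ext. intros n _. unfold y. rewrite <- csum_scal.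
      apply csum_ext. intros j _. ring. }
  assert (H1 : S ^ 2 <= rsum D (fun n => Cmod (c n) ^ 2) * rsum D (fun n => Cmod (y n) ^ 2)).
  { replace S with (Cmod (RtoC S)) at 1 by (rewrite Cmod_R, Rabs_pos_eq; easy).
    rewrite E1. apply Cmod_csum_Cauchy_Schwarz. }
  assert (E2 : RtoC (rsum D (fun n => Cmod (y n) ^ 2)) = csum N (fun j => csum N (fun k =>
      Cconj (A j) * A k * (w j * Cconj (w k) * csum D (fun n => (lam j * Cconj (lam k)) ^ n))))%C).
  { rewrite <- csum_RtoC.
    transitivity (csum D (fun n => csum N (fun j => csum N (fun k =>
       Cconj (A j) * A k * (w j * Cconj (w k)) * (lam j * Cconj (lam k)) ^ n)))%C).
    - apply csum_ext. intros n _. rewrite <- Cmult_conj_self. unfold y. rewrite csum_mul_conj.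
      apply csum_ext. intros j _. apply csum_ext. intros k _.
      rewrite !Cmult_conj, Cconj_conj, Cpow_conj, Cpow_mult_l. ring.
    - rewrite csum_swap. apply csum_ext. intros j _. rewrite csum_swap. apply csum_ext. intros k _.
      rewrite (csum_scal D _ (fun n => ((lam j * Cconj (lam k)) ^ n)%C)). ring. }
  assert (H2 : rsum D (fun n => Cmod (y n) ^ 2) <= Cst * S).
  { assert (Hp : 0 <= rsum D (fun n => Cmod (y n) ^ 2)) by pos.
    replace (rsum D (fun n => Cmod (y n) ^ 2)) with (Cmod (RtoC (rsum D (fun n => Cmod (y n) ^ 2)))) by (rewrite Cmod_R, Rabs_pos_eq; easy).
    rewrite E2. eapply Rle_trans; [|apply (HQ (fun j => Cmod (A j))); intros; apply Cmod_ge_0].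
    via Cmod_csum. apply rsum_le. intros j Hj.
    via Cmod_csum. apply rsum_le. intros k Hk.
    rewrite Cmod_mult, Cmod_mult, Cmod_conj. apply Rmult_le_compat_l; [pos|].
    now apply HG. }
  change (S <= Cst * rsum D (fun n => Cmod (c n) ^ 2)).
  set (X := rsum D (fun n => Cmod (c n) ^ 2)) in *.
  assert (HX : 0 <= X) by (apply rsum_nonneg; intros; apply pow2_ge_0).
  (* Cauchy-Schwarz has given [S^2 <= X * (Cst * S)]; one factor [S] is cancelled when it is
     nonzero. *)
  destruct HS as [HS|HS].
  - apply Rmult_le_reg_r with S; [easy|]. nra.
  - rewrite <- HS. now apply Rmult_le_pos.
Qed.

(** Truncating the reproducing kernel costs only a factor 2, uniformly in [D]. *)
Lemma Cmod_geom_sum_le q D : Cmod q < 1 -> Cmod (csum D (fun n => q ^ n)%C) <= 2 * / Cmod (1 - q).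
Proof.
  intros Hq. assert (H := csum_geom q D). apply (f_equal Cmod) in H. rewrite Cmod_mult in H.
  assert (H1 : Cmod (1 - q ^ D) <= 2).
  { via Cmod_triangle_minus. rewrite Cmod_1, Cmod_pow.
    assert (Cmod q ^ D <= 1); [|lra]. rewrite <- (pow1 D). apply pow_incr. generalize (Cmod_ge_0 q). lra. }
  assert (H2 : 0 < Cmod (1 - q)).
  { generalize (Cmod_le_minus 1 (1 - q)). replace (1 - (1 - q))%C with q by ring. rewrite Cmod_1. lra. }
  apply Rmult_le_reg_l with (Cmod (1 - q)); [easy|]. rewrite H.
  replace (Cmod (1 - q) * (2 * / Cmod (1 - q))) with 2 by (field; lra). easy.
Qed.

Definition aexp : R := 1 / 2 * (1 - 1 / th).
Definition wt (z : C) : C := Cpowr (1 - lens th z) aexp.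
Definition Wop : op := WComp wt (lens th).

(** Proved first for Taylor polynomials with a constant independent of [D]; then [D] tends to
    infinity at the finitely many nodes. *)
Lemma weighted_mean : exists K, 0 < K /\ forall f, in_H2 f -> forall r M, 1 / 2 <= r < 1 -> (1 <= M)%nat ->
  rsum (2 * M) (fun k => Cmod (Wop f (node r (2 * M) k)) ^ 2)
  <= INR (2 * M) * (K * H2norm f ^ 2).
Proof.
  set (a := aexp). assert (Ha : a <= 0).
  { unfold a, aexp. assert (1 < 1 / th); [|lra]. apply Rlt_div_r; lra. }
  assert (Hta : th * a = - ((1 - th) / 2)) by (unfold a, aexp; field; lra).
  destruct kernel_form_bound as [K [HK Hform]].
  destruct (kap_bounds th Hth) as [Hk _].
  set (c2 := Rpower 2 (- a)). assert (Hc2 : 0 < c2) by apply Rpower_pos.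
  set (C0 := c2 * c2 * (2 * (8 / kap th))).
  assert (HC0 : 0 < C0) by (unfold C0; repeat apply Rmult_lt_0_compat; try lra; apply Rinv_0_lt_compat; lra).
  exists (C0 * K). split; [pos|].
  intros f Hf r M Hr HM. set (N := (2 * M)%nat). assert (HN : 0 < INR N) by (apply (lt_INR 0); unfold N; lia).
  specialize (Hform r M Hr HM). fold N in Hform.
  set (zz := node r N) in *. assert (HD : forall k, inD (zz k)) by (intros k; apply node_inD; lra).
  set (w := fun k => Cpowr (1 - lens th (zz k)) a). set (lam := fun k => lens th (zz k)).
  destruct (in_H2_coef f Hf) as [Ht HB]. set (cf := H2coef f) in *.
  assert (Hpoly : forall D, rsum N (fun k => Cmod (w k * peval cf D (lam k)) ^ 2) <= INR N * (C0 * K * H2norm f ^ 2)).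
  { intros D. apply Rle_trans with (INR N * (C0 * K) * rsum D (fun n => Cmod (cf n) ^ 2)).
    2:{ rewrite !Rmult_assoc. apply Rmult_le_compat_l; [lra|]. rewrite <- !Rmult_assoc.
        apply Rmult_le_compat_l; [|apply HB]. apply Rlt_le. pos. }
    set (G := fun j k => C0 * Wker (zz j) (zz k)).
    apply (Gram_bound N D w lam G).
    - intros j k Hj Hk'.
      rewrite !Cmod_mult, Cmod_conj.
      assert (W1 := weight_bound th Hth a (zz j) Ha (HD j)). assert (W2 := weight_bound th Hth a (zz k) Ha (HD k)).
      rewrite Hta in W1, W2. fold c2 in W1, W2.
      assert (L1 := lens_inD th Hth _ (HD j)). assert (L2 := lens_inD th Hth _ (HD k)).
      assert (Hlt : Cmod (lam j * Cconj (lam k)) < 1).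
      { rewrite Cmod_mult, Cmod_conj. unfold inD in L1, L2. unfold lam.
        generalize (Cmod_ge_0 (lens th (zz j))) (Cmod_ge_0 (lens th (zz k))). nra. }
      assert (Gm := Cmod_geom_sum_le _ D Hlt).
      assert (Kr := lens_kernel th Hth _ _ (HD j) (HD k)).
      fold (lam j) (lam k) in Kr. fold (w j) in W1. fold (w k) in W2.
      set (X := _ + _) in Kr.
      assert (HX : 0 < X) by (apply Rplus_lt_0_compat; apply Rmult_lt_0_compat; apply Rpower_pos).
      assert (Hg : Cmod (csum D (fun n => (lam j * Cconj (lam k)) ^ n)%C) <= 2 * (8 / kap th) * / X).
      { via Gm. rewrite Rmult_assoc. apply Rmult_le_compat_l; [lra|].
        replace (8 / kap th * / X) with (/ (kap th / 8 * X)) by (field; lra).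
        apply Rinv_le_contravar; [|easy]. pos. }
      unfold G, Wker. fold X.
      set (p := Rpower (de (zz j)) _) in *. set (p' := Rpower (de (zz k)) (- ((1 - th) / 2))) in *.
      replace (C0 * (p * p' / X)) with ((c2 * p) * (c2 * p') * (2 * (8 / kap th) * / X)) by (unfold C0; field; lra).
      apply Rmult_le_compat; [pos|pos| |easy].
      apply Rmult_le_compat; try apply Cmod_ge_0; easy.
    - intros x Hx. specialize (Hform x Hx). unfold G.
      rewrite (rsum_ext N _ (fun j => C0 * rsum N (fun k => x j * x k * Wker (zz j) (zz k)))).
      + rewrite rsum_scal. eapply Rle_trans; [apply Rmult_le_compat_l; [lra|exact Hform]|]. right; ring.
      + intros j _. rewrite <- rsum_scal. apply rsum_ext. intros k _. ring.
    - apply Rlt_le. pos. }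
  assert (Hlim : forall n, is_lim_seq (fun D => rsum n (fun k => Cmod (w k * peval cf D (lam k)) ^ 2))
     (rsum n (fun k => Cmod (w k * f (lam k)) ^ 2))).
  { induction n as [|n IH]; [apply is_lim_seq_const|]. apply is_lim_seq_plus'; [exact IH|].
    assert (H1 : is_lim_seq (fun D => Cmod (w n * peval cf D (lam n))) (Cmod (w n * f (lam n)))).
    { apply is_lim_seq_spec. intros [eps He].
      assert (Hc := Ht (lam n) (lens_inD th Hth _ (HD n))).
      assert (Hw := Cmod_ge_0 (w n)).
      destruct (Hc (eps / (2 * (Cmod (w n) + 1)))) as [D0 HD0]; [pos|].
      exists D0. intros D Hge. specialize (HD0 D Hge). simpl.
      change (csum D (fun n0 => (cf n0 * lam n ^ n0)%C)) with (peval cf D (lam n)) in HD0.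
      assert (Hdiff : Cmod (w n * peval cf D (lam n) - w n * f (lam n)) <= eps / 2).
      { replace (w n * peval cf D (lam n) - w n * f (lam n))%C with (w n * (peval cf D (lam n) - f (lam n)))%C by ring.
        rewrite Cmod_mult. apply Rle_trans with ((Cmod (w n) + 1) * (eps / (2 * (Cmod (w n) + 1)))).
        - apply Rmult_le_compat; try apply Cmod_ge_0; lra.
        - right. field. lra. }
      assert (T1 := Cmod_le_minus (w n * peval cf D (lam n)) (w n * f (lam n))).
      assert (T2 := Cmod_le_minus (w n * f (lam n)) (w n * peval cf D (lam n))).
      rewrite Cmod_minus_sym in T2. apply Rabs_def1; lra. }
    apply is_lim_seq_ext with (fun D => Cmod (w n * peval cf D (lam n)) * Cmod (w n * peval cf D (lam n))); [intros; ring|].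
    replace (Cmod (w n * f (lam n)) ^ 2) with (Cmod (w n * f (lam n)) * Cmod (w n * f (lam n))) by ring.
    now apply is_lim_seq_mult'. }
  exact (is_lim_seq_le _ (fun _ => INR N * (C0 * K * H2norm f ^ 2)) _ _ Hpoly (Hlim N) (is_lim_seq_const _)).
Qed.

Lemma weighted_bounded : H2_bounded Wop.
Proof.
  destruct weighted_mean as [K [HK Hm]].
  assert (Hall : forall f, in_H2 f -> in_H2 (Wop f) /\
     H2norm (Wop f) <= sqrt (K * H2norm f ^ 2)).
  { intros f Hf. apply in_H2_of_mean.
    - pos.
    - apply papp_mult; [now apply papp_weight|]. apply papp_comp_lens; [easy|]. now apply papp_of_in_H2.
    - intros r M Hr HM. now apply Hm. }
  split.
  - intros f Hf. now apply Hall.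
  - exists (sqrt K). intros f Hf. destruct (Hall f Hf) as [_ H].
    rewrite sqrt_mult_alt, sqrt_pow2 in H by pos. exact H.
Qed.

End Weighted.

(** * Compactness of the composition operator *)

(** Phrased with cluster points rather than subsequences: a coordinate is added by
    Bolzano-Weierstrass while the earlier limits are kept, and no extractions need be composed. *)
Lemma cluster_step (x : nat -> nat -> R) B N (y : nat -> R) :
  (forall k n, Rabs (x k n) <= B) ->
  (forall eps K, 0 < eps -> exists k, (K <= k)%nat /\ forall n, (n < N)%nat -> Rabs (x k n - y n) < eps) ->
  exists y' : nat -> R, (forall n, n <> N -> y' n = y n) /\
  forall eps K, 0 < eps -> exists k, (K <= k)%nat /\ forall n, (n < S N)%nat -> Rabs (x k n - y' n) < eps.
Proof.
  intros HB Hy.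
  assert (Hk : forall j : nat, exists k, (j <= k)%nat /\ forall n, (n < N)%nat -> Rabs (x k n - y n) < / (INR j + 1)).
  { intros j. apply Hy. apply Rinv_0_lt_compat. generalize (pos_INR j). lra. }
  destruct (functional_choice _ Hk) as [ka Hka].
  destruct (Bolzano_Weierstrass (fun j => x (ka j) N) (fun t => - B <= t <= B) (compact_P3 (- B) B)) as [l Hl].
  { intros j. specialize (HB (ka j) N). apply Rabs_le_between in HB. lra. }
  exists (fun n => if Nat.eq_dec n N then l else y n). split.
  { intros n Hn. destruct (Nat.eq_dec n N); easy. }
  intros eps K He.
  destruct (nfloor_ex (/ eps)) as [J [_ HJ]]; [pos|].
  destruct (Hl (disc l (mkposreal eps He)) (K + J)%nat) as [p [Hp Hpl]].
  { exists (mkposreal eps He). intros t Ht. exact Ht. }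
  destruct (Hka p) as [Hp1 Hp2]. exists (ka p). split; [lia|].
  intros n Hn. destruct (Nat.eq_dec n N) as [->|Hne]; [exact Hpl|].
  eapply Rlt_le_trans; [apply Hp2; lia|].
  rewrite <- (Rinv_inv eps). apply Rinv_le_contravar; [pos|].
  assert (H : (J <= p)%nat) by lia. apply le_INR in H. lra.
Qed.

Lemma cluster_diagonal (x : nat -> nat -> R) B : (forall k n, Rabs (x k n) <= B) ->
  exists y : nat -> R, forall N eps K, 0 < eps ->
    exists k, (K <= k)%nat /\ forall n, (n < N)%nat -> Rabs (x k n - y n) < eps.
Proof.
  intros HB.
  set (Q := fun N (y : nat -> R) => forall eps K, 0 < eps ->
     exists k, (K <= k)%nat /\ forall n, (n < N)%nat -> Rabs (x k n - y n) < eps).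
  assert (Q0 : Q O (fun _ => 0)) by (intros eps K _; exists K; split; [lia|intros; lia]).
  set (step := fun N (s : {y | Q N y}) =>
     constructive_indefinite_description _ (cluster_step x B N (proj1_sig s) HB (proj2_sig s))).
  (* Stage [m] changes only coordinate [m], so reading coordinate [n] at stage [n + 1] gives a
     consistent diagonal sequence. *)
  set (F := fix F N : {y | Q N y} := match N with
     | O => exist _ (fun _ => 0) Q0
     | S m => exist _ (proj1_sig (step m (F m))) (proj2 (proj2_sig (step m (F m)))) end).
  assert (HF : forall N m, (N < m)%nat -> proj1_sig (F m) N = proj1_sig (F (S N)) N).
  { intros N m Hm. induction Hm as [|m Hm IH]; [easy|].
    rewrite <- IH. exact (proj1 (proj2_sig (step m (F m))) N ltac:(lia)). }
  exists (fun n => proj1_sig (F (S n)) n). intros N eps K He.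
  destruct (proj2_sig (F N) eps K He) as [k [Hk Hn]]. exists k. split; [easy|].
  intros n Hlt. rewrite <- (HF n N Hlt). now apply Hn.
Qed.

Lemma tconv_exists (b : nat -> C) K : 0 <= K -> (forall n, Cmod (b n) <= K) -> exists f, tconv f b.
Proof.
  intros HK Hb.
  assert (H : forall z, exists l, inD z -> cconv (fun n => b n * z ^ n)%C l).
  { intros z. destruct (Rlt_le_dec (Cmod z) 1) as [Hz|Hz].
    - assert (Hq : 0 <= Cmod z < 1) by (generalize (Cmod_ge_0 z); lra).
      destruct (cconv_cauchy (fun n => b n * z ^ n)%C (fun n => K * Cmod z ^ n / (1 - Cmod z))) as [l [Hl _]].
      + now apply lim_geom.
      + intros n m. apply (peval_block_bound b K (Cmod z) n m z HK Hq).
        intros i. rewrite Cmod_mult, Cmod_pow. apply Rmult_le_compat_r; [pos|apply Hb].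
      + now exists l.
    - exists (RtoC 0). unfold inD. lra. }
  exact (functional_choice _ H).
Qed.

Lemma coef_le_of_l2 (b : nat -> C) B : 0 <= B -> l2le b (B ^ 2) -> forall n, Cmod (b n) <= B.
Proof.
  intros HB H n. apply Rsqr_incr_0_var; [|easy]. unfold Rsqr.
  assert (H1 := rsum_term_le (S n) (fun i => Cmod (b i) ^ 2) n (fun j _ => pow2_ge_0 _) ltac:(lia)).
  specialize (H (S n)). simpl in *. lra.
Qed.

Section CompLens.

Context (th : R) (Hth : 0 < th < 1).

(** Midway between [th] and 1: [Vwt s] still has bounded means and dominates [|1-z^2|^(-th)] with a
    factor [|1-z^2|^((1-th)/2)] to spare. *)
Notation s := ((1 + th) / 2).

Lemma inv_defect z : inD z -> / (1 - Cmod (lens th z) ^ 2) <= 4 / kap th * Rpower (sg z * de z) (- th).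
Proof.
  intros H. assert (B := lens_defect th Hth z H). destruct (kap_bounds th Hth) as [Hk _].
  rewrite Rpower_Ropp. assert (P := Rpower_pos (sg z * de z) th).
  replace (4 / kap th * / Rpower (sg z * de z) th) with (/ (kap th / 4 * Rpower (sg z * de z) th)) by (field; lra).
  apply Rinv_le_contravar; [|easy]. pos.
Qed.

Lemma sg_de_range z : inD z -> 0 < sg z * de z <= 4.
Proof.
  intros H. destruct (sg_de_bounds z H) as [H1 [H2 _]]. split; [pos|nra].
Qed.

Lemma power_th_Vwt z : Rpower (sg z * de z) (- th) = Vwt s z * Rpower (sg z * de z) ((1 - th) / 2).
Proof. unfold Vwt. rewrite <- Rpower_plus. f_equal. field. Qed.

Lemma Rpower_small_le_4 x u : 0 <= u <= 1 -> 0 < x <= 4 -> Rpower x u <= 4.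
Proof.
  intros Hu Hx. apply Rle_trans with (Rpower 4 u); [apply Rle_Rpower_l; lra|].
  rewrite <- (Rpower_1 4) at 2 by lra. apply Rle_Rpower; lra.
Qed.

Lemma Vwt_ge z : inD z -> 1 / 4 <= Vwt s z.
Proof.
  intros H. unfold Vwt. rewrite Rpower_Ropp. replace (1 / 4) with (/ 4) by field.
  apply Rinv_le_contravar; [pos|]. apply Rpower_small_le_4; [lra|now apply sg_de_range].
Qed.

Lemma inv_defect_Vwt z : inD z -> / (1 - Cmod (lens th z) ^ 2) <= 16 / kap th * Vwt s z.
Proof.
  intros H. eapply Rle_trans; [now apply inv_defect|]. rewrite power_th_Vwt.
  destruct (kap_bounds th Hth) as [Hk _].
  assert (P : Rpower (sg z * de z) ((1 - th) / 2) <= 4) by (apply Rpower_small_le_4; [lra|now apply sg_de_range]).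
  assert (V : 1 / 4 <= Vwt s z) by now apply Vwt_ge.
  replace (16 / kap th * Vwt s z) with (4 / kap th * (Vwt s z * 4)) by (field; lra).
  apply Rmult_le_compat_l; [pos|]. apply Rmult_le_compat_l; lra.
Qed.

Lemma comp_bounded : exists K, 0 < K /\ forall f, in_H2 f ->
  in_H2 (Comp (lens th) f) /\ H2norm (Comp (lens th) f) <= K * H2norm f.
Proof.
  destruct (in_H2_of_Vwt s ltac:(lra)) as [K0 [HK0 HV]]. destruct (kap_bounds th Hth) as [Hk _].
  exists (sqrt (K0 * (16 / kap th))).
  split; [pos|].
  intros f Hf. assert (Hn := H2norm_ge_0 f).
  destruct (HV (Comp (lens th) f) (16 / kap th * H2norm f ^ 2)) as [H1 H2].
  - pos.
  - unfold Comp. apply papp_comp_lens; [easy|]. now apply papp_of_in_H2.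
  - intros z Hz. unfold Comp. eapply Rle_trans; [apply point_evaluation; [easy|now apply lens_inD]|].
    unfold Rdiv at 1. replace (16 / kap th * H2norm f ^ 2 * Vwt s z) with (H2norm f ^ 2 * (16 / kap th * Vwt s z)) by ring.
    apply Rmult_le_compat_l; [pos|]. now apply inv_defect_Vwt.
  - split; [easy|]. rewrite <- (sqrt_pow2 (H2norm f)) by easy.
    rewrite <- sqrt_mult_alt by pos. rewrite Rmult_assoc. exact H2.
Qed.

(** Near 1 and -1 the spare factor is small and the power is bounded by 1; elsewhere [|lens|] stays
    away from 1 and the power [N] wins. *)
Lemma defect_power_small eta : 0 < eta -> exists N, forall z, inD z ->
  (Cmod (lens th z) ^ 2) ^ N / (1 - Cmod (lens th z) ^ 2) <= eta * Vwt s z.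
Proof.
  intros He. destruct (kap_bounds th Hth) as [Hk Hk1].
  set (e1 := eta * (kap th / 4)). assert (He1 : 0 < e1) by (apply Rmult_lt_0_compat; lra).
  (* Converts the threshold [e1] on the spare factor into one on [|1-z^2|^th], hence on the
     defect. *)
  set (e2 := Rpower e1 (th / ((1 - th) / 2))). assert (He2 : 0 < e2) by apply Rpower_pos.
  set (t0 := Rmin (kap th / 4 * e2) (1 / 2)).
  assert (Ht0 : 0 < t0 <= 1 / 2).
  { split; [apply Rmin_pos; [pos|lra]|apply Rmin_r]. }
  (* [t0] absorbs the division by the defect, and 4 comes from [Vwt >= 1/4]. *)
  destruct (pow_lt_1_zero (1 - t0) ltac:(rewrite Rabs_pos_eq; lra) (eta * t0 / 4)) as [N HN].
  { pos. }
  specialize (HN N (le_n N)). rewrite Rabs_pos_eq in HN by pos.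
  exists N. intros z Hz.
  assert (B := lens_defect th Hth z Hz). assert (D := lens_inD th Hth z Hz). unfold inD in D.
  assert (HV := Vwt_ge z Hz).
  set (L := Cmod (lens th z) ^ 2) in *.
  assert (HL : 0 <= L < 1) by now apply Cmod_sq_lt_1, lens_inD.
  destruct (Rle_lt_dec (Rpower (sg z * de z) ((1 - th) / 2)) e1) as [Hs|Hs].
  - apply Rle_trans with (1 / (1 - L)).
    + apply Rmult_le_compat_r; [pos|]. rewrite <- (pow1 N). apply pow_incr. lra.
    + replace (1 / (1 - L)) with (/ (1 - L)) by (field; lra). eapply Rle_trans; [now apply inv_defect|]. rewrite power_th_Vwt.
      replace (eta * Vwt s z) with (4 / kap th * (Vwt s z * e1)) by (unfold e1; field; lra).
      apply Rmult_le_compat_l; [pos|]. apply Rmult_le_compat_l; lra.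
  - assert (Ht : t0 <= 1 - L).
    { via Rmin_l. eapply Rle_trans; [|exact B].
      apply Rmult_le_compat_l; [lra|]. unfold e2.
      replace (Rpower (sg z * de z) th) with (Rpower (Rpower (sg z * de z) ((1 - th) / 2)) (th / ((1 - th) / 2))).
      - apply Rle_Rpower_l; [pos|lra].
      - rewrite Rpower_mult. f_equal. field. lra. }
    apply Rle_trans with ((1 - t0) ^ N * / t0).
    + apply Rmult_le_compat; [pos|pos| |].
      * apply pow_incr. lra.
      * apply Rinv_le_contravar; lra.
    + apply Rle_trans with (eta * t0 / 4 * / t0).
      * apply Rmult_le_compat_r; [pos|lra].
      * replace (eta * t0 / 4 * / t0) with (eta * (1 / 4)) by (field; lra). apply Rmult_le_compat_l; lra.
Qed.

(** Coefficientwise smallness becomes norm smallness after composition. The 10 is [2 * 1 + 2 * 4],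
    for differences of a unit ball element and a cluster point of squared norm at most 4. *)
Lemma comp_small eta : 0 < eta -> exists N eps, 0 < eps /\ forall h c, tconv h c ->
  l2le c 10 -> (forall n, (n < N)%nat -> Cmod (c n) <= eps) ->
  H2norm (Comp (lens th) h) <= eta.
Proof.
  intros He. destruct (in_H2_of_Vwt s ltac:(lra)) as [K0 [HK0 HV]].
  (* [21 = 2 * 10 + 1]: the tail contributes [2 * 10] times [e' * Vwt], the head at most
     [e' * Vwt]. *)
  set (e' := eta ^ 2 / (21 * K0)). assert (He' : 0 < e') by (apply Rdiv_lt_0_compat; [apply pow_lt; easy|lra]).
  destruct (defect_power_small e' He') as [N HN].
  set (eps := Rmin 1 (e' / (8 * (INR N ^ 2 + 1)))).
  assert (HN2 : 0 <= INR N ^ 2) by apply pow2_ge_0.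
  assert (Heps : 0 < eps <= 1 /\ 8 * (INR N ^ 2 + 1) * eps <= e').
  { assert (0 < e' / (8 * (INR N ^ 2 + 1))) by pos.
    split; [split; [apply Rmin_pos; lra|apply Rmin_l]|].
    replace e' with (8 * (INR N ^ 2 + 1) * (e' / (8 * (INR N ^ 2 + 1)))) at 1 by (field; lra).
    apply Rmult_le_compat_l; [lra|apply Rmin_r]. }
  exists N, eps. split; [easy|]. intros h c Ht Hc Hsm.
  destruct (HV (Comp (lens th) h) (21 * e')) as [_ H].
  - lra.
  - unfold Comp. apply papp_comp_lens; [easy|]. now apply (papp_of_tconv h c).
  - intros z Hz. unfold Comp. assert (HD := lens_inD th Hth z Hz).
    assert (T := tail_Cauchy_Schwarz h c 10 (lens th z) N Ht Hc HD).
    assert (HNz := HN z Hz). assert (HVz := Vwt_ge z Hz).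
    assert (Hp : Cmod (peval c N (lens th z)) <= INR N * eps).
    { rewrite <- rsum_const. via Cmod_csum. apply rsum_le. intros i Hi.
      rewrite Cmod_mult, Cmod_pow. rewrite <- (Rmult_1_r eps). apply Rmult_le_compat;
        [pos|pos|now apply Hsm|].
      rewrite <- (pow1 i). apply pow_incr. unfold inD in HD. generalize (Cmod_ge_0 (lens th z)); lra. }
    assert (H1 := Cmod_sq_plus_le (peval c N (lens th z)) (h (lens th z) - peval c N (lens th z))).
    replace (peval c N (lens th z) + (h (lens th z) - peval c N (lens th z)))%C with (h (lens th z)) in H1 by ring.
    set (x := Cmod (peval c N (lens th z))) in *. set (y := Cmod (h (lens th z) - peval c N (lens th z))) in *.
    assert (Hx : 0 <= x) by apply Cmod_ge_0.
    assert (H2 : x ^ 2 <= INR N ^ 2 * eps).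
    { apply Rle_trans with ((INR N * eps) ^ 2); [apply pow_incr; lra|]. rewrite Rpow_mult_distr.
      apply Rmult_le_compat_l; [easy|]. nra. }
    assert (H3 : y ^ 2 <= 10 * (e' * Vwt s z)).
    { via T. unfold Rdiv in HNz |- *. rewrite Rmult_assoc. apply Rmult_le_compat_l; [lra|exact HNz]. }
    assert (H4 : 2 * (INR N ^ 2 * eps) <= e' * Vwt s z) by nra.
    lra.
  - replace (K0 * (21 * e')) with (eta ^ 2) in H by (unfold e'; field; lra).
    now rewrite sqrt_pow2 in H by lra.
Qed.

Lemma comp_compact : H2_compact (Comp (lens th)).
Proof.
  destruct comp_bounded as [Kb [HKb Hb]].
  split.
  { split; [intros f Hf; now apply Hb|]. exists Kb. intros f Hf. now apply Hb. }
  intros fs Hfs.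
  set (a := fun k => H2coef (fs k)).
  assert (Hta : forall k, tconv (fs k) (a k)) by (intros k; apply in_H2_coef, Hfs).
  assert (Hla : forall k, l2le (a k) (1 ^ 2)).
  { intros k D. destruct (Hfs k) as [H1 H2]. eapply Rle_trans; [apply (proj2 (in_H2_coef (fs k) H1))|].
    apply pow_incr. split; [pos|easy]. }
  assert (Hca : forall k n, Cmod (a k n) <= 1) by (intros k; apply coef_le_of_l2; [lra|apply Hla]).
  (* Real and imaginary parts are interleaved so that the real cluster lemma applies. *)
  set (xr := fun k m => if Nat.even m then Re (a k (Nat.div2 m)) else Im (a k (Nat.div2 m))).
  destruct (cluster_diagonal xr 1) as [y Hy].
  { intros k m. unfold xr. eapply Rle_trans; [|apply (Hca k (Nat.div2 m))].
    destruct (Nat.even m); [apply re_le_Cmod|]. eapply Rle_trans; [apply Rmax_r|apply Rmax_Cmod]. }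
  set (b := fun n => (y (2 * n)%nat, y (2 * n + 1)%nat) : C).
  assert (Hclose : forall N eps K, 0 < eps -> exists k, (K <= k)%nat /\ forall n, (n < N)%nat -> Cmod (a k n - b n) <= eps).
  { intros N eps K He. destruct (Hy (2 * N)%nat (eps / 2) K ltac:(lra)) as [k [Hk Hn]]. exists k. split; [easy|].
    intros n Hlt.
    assert (Hr := Hn (2 * n)%nat ltac:(lia)). assert (Hi := Hn (2 * n + 1)%nat ltac:(lia)).
    unfold xr in Hr, Hi.
    rewrite Nat.even_mul in Hr. simpl orb in Hr. rewrite Nat.div2_double in Hr.
    replace (2 * n + 1)%nat with (S (2 * n)) in Hi by lia.
    rewrite Nat.even_succ, Nat.odd_mul in Hi. simpl andb in Hi. rewrite Nat.div2_succ_double in Hi.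
    via Cmod_le_2Rmax.
    apply Rle_trans with (2 * (eps / 2)); [|lra]. apply Rmult_le_compat_l; [lra|].
    replace (S (2 * n)) with (2 * n + 1)%nat in Hi by lia.
    apply Rmax_lub; apply Rlt_le; [exact Hr|exact Hi]. }
  assert (Hlb : l2le b (2 ^ 2)).
  { intros D. set (e := / (INR D + 1)). generalize (pos_INR D); intros HD.
    assert (He : 0 < e) by (apply Rinv_0_lt_compat; lra).
    assert (HDe : INR D * e ^ 2 <= 1).
    { assert ((INR D + 1) * e = 1) by (unfold e; field; lra). nra. }
    destruct (Hclose D e O He) as [k [_ Hk]].
    apply Rle_trans with (rsum D (fun i => 2 * Cmod (a k i) ^ 2 + 2 * e ^ 2)).
    - apply rsum_le. intros i Hi. specialize (Hk i Hi). rewrite Cmod_minus_sym in Hk.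
      replace (b i) with (a k i + (b i - a k i))%C by ring.
      via Cmod_sq_plus_le. apply Rplus_le_compat_l, Rmult_le_compat_l; [lra|].
      apply pow_incr. split; [pos|easy].
    - rewrite rsum_plus, rsum_scal, rsum_const. specialize (Hla k D). nra. }
  destruct (tconv_exists b 2 ltac:(lra) (coef_le_of_l2 b 2 ltac:(lra) Hlb)) as [f Hf].
  assert (HfH : in_H2 f) by (apply (H2norm_le f b (2 ^ 2)); [nra|easy|easy]).
  assert (Hsel : forall (j K : nat), exists k, (K <= k)%nat /\
     H2norm (fsub (Comp (lens th) (fs k)) (Comp (lens th) f)) <= / (INR j + 1)).
  { intros j K. assert (Hj : 0 < / (INR j + 1)) by (apply Rinv_0_lt_compat; generalize (pos_INR j); lra).
    destruct (comp_small _ Hj) as [N [eps [He Hsm]]].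
    destruct (Hclose N eps K He) as [k [Hk Hn]]. exists k. split; [easy|].
    change (fsub (Comp (lens th) (fs k)) (Comp (lens th) f)) with (Comp (lens th) (fsub (fs k) f)).
    apply (Hsm _ (fun n => a k n - b n)%C).
    - intros z Hz. unfold fsub. replace (fs k z - f z)%C with (fs k z + (-1) * f z)%C by ring.
      apply cconv_ext with (fun n => a k n * z ^ n + (-1) * (b n * z ^ n))%C; [intros; ring|].
      apply cconv_lin; [now apply Hta|now apply Hf].
    - intros D. apply Rle_trans with (rsum D (fun i => 2 * Cmod (a k i) ^ 2 + 2 * Cmod (b i) ^ 2)).
      + apply rsum_le. intros i _. rewrite <- (Cmod_opp (b i)). apply Cmod_sq_plus_le.
      + rewrite rsum_plus, !rsum_scal. specialize (Hla k D). specialize (Hlb D). lra.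
    - exact Hn. }
  assert (Hsel' := fun j => functional_choice _ (Hsel j)).
  destruct (functional_choice _ Hsel') as [pick Hpick].
  (* Each choice is made beyond the previous index, which gives strict monotonicity. *)
  set (ph := fix ph j := match j with O => pick O O | S i => pick (S i) (S (ph i)) end).
  assert (Hph : forall j, H2norm (fsub (Comp (lens th) (fs (ph j))) (Comp (lens th) f)) <= / (INR j + 1)).
  { intros [|j]; apply Hpick. }
  exists ph, (Comp (lens th) f). split; [|split].
  - intros k. exact (proj1 (Hpick (S k) (S (ph k)))).
  - now apply Hb.
  - apply is_lim_seq_le_le with (u := fun _ => 0) (w := fun j => / (INR j + 1)).
    + intros j. split; [pos|apply Hph].
    + apply is_lim_seq_const.
    + apply lim_inv_INR.
Qed.

End CompLens.

(** * Blaschke expansions *)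

Definition shift (n : nat) (x : nat -> C) : nat -> C := fun k => x (n + k)%nat.

(** The value at [a] of the function with coefficients [x], made total by choice so that it can be
    applied to any sequence. *)
Definition Uval (a : R) (x : nat -> C) : C :=
  epsilon (inhabits (RtoC 0)) (fun l => cconv (fun k => x k * RtoC a ^ k)%C l).

Lemma Uval_eq a x l : cconv (fun k => x k * RtoC a ^ k)%C l -> Uval a x = l.
Proof.
  intros H. apply (cconv_unique (fun k => x k * RtoC a ^ k)%C); [|easy].
  unfold Uval. apply epsilon_spec. now exists l.
Qed.

Lemma l2le_pos x B : l2le x B -> 0 <= B.
Proof. intros H. exact (H O). Qed.

Lemma l2le_coef x B : l2le x B -> forall n, Cmod (x n) <= sqrt B.
Proof.
  intros H. apply coef_le_of_l2; [pos|]. intros D. rewrite pow2_sqrt by now apply (l2le_pos x). apply H.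
Qed.

Lemma l2le_tconv x B : l2le x B -> exists f, tconv f x.
Proof. intros H. apply (tconv_exists x (sqrt B)); [pos|now apply l2le_coef]. Qed.

Lemma inD_R a : Rabs a < 1 -> inD a.
Proof. intros H. unfold inD. now rewrite Cmod_R. Qed.

Lemma Uval_conv a x B : Rabs a < 1 -> l2le x B -> cconv (fun k => x k * RtoC a ^ k)%C (Uval a x).
Proof.
  intros Ha H. destruct (l2le_tconv x B H) as [f Hf].
  assert (Hc := Hf a (inD_R a Ha)). now rewrite (Uval_eq a x _ Hc).
Qed.

Lemma Uval_bound a x B : Rabs a < 1 -> l2le x B -> (1 - a ^ 2) * Cmod (Uval a x) ^ 2 <= B.
Proof.
  intros Ha H. destruct (l2le_tconv x B H) as [f Hf].
  assert (Hc := Hf a (inD_R a Ha)). rewrite (Uval_eq a x _ Hc).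
  assert (T := tconv_point f x B a Hf H (inD_R a Ha)). rewrite Cmod_R, pow2_abs in T.
  assert (a ^ 2 < 1) by now apply sq_lt_1.
  apply Rmult_le_compat_l with (r := 1 - a ^ 2) in T; [|lra].
  replace ((1 - a ^ 2) * (B / (1 - a ^ 2))) with B in T by (field; lra). exact T.
Qed.

Lemma cconv_cons (x : nat -> C) z m : cconv (fun k => x (S k) * z ^ k)%C m -> cconv (fun k => x k * z ^ k)%C (x O + z * m)%C.
Proof.
  intros H eps He. assert (Hz := Cmod_ge_0 z).
  destruct (H (eps / (Cmod z + 1))) as [N HN]; [pos|].
  exists (S N). intros n Hn. destruct n as [|n]; [lia|]. specialize (HN n ltac:(lia)).
  change (S n) with (1 + n)%nat. rewrite csum_add.
  rewrite (csum_ext n _ (fun i => z * (x (S i) * z ^ i))%C) by (intros; simpl Nat.add; rewrite Cpow_S; ring).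
  rewrite csum_scal. simpl csum at 1.
  replace (0 + x O * 1 + z * csum n (fun i => x (S i) * z ^ i) - (x O + z * m))%C
    with (z * (csum n (fun i => x (S i) * z ^ i) - m))%C by ring.
  rewrite Cmod_mult. apply Rle_trans with ((Cmod z + 1) * (eps / (Cmod z + 1))).
  - apply Rmult_le_compat; try apply Cmod_ge_0; lra.
  - right. field. lra.
Qed.

Lemma l2le_shift n x B : l2le x B -> l2le (shift n x) (B - rsum n (fun i => Cmod (x i) ^ 2)).
Proof.
  intros H D. specialize (H (n + D)%nat). rewrite rsum_add in H. unfold shift. lra.
Qed.

(** These are the coefficients of [(z f(z) - a f(a)) / (z - a)]; dropping the first one gives those
    of the difference quotient [(f(z) - f(a)) / (z - a)]. *)
Definition Uor (a : R) (x : nat -> C) (n : nat) : C := Uval a (shift n x).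

Lemma Uor_rec a x B n : Rabs a < 1 -> l2le x B -> Uor a x n = (x n + a * Uor a x (S n))%C.
Proof.
  intros Ha H. unfold Uor. apply Uval_eq.
  replace (x n) with (shift n x O) by (unfold shift; f_equal; lia).
  apply (cconv_cons (shift n x) a).
  apply cconv_ext with (fun k => shift (S n) x k * RtoC a ^ k)%C.
  - intros k. unfold shift. do 2 f_equal. lia.
  - apply (Uval_conv a _ (B - rsum (S n) (fun i => Cmod (x i) ^ 2)) Ha). now apply l2le_shift.
Qed.

(* On coefficients, [Gop a] is the adjoint of multiplication by [(z - a) / (1 - a z)]. *)
Definition Gop (a : R) (x : nat -> C) (n : nat) : C := (Uor a x (S n) - a * Uor a x n)%C.

(** With [U = Uor a x], [|x_n|^2 - |Gop_n|^2 = (1 - a^2) (|U_n|^2 - |U_(n+1)|^2)], which telescopes.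
    The boundary term at [D] is paid by the tail of [x] through point evaluation. *)
Lemma Gop_contraction a x B : Rabs a < 1 -> l2le x B -> l2le (Gop a x) B.
Proof.
  intros Ha H D.
  assert (Ha2 : a ^ 2 < 1) by now apply sq_lt_1.
  assert (E : rsum D (fun i => Cmod (x i) ^ 2) - rsum D (fun i => Cmod (Gop a x i) ^ 2)
     = (1 - a ^ 2) * (Cmod (Uor a x 0) ^ 2 - Cmod (Uor a x D) ^ 2)).
  { induction D as [|D IH]; [simpl; ring|]. cbn [rsum].
    assert (Hx : x D = (Uor a x D - a * Uor a x (S D))%C) by (rewrite (Uor_rec a x B D Ha H); ring).
    assert (Ed : Cmod (x D) ^ 2 - Cmod (Gop a x D) ^ 2 = (1 - a ^ 2) * (Cmod (Uor a x D) ^ 2 - Cmod (Uor a x (S D)) ^ 2)).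
    { rewrite Hx. unfold Gop. rewrite !Cmod_sq.
      unfold Cminus, Cplus, Copp, Cmult, RtoC, Re, Im. simpl. ring. }
    lra. }
  assert (HU := Uval_bound a _ _ Ha (l2le_shift D x B H)). fold (Uor a x D) in HU.
  assert (0 <= (1 - a ^ 2) * Cmod (Uor a x 0) ^ 2) by pos.
  lra.
Qed.

Lemma Uor_bounded a x B : Rabs a < 1 -> l2le x B -> exists K, 0 <= K /\ forall n, Cmod (Uor a x n) <= K.
Proof.
  intros Ha H.
  assert (Ha2 : a ^ 2 < 1) by now apply sq_lt_1.
  exists (sqrt (B / (1 - a ^ 2))). split; [pos|]. intros n.
  rewrite <- (sqrt_pow2 (Cmod _)) by apply Cmod_ge_0. apply sqrt_le_1_alt.
  assert (HU := Uval_bound a _ _ Ha (l2le_shift n x B H)). fold (Uor a x n) in HU.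
  assert (0 <= rsum n (fun i => Cmod (x i) ^ 2)) by pos.
  apply -> Rle_div_r; lra.
Qed.

(** Division by the Blaschke factor at [a], with a multiple of the reproducing kernel at [a] as
    remainder. For [k] the difference quotient and [h = f(a) + z k]: [f = h - a k] and
    [g = k - a h]. *)
Lemma Gop_identity a x B f g z : Rabs a < 1 -> l2le x B -> tconv f x -> tconv g (Gop a x) -> inD z ->
  ((1 - a * z) * f z)%C = ((z - a) * g z + (1 - a * a) * Uval a x)%C.
Proof.
  intros Ha H Hf Hg Hz.
  destruct (Uor_bounded a x B Ha H) as [K [HK HU]].
  destruct (tconv_exists (fun n => Uor a x (S n)) K HK ltac:(intros; apply HU)) as [k Hk].
  set (h := (Uor a x 0 + z * k z)%C).
  assert (Hh : cconv (fun n => Uor a x n * z ^ n)%C h) by (apply (cconv_cons (Uor a x) z), Hk, Hz).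
  assert (Ef : f z = (h + (- a)%R * k z)%C).
  { apply (cconv_unique (fun n => x n * z ^ n)%C); [now apply Hf|].
    apply cconv_ext with (fun n => Uor a x n * z ^ n + (- a)%R * (Uor a x (S n) * z ^ n))%C.
    - intros n. rewrite (Uor_rec a x B n Ha H), RtoC_opp. ring.
    - apply cconv_lin; [easy|now apply Hk]. }
  assert (Eg : g z = (k z + (- a)%R * h)%C).
  { apply (cconv_unique (fun n => Gop a x n * z ^ n)%C); [now apply Hg|].
    apply cconv_ext with (fun n => Uor a x (S n) * z ^ n + (- a)%R * (Uor a x n * z ^ n))%C.
    - intros n. unfold Gop. rewrite RtoC_opp. ring.
    - apply cconv_lin; [now apply Hk|easy]. }
  assert (E0 : Uval a x = Uor a x 0) by reflexivity.
  rewrite Ef, Eg, E0, RtoC_opp. unfold h. ring.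
Qed.

Lemma Uval_lin a x y c B B' : Rabs a < 1 -> l2le x B -> l2le y B' ->
  Uval a (fun n => x n + c * y n)%C = (Uval a x + c * Uval a y)%C.
Proof.
  intros Ha Hx Hy. apply Uval_eq.
  apply cconv_ext with (fun n => x n * RtoC a ^ n + c * (y n * RtoC a ^ n))%C; [intros; ring|].
  apply cconv_lin; [now apply (Uval_conv a x B)|now apply (Uval_conv a y B')].
Qed.

Lemma Uor_lin a x y c B B' n : Rabs a < 1 -> l2le x B -> l2le y B' ->
  Uor a (fun n => x n + c * y n)%C n = (Uor a x n + c * Uor a y n)%C.
Proof.
  intros Ha Hx Hy. unfold Uor.
  change (shift n (fun n => x n + c * y n)%C) with (fun k => shift n x k + c * shift n y k)%C.
  apply (Uval_lin a _ _ c _ _ Ha (l2le_shift n x B Hx) (l2le_shift n y B' Hy)).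
Qed.

Lemma Gop_lin a x y c B B' : Rabs a < 1 -> l2le x B -> l2le y B' ->
  Gop a (fun n => x n + c * y n)%C = (fun n => Gop a x n + c * Gop a y n)%C.
Proof.
  intros Ha Hx Hy. apply functional_extensionality. intros n. unfold Gop.
  rewrite !(Uor_lin a x y c B B') by easy. ring.
Qed.

Section Blaschke.

Context (a : nat -> R) (Ha : forall i, Rabs (a i) < 1).

Fixpoint iterG (x : nat -> C) (i : nat) : nat -> C :=
  match i with O => x | S j => Gop (a j) (iterG x j) end.

Definition bl (al : R) (z : C) : C := ((z - al) / (1 - al * z))%C.

Fixpoint Bprod (i : nat) (z : C) : C :=
  match i with O => RtoC 1 | S j => (Bprod j z * bl (a j) z)%C end.

(** The Takenaka-Malmquist functions, up to normalization; repeated points are allowed. *)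
Definition efun (i : nat) (z : C) : C := (Bprod i z * ((1 - a i * a i) / (1 - a i * z)))%C.

Lemma iterG_l2 x B i : l2le x B -> l2le (iterG x i) B.
Proof. intros H. induction i as [|i IH]; [easy|]. now apply Gop_contraction. Qed.

Lemma iterG_lin x y c B B' i : l2le x B -> l2le y B' ->
  iterG (fun n => x n + c * y n)%C i = (fun n => iterG x i n + c * iterG y i n)%C.
Proof.
  intros Hx Hy. induction i as [|i IH]; [easy|]. simpl. rewrite IH.
  apply (Gop_lin _ _ _ c B B' (Ha i)); now apply iterG_l2.
Qed.

Lemma one_minus_az al z : Rabs al < 1 -> inD z -> 1 - Rabs al <= Cmod (1 - al * z).
Proof.
  intros H Hz. unfold inD in Hz. generalize (Cmod_le_minus 1 (1 - al * z)).
  replace (1 - (1 - al * z))%C with (al * z)%C by ring. rewrite Cmod_1, Cmod_mult, Cmod_R.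
  generalize (Rabs_pos al) (Cmod_ge_0 z). nra.
Qed.

(** Iterated division. By [iterG_l2] the quotient [g] keeps the bound [B] however many points are
    used, so the remainder is controlled by [Bprod] alone. *)
Lemma Blaschke_expansion x B f n : l2le x B -> tconv f x ->
  exists g, tconv g (iterG x n) /\ forall z, inD z ->
    f z = (csum n (fun i => Uval (a i) (iterG x i) * efun i z) + Bprod n z * g z)%C.
Proof.
  intros Hx Hf. induction n as [|n [g [Hg IH]]].
  - exists f. split; [easy|]. intros z _. simpl. ring.
  - destruct (l2le_tconv (iterG x (S n)) B (iterG_l2 x B (S n) Hx)) as [g' Hg'].
    exists g'. split; [easy|]. intros z Hz. rewrite (IH z Hz). cbn [csum Bprod].
    assert (E := Gop_identity (a n) (iterG x n) B g g' z (Ha n) (iterG_l2 x B n Hx) Hg Hg' Hz).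
    assert (N : (1 - a n * z)%C <> RtoC 0).
    { apply Cmod_gt_0. generalize (one_minus_az (a n) z (Ha n) Hz) (Ha n). lra. }
    assert (Eg : g z = ((z - a n) / (1 - a n * z) * g' z + (1 - a n * a n) / (1 - a n * z) * Uval (a n) (iterG x n))%C).
    { transitivity ((1 - a n * z) * g z / (1 - a n * z))%C; [field; easy|]. rewrite E. field. easy. }
    rewrite Eg. unfold efun, bl. ring.
Qed.

Lemma papp_one_minus_az_inv al : Rabs al < 1 -> papp (fun z => / (1 - al * z))%C.
Proof.
  intros H. apply papp_inv.
  - apply papp_minus; [apply papp_const|]. apply papp_mult; [apply papp_const|apply papp_id].
  - intros r Hr. exists (1 - r). split; [lra|]. intros z Hz.
    assert (R1 := re_le_Cmod (al * z)). rewrite Cmod_mult, Cmod_R in R1.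
    assert (Rabs al * Cmod z <= r) by (generalize (Rabs_pos al) (Cmod_ge_0 z); nra).
    assert (R2 := Rle_abs (Re (al * z))).
    replace (Re (1 - al * z)) with (1 - Re (al * z)) by (unfold Re, Cminus, Cplus, Copp, RtoC; simpl; ring).
    lra.
Qed.

Lemma papp_bl al : Rabs al < 1 -> papp (bl al).
Proof.
  intros H. apply (papp_mult (fun z => z - al)%C).
  - apply papp_minus; [apply papp_id|apply papp_const].
  - now apply papp_one_minus_az_inv.
Qed.

Lemma papp_Bprod i : papp (Bprod i).
Proof.
  induction i as [|i IH]; [exact (papp_const 1)|]. apply (papp_mult (Bprod i)); [easy|]. now apply papp_bl.
Qed.

Lemma papp_efun i : papp (efun i).
Proof.
  apply (papp_mult (Bprod i)); [apply papp_Bprod|].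
  apply (papp_mult (fun _ => (1 - a i * a i)%C)); [apply papp_const|]. now apply papp_one_minus_az_inv.
Qed.

Lemma bl_le_1 al z : Rabs al < 1 -> inD z -> Cmod (bl al z) <= 1.
Proof.
  intros H Hz. assert (N := one_minus_az al z H Hz).
  unfold bl. rewrite Cmod_div by (apply Cmod_gt_0; lra).
  apply Rle_div_l; [lra|]. rewrite Rmult_1_l.
  apply Rsqr_incr_0; try apply Cmod_ge_0. rewrite !Rsqr_pow2, !Cmod_sq.
  assert (al ^ 2 < 1) by now apply sq_lt_1.
  unfold inD in Hz.
  assert (Re z ^ 2 + Im z ^ 2 < 1) by (rewrite <- Cmod_sq; generalize (Cmod_ge_0 z); simpl; nra).
  unfold Cminus, Cplus, Copp, Cmult, RtoC, Re, Im in *. simpl in *. nra.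
Qed.

Lemma Bprod_le_1 i z : inD z -> Cmod (Bprod i z) <= 1.
Proof.
  intros Hz. induction i as [|i IH]; [simpl; rewrite Cmod_1; lra|].
  simpl. rewrite Cmod_mult. assert (B := bl_le_1 (a i) z (Ha i) Hz).
  rewrite <- (Rmult_1_l 1). apply Rmult_le_compat; try apply Cmod_ge_0; easy.
Qed.

Lemma efun_bounded i : exists K, 0 <= K /\ forall z, inD z -> Cmod (efun i z) <= K.
Proof.
  assert (H := Ha i). assert (Hi : 0 < / (1 - Rabs (a i))) by pos.
  exists (1 * (Cmod (1 - a i * a i) * / (1 - Rabs (a i)))). split.
  { apply Rmult_le_pos; [lra|]. pos. }
  intros z Hz. assert (N := one_minus_az (a i) z H Hz). unfold efun.
  rewrite Cmod_mult, Cmod_div by (apply Cmod_gt_0; lra).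
  apply Rmult_le_compat; [pos| |now apply Bprod_le_1|].
  - apply Rmult_le_pos; [apply Cmod_ge_0|]. apply Rlt_le, Rinv_0_lt_compat. lra.
  - apply Rmult_le_compat_l; [pos|]. apply Rinv_le_contravar; lra.
Qed.

Context (th : R) (Hth : 0 < th < 1).

Definition Bop (n : nat) : op := fun f z => csum n (fun i => Uval (a i) (iterG (H2coef f) i) * efun i (lens th z))%C.

Lemma Bop_linear n : H2_linear (Bop n).
Proof.
  intros f g c Hf Hg z Hz. unfold Bop.
  destruct (in_H2_lin f g c Hf Hg) as [_ ->].
  destruct (in_H2_coef f Hf) as [_ Bf]. destruct (in_H2_coef g Hg) as [_ Bg].
  rewrite <- csum_scal, <- csum_plus. apply csum_ext. intros i _.
  rewrite (iterG_lin _ _ c _ _ i Bf Bg).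
  rewrite (Uval_lin (a i) _ _ c _ _ (Ha i) (iterG_l2 _ _ i Bf) (iterG_l2 _ _ i Bg)). ring.
Qed.

Lemma Bop_rank n m : (n <= m)%nat -> H2_rank_le m (Bop n).
Proof.
  intros Hnm. exists (fun i z => efun i (lens th z)). split.
  - intros i. destruct (efun_bounded i) as [K [HK Hb]].
    refine (proj1 (in_H2_of_mean _ (K ^ 2) (pow2_ge_0 K) _ _)).
    + apply papp_comp_lens; [easy|apply papp_efun].
    + intros r M Hr HM. rewrite <- rsum_const. apply rsum_le. intros k _.
      apply pow_incr. split; [pos|]. apply Hb, lens_inD; [easy|]. apply node_inD. lra.
  - intros f Hf. exists (fun i => if lt_dec i n then Uval (a i) (iterG (H2coef f) i) else RtoC 0).
    intros z Hz. replace m with (n + (m - n))%nat by lia. rewrite csum_add.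
    rewrite (csum_ext (m - n) _ (fun _ => RtoC 0)).
    + rewrite csum_zero, Cplus_0_r. apply csum_ext. intros i Hi. now destruct (lt_dec i n).
    + intros i Hi. destruct (lt_dec (n + i) n); [lia|ring].
Qed.

(** The error is [(Bprod n * g) o lens], with [g] bounded by point evaluation. [K0] enters through a
    hypothesis so that one constant serves all [n] and all zeros. *)
Lemma Bop_error K0 n K : 0 < K0 ->
  (forall F K, 0 <= K -> papp F -> (forall z, inD z -> Cmod (F z) ^ 2 <= K * Vwt ((1 + th) / 2) z) ->
     in_H2 F /\ H2norm F <= sqrt (K0 * K)) ->
  0 <= K ->
  (forall z, inD z -> Cmod (Bprod n (lens th z)) ^ 2 / (1 - Cmod (lens th z) ^ 2) <= K * Vwt ((1 + th) / 2) z) ->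
  forall f, in_H2 f -> H2norm (fsub (Comp (lens th) f) (Bop n f)) <= sqrt (K0 * K) * H2norm f.
Proof.
  intros HK0 HV HK HB f Hf.
  destruct (in_H2_coef f Hf) as [Tf Bf].
  destruct (Blaschke_expansion (H2coef f) _ f n Bf Tf) as [g [Tg Eg]].
  assert (Hn := H2norm_ge_0 f).
  destruct (HV (fsub (Comp (lens th) f) (Bop n f)) (K * H2norm f ^ 2)) as [_ H].
  - pos.
  - apply papp_minus.
    + apply papp_comp_lens; [easy|]. now apply papp_of_in_H2.
    + apply (papp_csum n (fun i z => Uval (a i) (iterG (H2coef f) i) * efun i (lens th z))%C).
      intros i _. apply papp_mult; [apply papp_const|]. apply papp_comp_lens; [easy|apply papp_efun].
  - intros z Hz. assert (HD := lens_inD th Hth z Hz). unfold fsub, Comp. rewrite (Eg _ HD). unfold Bop.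
    set (S := csum n _). replace (S + Bprod n (lens th z) * g (lens th z) - S)%C with (Bprod n (lens th z) * g (lens th z))%C by ring.
    rewrite Cmod_mult, Rpow_mult_distr.
    assert (T := tconv_point g _ _ (lens th z) Tg (iterG_l2 _ _ n Bf) HD).
    specialize (HB z Hz).
    apply Rle_trans with (Cmod (Bprod n (lens th z)) ^ 2 * (H2norm f ^ 2 / (1 - Cmod (lens th z) ^ 2))).
    + apply Rmult_le_compat_l; [pos|exact T].
    + apply Rmult_le_compat_l with (r := H2norm f ^ 2) in HB; [|pos].
      unfold Rdiv in HB |- *. lra.
  - rewrite <- (sqrt_pow2 (H2norm f)) by easy.
    rewrite <- sqrt_mult_alt by pos. rewrite Rmult_assoc. exact H.
Qed.

End Blaschke.

Lemma sing_val_le T n F r : 0 <= r -> H2_linear F -> H2_rank_le n F ->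
  (forall f, in_H2 f -> H2norm (fsub (T f) (F f)) <= r * H2norm f) -> sing_val T n <= r.
Proof.
  intros Hr HL HR HF. unfold sing_val.
  set (E := fun r0 : R => _). assert (HE : E r) by (exists F; easy).
  destruct (Glb_Rbar_correct E) as [Hlb _]. specialize (Hlb r HE).
  (* [real] sends [m_infty] to 0; that case is covered by [0 <= r]. *)
  destruct (Glb_Rbar E) as [g| |]; simpl in *; [easy|easy|lra].
Qed.

(** * Singular values *)

Section Schatten.

Context (th : R) (Hth : 0 < th < 1).

(* Half-plane coordinates [2^(-J), ..., 2^(J-1)] of the zeros, repeated periodically. *)
Definition dyad (J i : nat) : R := 2 ^ (i mod (2 * J)) / 2 ^ J.
Definition zpt (J i : nat) : R := (dyad J i - 1) / (dyad J i + 1).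

Lemma dyad_pos J i : 0 < dyad J i.
Proof. apply Rdiv_lt_0_compat; apply pow_lt; lra. Qed.

Lemma zpt_lt_1 J i : Rabs (zpt J i) < 1.
Proof.
  assert (H := dyad_pos J i). unfold zpt. apply Rabs_def1.
  - apply Rlt_div_l; lra.
  - apply Rlt_div_r; lra.
Qed.

(** Since [zpt = (A - 1) / (A + 1)] with [A = dyad J i], in the coordinate [U] the factor becomes
    [(U - A) / (U + A)], the form treated by [Blaschke_factor_sq]. *)
Lemma bl_lens J i z : inD z ->
  bl (zpt J i) (lens th z) = ((Cpowr (1 + z) th - dyad J i * Cpowr (1 - z) th) / (Cpowr (1 + z) th + dyad J i * Cpowr (1 - z) th))%C.
Proof.
  intros Hz. assert (HA := dyad_pos J i). assert (N := PM_neq_0 th Hth z Hz).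
  unfold bl, lens. unfold zpt at 1 2. rewrite RtoC_div, RtoC_minus, RtoC_plus by lra.
  set (A := dyad J i) in *. set (X := Cpowr (1 + z) th) in *. set (Y := Cpowr (1 - z) th) in *.
  assert (NA : (A + 1)%C <> RtoC 0).
  { rewrite <- RtoC_plus. intros E. apply RtoC_inj in E. lra. }
  assert (N2 : (X + A * Y)%C <> RtoC 0).
  { apply Re_pos_neq_0. rewrite re_plus, re_scal_l. destruct (Re_P_M th Hth z Hz) as [H1 H2].
    fold X in H1. fold Y in H2. destruct (kap_bounds th Hth) as [Hk _].
    generalize (Rpower_pos (sg z) th) (Rpower_pos (de z) th); intros.
    assert (0 < kap th * Rpower (de z) th) by now apply Rmult_lt_0_compat. nra. }
  assert (N3 : ((A + 1) * (X + Y) - (A - 1) * (X - Y))%C <> RtoC 0).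
  { replace ((A + 1) * (X + Y) - (A - 1) * (X - Y))%C with (2 * (X + A * Y))%C by ring.
    apply Cmult_neq_0; [|easy]. intros E. apply RtoC_inj in E. lra. }
  field. repeat split; easy.
Qed.

Lemma dyadic_search n t : 1 <= t < 2 ^ n -> exists i, (i < n)%nat /\ 2 ^ i <= t <= 2 * 2 ^ i.
Proof.
  induction n as [|n IH]; intros H; [simpl in H; lra|].
  destruct (Rlt_le_dec t (2 ^ n)) as [Hl|Hl].
  - destruct IH as [i [Hi Ht]]; [lra|]. exists i. split; [lia|easy].
  - exists n. split; [lia|]. simpl in H. lra.
Qed.

(** The hypotheses say that the modulus of [U] lies in [[2^(-J), 2^J)], so some dyadic zero is
    within a factor 2 of it, and it recurs in every period [m]. *)
Lemma bl_zone J z : inD z ->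
  Rpower (de z) th <= Rpower (sg z) th * 2 ^ J -> Rpower (sg z) th < Rpower (de z) th * 2 ^ J ->
  exists i, (i < 2 * J)%nat /\ forall m, Cmod (bl (zpt J (2 * J * m + i)) (lens th z)) ^ 2 <= 1 - kap th / 2.
Proof.
  intros Hz H1 H2. set (p := Rpower (sg z) th) in *. set (q := Rpower (de z) th) in *.
  assert (Hp : 0 < p) by apply Rpower_pos. assert (Hq : 0 < q) by apply Rpower_pos.
  assert (HJ : 0 < 2 ^ J) by pos.
  destruct (dyadic_search (2 * J) (p * 2 ^ J / q)) as [i [Hi [T1 T2]]].
  { split.
    - apply Rle_div_r; lra.
    - apply Rlt_div_l; [easy|].
      replace (2 * J)%nat with (J + J)%nat by lia. rewrite pow_add. nra. }
  exists i. split; [easy|]. intros m.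
  assert (Em : dyad J (2 * J * m + i) = 2 ^ i / 2 ^ J).
  { unfold dyad. do 2 f_equal. rewrite Nat.add_comm, (Nat.mul_comm (2 * J)), Nat.Div0.mod_add.
    now apply Nat.mod_small. }
  rewrite bl_lens, Em by easy. set (A := 2 ^ i / 2 ^ J).
  assert (HA : 0 < A) by (apply Rdiv_lt_0_compat; [apply pow_lt; lra|easy]).
  via (Blaschke_factor_sq th Hth A z HA Hz). fold p q.
  set (y := A * q). assert (Hy : 0 < y) by (apply Rmult_lt_0_compat; easy).
  apply (Rle_div_r _ _ _ Hq) in T1. apply (Rle_div_l _ _ _ Hq) in T2.
  assert (Ey : y * 2 ^ J = 2 ^ i * q) by (unfold y, A; field; lra).
  replace (4 * A * kap th * (p * q) / (p + y) ^ 2) with (kap th * (4 * (p * y) / (p + y) ^ 2)) by (unfold y; field; unfold y in Hy; nra).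
  (* Here [y <= p <= 2 y], so the quotient is in fact at least 8/9. *)
  assert (1 / 2 <= 4 * (p * y) / (p + y) ^ 2).
  { apply -> Rle_div_r; [nra|pos]. }
  destruct (kap_bounds th Hth) as [Hk _]. nra.
Qed.

Lemma Bprod_block a (Ha : forall i, Rabs (a i) < 1) n k z i : inD z -> (i < k)%nat ->
  Cmod (Bprod a (n + k) z) <= Cmod (Bprod a n z) * Cmod (bl (a (n + i)%nat) z).
Proof.
  intros Hz. induction k as [|k IH]; intros Hi; [lia|].
  rewrite Nat.add_succ_r. cbn [Bprod]. rewrite Cmod_mult.
  destruct (Nat.eq_dec i k) as [->|Hne].
  - apply Rmult_le_compat_r; [pos|].
    clear IH Hi. induction k as [|k IH]; [rewrite Nat.add_0_r; lra|].
    rewrite Nat.add_succ_r. cbn [Bprod]. rewrite Cmod_mult.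
    generalize (bl_le_1 (a (n + k)%nat) z (Ha _) Hz) (Cmod_ge_0 (Bprod a (n + k) z)) (Cmod_ge_0 (bl (a (n + k)%nat) z)). nra.
  - specialize (IH ltac:(lia)).
    generalize (bl_le_1 (a (n + k)%nat) z (Ha _) Hz) (Cmod_ge_0 (Bprod a (n + k) z)) (Cmod_ge_0 (bl (a (n + k)%nat) z)). nra.
Qed.

(** One good factor is kept from each of the [m] periods of [2 * J] zeros; the others are at most
    1. *)
Lemma Bprod_zone J m z : inD z ->
  Rpower (de z) th <= Rpower (sg z) th * 2 ^ J -> Rpower (sg z) th < Rpower (de z) th * 2 ^ J ->
  Cmod (Bprod (zpt J) (2 * J * m) (lens th z)) ^ 2 <= (1 - kap th / 2) ^ m.
Proof.
  intros Hz H1 H2. destruct (bl_zone J z Hz H1 H2) as [i [Hi Hb]].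
  assert (HD := lens_inD th Hth z Hz).
  destruct (kap_bounds th Hth) as [Hk Hk1].
  induction m as [|m IH].
  - rewrite Nat.mul_0_r. simpl. rewrite Cmod_1. lra.
  - replace (2 * J * S m)%nat with (2 * J * m + 2 * J)%nat by lia.
    assert (B := Bprod_block (zpt J) (zpt_lt_1 J) (2 * J * m) (2 * J) (lens th z) i HD Hi).
    apply Rle_trans with ((Cmod (Bprod (zpt J) (2 * J * m) (lens th z)) * Cmod (bl (zpt J (2 * J * m + i)) (lens th z))) ^ 2).
    + apply pow_incr. split; [pos|exact B].
    + rewrite Rpow_mult_distr. rewrite <- tech_pow_Rmult, Rmult_comm.
      apply Rmult_le_compat; try apply pow2_ge_0; [apply Hb|exact IH].
Qed.

Lemma Bprod_defect : exists K Q, 0 < K /\ 0 < Q < 1 /\ forall J z, inD z ->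
  Cmod (Bprod (zpt J) (2 * J * J) (lens th z)) ^ 2 / (1 - Cmod (lens th z) ^ 2) <= K * Q ^ J * Vwt ((1 + th) / 2) z.
Proof.
  destruct (kap_bounds th Hth) as [Hk Hk1].
  (* For this exponent the spare factor [|1-z^2|^((1-th)/2)] equals [(p * q)^be]. *)
  set (be := (1 - th) / 2 / th). assert (Hbe : 0 < be) by (repeat apply Rdiv_lt_0_compat; lra).
  set (r1 := 1 - kap th / 2). set (r2 := Rpower (/ 2) be).
  assert (Hr2 : 0 < r2 < 1).
  { split; [apply Rpower_pos|]. unfold r2, Rpower. rewrite <- exp_0. apply exp_increasing.
    rewrite ln_Rinv by lra. generalize ln_lt_2. nra. }
  set (Q := Rmax r1 r2).
  assert (HQ : 0 < Q < 1).
  { split; [apply Rlt_le_trans with r2; [easy|apply Rmax_r]|]. apply Rmax_lub_lt; unfold r1; lra. }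
  set (c4 := Rpower 4 be). assert (Hc4 : 0 < c4) by apply Rpower_pos.
  assert (H16 : 0 < 16 / kap th) by pos.
  assert (H4 : 0 < 4 / kap th) by pos.
  exists (16 / kap th + 4 / kap th * c4), Q. split; [generalize (Rmult_lt_0_compat _ _ H4 Hc4); lra|]. split; [easy|].
  intros J z Hz. assert (HD := lens_inD th Hth z Hz).
  assert (HV := Vwt_ge th Hth z Hz). destruct (sg_de_bounds z Hz) as [S1 [D1 _]].
  set (V := Vwt ((1 + th) / 2) z) in *.
  set (L := Cmod (lens th z) ^ 2).
  assert (HL : 0 <= L < 1) by now apply Cmod_sq_lt_1, lens_inD.
  set (b := Cmod (Bprod (zpt J) (2 * J * J) (lens th z)) ^ 2).
  assert (Hb0 : 0 <= b) by apply pow2_ge_0.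
  assert (Hb1 : b <= 1).
  { unfold b. rewrite <- (pow1 2). apply pow_incr. split; [pos|]. apply Bprod_le_1; [apply zpt_lt_1|easy]. }
  set (p := Rpower (sg z) th). set (q := Rpower (de z) th).
  assert (Hp : 0 < p) by apply Rpower_pos. assert (Hq : 0 < q) by apply Rpower_pos.
  assert (Hp2 : p <= 2) by (apply (pow_sg_le_2 th Hth); easy). assert (Hq2 : q <= 2) by (apply (pow_sg_le_2 th Hth); easy).
  assert (HJ : 1 <= 2 ^ J) by (apply pow_R1_Rle; lra).
  assert (Hi : 0 < / (1 - L)) by pos.
  assert (Hsum : forall X Y, X <= 16 / kap th * Q ^ J * V \/ X <= 4 / kap th * c4 * Q ^ J * V -> Y = X ->
     Y <= (16 / kap th + 4 / kap th * c4) * Q ^ J * V).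
  { intros X Y HX ->. assert (0 < Q ^ J * V) by pos.
    assert (0 < 16 / kap th * (Q ^ J * V)) by now apply Rmult_lt_0_compat.
    assert (0 < 4 / kap th * c4 * (Q ^ J * V)) by pos.
    destruct HX; lra. }
  apply (Hsum (b * / (1 - L))); [|reflexivity].
  (* Outside the zone one of [p], [q] is at most [2^(-J)] times the other, which is at most 2; the
     spare factor then decays like [2^(- be J)]. *)
  assert (Hout : p * q <= 4 * / 2 ^ J -> b * / (1 - L) <= 4 / kap th * c4 * Q ^ J * V).
  { intros Hpq. apply Rle_trans with (1 * (4 / kap th * Rpower (sg z * de z) (- th))).
    { apply Rmult_le_compat; [easy|lra|easy|now apply inv_defect]. }
    rewrite power_th_Vwt. fold V. rewrite Rmult_1_l.
    replace (4 / kap th * c4 * Q ^ J * V) with (4 / kap th * (V * (c4 * Q ^ J))) by ring.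
    apply Rmult_le_compat_l; [lra|]. apply Rmult_le_compat_l; [lra|].
    replace (Rpower (sg z * de z) ((1 - th) / 2)) with (Rpower (p * q) be).
    2:{ unfold p, q. rewrite Rpower_mult_distr, Rpower_mult by lra. f_equal. unfold be. field. lra. }
    assert (Hi2 : 0 < / 2 ^ J) by pos.
    eapply Rle_trans; [apply Rle_Rpower_l; [lra|split; [pos|exact Hpq]]|].
    rewrite <- Rpower_mult_distr by lra. fold c4. apply Rmult_le_compat_l; [lra|].
    replace (Rpower (/ 2 ^ J) be) with (r2 ^ J).
    - apply pow_incr. split; [lra|apply Rmax_r].
    - rewrite <- pow_inv, <- (Rpower_pow J (/ 2)), <- (Rpower_pow J r2) by lra. unfold r2.
      rewrite !Rpower_mult. f_equal. ring. }
  destruct (Rle_lt_dec q (p * 2 ^ J)) as [Z1|Z1]; [destruct (Rlt_le_dec p (q * 2 ^ J)) as [Z2|Z2]|].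
  - left. assert (B := Bprod_zone J J z Hz Z1 Z2). fold b r1 in B.
    replace (16 / kap th * Q ^ J * V) with (Q ^ J * (16 / kap th * V)) by ring.
    apply Rmult_le_compat; [easy|lra| |now apply inv_defect_Vwt].
    via B. apply pow_incr. split; [unfold r1; lra|apply Rmax_l].
  - right. apply Hout. apply -> Rle_div_r; [nra|lra].
  - right. apply Hout. apply -> Rle_div_r; [nra|lra].
Qed.

Lemma singular_values_decay : exists K d, 0 < K /\ 0 < d /\ forall n J, (2 * J * J <= n)%nat ->
  sing_val (Comp (lens th)) n <= K * exp (- d * INR J).
Proof.
  destruct (in_H2_of_Vwt ((1 + th) / 2) ltac:(lra)) as [K0 [HK0 HV]].
  destruct Bprod_defect as [K [Q [HK [HQ HB]]]].
  (* Halved because [Q^J] bounds the squared error. *)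
  set (d := - ln Q / 2).
  assert (Hd : 0 < d).
  { unfold d. assert (ln Q < 0) by (rewrite <- ln_1; apply ln_increasing; lra). lra. }
  exists (sqrt (K0 * K)), d. split; [pos|]. split; [easy|].
  intros n J HnJ.
  assert (E : sqrt (K0 * (K * Q ^ J)) = sqrt (K0 * K) * exp (- d * INR J)).
  { rewrite <- Rmult_assoc, sqrt_mult_alt by pos. f_equal.
    replace (Q ^ J) with (exp (- d * INR J) ^ 2).
    - apply sqrt_pow2, Rlt_le, exp_pos.
    - rewrite exp_pow_INR. rewrite <- (Rpower_pow J Q) by lra. unfold Rpower, d. f_equal. simpl. field. }
  rewrite <- E.
  apply (sing_val_le _ _ (Bop (zpt J) th (2 * J * J))).
  - pos.
  - apply Bop_linear, zpt_lt_1.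
  - apply Bop_rank; [apply zpt_lt_1|easy|easy].
  - apply Bop_error; [apply zpt_lt_1|easy|easy|easy| |].
    + pos.
    + intros z Hz. now apply HB.
Qed.

Lemma comp_Schatten p : 0 < p -> in_Schatten p (Comp (lens th)).
Proof.
  intros Hp. split; [|split].
  - intros f g c _ _ z _. reflexivity.
  - now apply comp_compact.
  - destruct singular_values_decay as [K [d [HK [Hd Hs]]]].
    (* So that [mu * (j + 1) <= 1 + (d p / 4) j <= exp (d p j / 4)]; the fourth power yields
       polynomial decay. *)
    set (mu := Rmin 1 (d * p / 4)).
    assert (Hdp : 0 < d * p) by now apply Rmult_lt_0_compat.
    assert (Hmu : 0 < mu <= 1 /\ mu <= d * p / 4).
    { split; [split; [apply Rmin_pos; lra|apply Rmin_l]|apply Rmin_r]. }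
    set (C1 := 8 * (Rpower K p / mu ^ 4)).
    assert (HC1 : 0 < C1) by (apply Rmult_lt_0_compat; [lra|]; apply Rdiv_lt_0_compat; [apply Rpower_pos|apply pow_lt; lra]).
    assert (Hnn : forall n, 0 <= nnpow (sing_val (Comp (lens th)) n) p).
    { intros n. unfold nnpow. destruct (Rle_dec _ 0); [lra|pos]. }
    (* [J] is the largest integer with [2 J^2 <= n], so [(J + 1)^(-4)] is of order [n^(-2)], put in
       telescoping form. *)
    assert (Hterm : forall n, nnpow (sing_val (Comp (lens th)) n) p <= C1 * (/ (INR n + 1) - / (INR n + 2))).
    { intros n. set (J := Nat.sqrt (n / 2)).
      destruct (Nat.sqrt_spec (n / 2) ltac:(lia)) as [Q1 Q2]. fold J in Q1, Q2.
      assert (Hdm := Nat.div_mod_eq n 2). assert (Hml := Nat.mod_upper_bound n 2 ltac:(lia)).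
      assert (HnJ : (2 * J * J <= n)%nat) by nia.
      assert (Hup : (n + 1 <= 2 * ((J + 1) * (J + 1)))%nat) by nia.
      apply le_INR in Hup. rewrite plus_INR, !mult_INR, plus_INR in Hup. simpl INR in Hup.
      assert (Hn0 := pos_INR n). assert (HJ0 := pos_INR J).
      set (N := INR n) in *. set (j := INR J) in *.
      specialize (Hs n J HnJ). fold j in Hs.
      assert (H1 : nnpow (sing_val (Comp (lens th)) n) p <= Rpower K p * exp (- (d * p) * j)).
      { unfold nnpow. destruct (Rle_dec (sing_val (Comp (lens th)) n) 0) as [Hle|Hgt].
        - pos.
        - apply Rle_trans with (Rpower (K * exp (- d * j)) p); [apply Rle_Rpower_l; lra|].
          rewrite <- Rpower_mult_distr by pos. right. f_equal.
          unfold Rpower. rewrite ln_exp. f_equal. ring. }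
      assert (H2 : exp (- (d * p) * j) <= / (mu ^ 4 * (j + 1) ^ 4)).
      { replace (- (d * p) * j) with (- (d * p * j)) by ring. rewrite exp_Ropp.
        assert (Hpos : 0 < mu * (j + 1)) by pos.
        apply Rinv_le_contravar; [rewrite <- Rpow_mult_distr; now apply pow_lt|].
        replace (exp (d * p * j)) with (exp (d * p / 4 * j) ^ 4).
        - rewrite <- Rpow_mult_distr. apply pow_incr. split; [lra|].
          eapply Rle_trans; [|apply exp_ineq1_le]. nra.
        - rewrite exp_pow_INR. f_equal. simpl. field. }
      assert (H3 : (N + 1) * (N + 2) <= 8 * (j + 1) ^ 4).
      {
        nra. }
      via H1.
      apply Rle_trans with (Rpower K p * / (mu ^ 4 * (j + 1) ^ 4)).
      { apply Rmult_le_compat_l; [pos|exact H2]. }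
      replace (/ (N + 1) - / (N + 2)) with (/ ((N + 1) * (N + 2))) by (field; lra).
      unfold C1.
      replace (Rpower K p * / (mu ^ 4 * (j + 1) ^ 4)) with (8 * (Rpower K p / mu ^ 4) * / (8 * (j + 1) ^ 4)) by (field; split; apply Rgt_not_eq; lra).
      fold C1. apply Rmult_le_compat_l; [lra|]. apply Rinv_le_contravar; [nra|easy]. }
    refine (proj1 (ex_series_of_bounded _ C1 Hnn _)).
    intros n. apply Rle_trans with (rsum n (fun i => C1 * (/ (INR i + 1) - / (INR i + 2)))).
    + apply rsum_le. intros i _. apply Hterm.
    + rewrite rsum_scal.
      assert (E : rsum n (fun i => / (INR i + 1) - / (INR i + 2)) = 1 - / (INR n + 1)).
      { induction n as [|n IH]; [simpl; field|]. cbn [rsum]. rewrite IH, S_INR.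
        replace (INR n + 1 + 1) with (INR n + 2) by ring. lra. }
      rewrite E. assert (0 < / (INR n + 1)) by (apply Rinv_0_lt_compat; generalize (pos_INR n); lra). nra.
Qed.

End Schatten.

(** * Failure of compactness of the weighted operator *)

Lemma Cpowr_pos_real y c : 0 < y -> Cpowr y c = RtoC (Rpower y c).
Proof.
  intros Hy. rewrite Cpowr_eis by (intros E; apply RtoC_inj in E; lra).
  rewrite Carg_Re_pos by (simpl; lra). simpl. unfold Rdiv. rewrite Rmult_0_l, atan_0, Rmult_0_r, eis_0.
  rewrite Cmod_R, Rabs_pos_eq by lra. ring.
Qed.

(** The normalized reproducing kernel at the real point [l]. *)
Definition kf (l : R) (z : C) : C := (RtoC (sqrt (1 - l ^ 2)) * / (1 - l * z))%C.

Lemma kf_unit_ball l : 0 <= l < 1 -> in_H2 (kf l) /\ H2norm (kf l) <= 1.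
Proof.
  intros Hl. replace 1 with (sqrt 1) by apply sqrt_1.
  assert (Hl2 : 0 <= l ^ 2 < 1) by (simpl; nra).
  apply (H2norm_le (kf l) (fun n => RtoC (sqrt (1 - l ^ 2)) * RtoC l ^ n)%C); [lra| |].
  - intros z Hz. unfold inD in Hz.
    set (c := sqrt (1 - l ^ 2)). assert (Hc : 0 <= c) by apply sqrt_pos.
    assert (Hq : Cmod (l * z) < 1).
    { rewrite Cmod_mult, Cmod_R, Rabs_pos_eq by lra. generalize (Cmod_ge_0 z). nra. }
    assert (Hq0 := Cmod_ge_0 (l * z)).
    intros eps He. destruct (lim_le_eps _ _ (lim_geom c (Cmod (l * z)) (conj Hq0 Hq)) He) as [N HN].
    exists N. intros n Hn. specialize (HN n Hn).
    rewrite (csum_ext n _ (fun i => c * (l * z) ^ i)%C) by (intros; rewrite Cpow_mult_l; ring).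
    rewrite (csum_scal n _ (fun i => ((l * z) ^ i)%C)). unfold kf. fold c.
    rewrite Cmod_minus_sym.
    replace (c * / (1 - l * z) - c * csum n (fun i => (l * z) ^ i))%C
      with (c * (/ (1 - l * z) - csum n (fun i => (l * z) ^ i)))%C by ring.
    rewrite Cmod_mult, Cmod_R, Rabs_pos_eq by easy. eapply Rle_trans; [|exact HN].
    unfold Rdiv. rewrite Rmult_assoc. apply Rmult_le_compat_l; [easy|]. now apply Cmod_one_minus_geom.
  - intros D. rewrite (rsum_ext D _ (fun i => (1 - l ^ 2) * (l ^ 2) ^ i)).
    + rewrite rsum_scal. assert (H := rsum_geom_bound (l ^ 2) D Hl2).
      apply Rmult_le_compat_l with (r := 1 - l ^ 2) in H; [|lra]. rewrite Rinv_r in H by lra. exact H.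
    + intros i _. rewrite Cmod_mult, Cmod_R, Cmod_pow, Cmod_R, Rpow_mult_distr, !Rabs_pos_eq by pos.
      rewrite pow2_sqrt by lra. rewrite <- !pow_mult. do 2 f_equal. lia.
Qed.

Section NonCompact.

Context (th : R) (Hth : 0 < th < 1).

Definition lre (x : R) : R := (Rpower (1 + x) th - Rpower (1 - x) th) / (Rpower (1 + x) th + Rpower (1 - x) th).

Lemma lens_real x : 0 < x < 1 -> lens th x = RtoC (lre x) /\ 0 <= lre x < 1 /\ 1 - lre x <= 2 * Rpower (1 - x) th.
Proof.
  intros Hx. unfold lens, lre.
  rewrite <- RtoC_plus, <- RtoC_minus, !Cpowr_pos_real by lra.
  set (p := Rpower (1 + x) th). set (m := Rpower (1 - x) th).
  assert (Hp : 1 <= p) by (apply Rpower_ge_1; lra).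
  assert (Hm : 0 < m <= 1) by (split; [apply Rpower_pos|apply Rpower_le_1; lra]).
  split; [rewrite RtoC_div, RtoC_minus, RtoC_plus by lra; easy|].
  assert (E : 1 - (p - m) / (p + m) = 2 * m * / (p + m)) by (field; lra).
  split.
  - split; [pos|]. assert (0 < 2 * m * / (p + m)) by pos. lra.
  - rewrite E. nra.
Qed.

(** With [l = lens x] and [2 a = 1 - 1/th], the squared value at [x] is [(1-l)^(-1/th) / (1+l)]. As
    [1 - l <= 2 (1-x)^th], it is at least of order [1 / (1-x)], which matches the point evaluation
    bound. *)
Lemma weighted_lower x : 0 < x < 1 ->
  in_H2 (Wop th (kf (lre x))) ->
  Rpower 2 (- (1 / th)) / 2 <= H2norm (Wop th (kf (lre x))) ^ 2.
Proof.
  intros Hx HH. set (F := Wop th _) in *. set (a := aexp th).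
  assert (HD : inD x) by (unfold inD; rewrite Cmod_R, Rabs_pos_eq; lra).
  assert (PE := point_evaluation F x HH HD). rewrite Cmod_R, pow2_abs in PE.
  destruct (lens_real x Hx) as [El [Hl Hm]]. set (l := lre x) in *.
  assert (Hl2 : 0 <= l ^ 2 < 1) by (simpl; nra).
  assert (EF : Cmod (F x) ^ 2 = Rpower (1 - l) (2 * a) / (1 - l ^ 2)).
  { unfold F, Wop, WComp, wt. fold a. rewrite El, <- RtoC_minus, Cpowr_pos_real by lra. unfold kf.
    rewrite <- RtoC_mult, <- RtoC_minus. replace (1 - l * l) with (1 - l ^ 2) by ring.
    rewrite <- RtoC_inv, <- !RtoC_mult, Cmod_R, pow2_abs by lra.
    rewrite !Rpow_mult_distr, pow2_sqrt by lra.
    rewrite <- (Rpower_pow 2) by apply Rpower_pos. rewrite Rpower_mult.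
    replace (a * INR 2) with (2 * a) by (simpl; ring). field. lra. }
  assert (E1 : Rpower (1 - l) (2 * a) = (1 - l) * Rpower (1 - l) (- (1 / th))).
  { replace (2 * a) with (1 + - (1 / th)) by (unfold a, aexp; field; lra).
    rewrite Rpower_plus, Rpower_1 by lra. easy. }
  assert (H1 : Rpower 2 (- (1 / th)) * / (1 - x) <= Rpower (1 - l) (- (1 / th))).
  { assert (0 < 1 / th) by pos.
    replace (Rpower 2 (- (1 / th)) * / (1 - x)) with (Rpower (2 * Rpower (1 - x) th) (- (1 / th))).
    - apply Rpower_anti_l; [lra|]. split; [lra|easy].
    - rewrite <- Rpower_mult_distr by pos. f_equal.
      rewrite Rpower_mult. replace (th * - (1 / th)) with (- (1)) by (field; lra).
      rewrite Rpower_Ropp, Rpower_1 by lra. easy. }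
  assert (H2 : Rpower (1 - l) (- (1 / th)) / 2 <= Cmod (F x) ^ 2).
  { rewrite EF, E1. assert (P := Rpower_pos (1 - l) (- (1 / th))). set (R0 := Rpower (1 - l) (- (1 / th))) in *.
    apply -> Rle_div_r; [|lra].
    replace (1 - l ^ 2) with ((1 - l) * (1 + l)) by ring.
    assert (0 < (1 - l) * R0) by pos. nra. }
  assert (Hx2 : 0 < 1 - x ^ 2) by (simpl; nra).
  apply Rmult_le_compat_l with (r := 1 - x ^ 2) in PE; [|lra].
  replace ((1 - x ^ 2) * (H2norm F ^ 2 / (1 - x ^ 2))) with (H2norm F ^ 2) in PE by (field; lra).
  eapply Rle_trans; [|exact PE].
  assert (P2 := Rpower_pos 2 (- (1 / th))). set (c := Rpower 2 (- (1 / th))) in *.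
  apply Rle_trans with ((1 - x ^ 2) * (c * / (1 - x) / 2)).
  - replace ((1 - x ^ 2) * (c * / (1 - x) / 2)) with (c / 2 * (1 + x)) by (field; lra). nra.
  - apply Rmult_le_compat_l; [lra|]. lra.
Qed.

Definition xs (k : nat) : R := 1 - / (INR k + 2).

Lemma xs_range k : 0 < xs k < 1.
Proof.
  unfold xs. generalize (pos_INR k); intros.
  assert (0 < / (INR k + 2)) by pos.
  assert (/ (INR k + 2) <= / 2) by (apply Rinv_le_contravar; lra). lra.
Qed.

Lemma lim_inv_Rpower u : 0 < u -> is_lim_seq (fun k => Rpower (/ (INR k + 2)) u) 0.
Proof.
  intros Hu. apply is_lim_seq_spec. intros [eps He].
  destruct (nfloor_ex (Rpower eps (- (1 / u)))) as [N [_ HN]]; [pos|].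
  exists N. intros n Hn. apply le_INR in Hn. simpl. rewrite Rminus_0_r, Rabs_pos_eq by apply Rlt_le, Rpower_pos.
  generalize (pos_INR n); intros H0.
  apply Rlt_le_trans with (Rpower (/ Rpower eps (- (1 / u))) u).
  - apply Rlt_Rpower_l; [easy|]. split; [pos|].
    apply Rinv_lt_contravar; [pos|lra].
  - rewrite <- Rpower_Ropp, Rpower_mult. replace (- - (1 / u) * u) with 1 by (field; lra).
    rewrite Rpower_1 by easy. lra.
Qed.

Lemma weighted_not_compact : ~ H2_compact (Wop th).
Proof.
  intros [[HB _] HC]. set (W := Wop th) in *.
  set (fs := fun k => kf (lre (xs k))).
  assert (Hfs : forall k, in_H2 (fs k) /\ H2norm (fs k) <= 1).
  { intros k. apply kf_unit_ball. apply (lens_real (xs k) (xs_range k)). }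
  destruct (HC fs Hfs) as [ph [g [Hph [Hg Hlim]]]].
  assert (Hge : forall k, (k <= ph k)%nat).
  { induction k as [|k IH]; [lia|]. specialize (Hph k). lia. }
  assert (Hsub : forall k, in_H2 (fsub (W (fs (ph k))) g)) by (intros k; apply in_H2_fsub; [apply HB, Hfs|easy]).
  (* Norm convergence forces pointwise convergence, while at a fixed [z] the normalized kernels tend
     to 0: [sqrt (1 - l^2)] vanishes and the denominator is at least [1 - |lens z|]. *)
  assert (Hg0 : forall z, inD z -> g z = RtoC 0).
  { intros z Hz. apply Cmod_eq_0. apply Rle_antisym; [|pos].
    assert (HDl := lens_inD th Hth z Hz). unfold inD in Hz, HDl.
    set (c1 := / sqrt (1 - Cmod z ^ 2)).
    set (c2 := Cmod (wt th z) * / (1 - Cmod (lens th z))).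
    set (u := fun k => H2norm (fsub (W (fs (ph k))) g) * c1 + c2 * (2 * Rpower (/ (INR k + 2)) (th / 2))).
    assert (Hu : is_lim_seq u 0).
    { replace (Finite 0) with (Finite (0 * c1 + c2 * (2 * 0))) by (f_equal; ring).
      apply is_lim_seq_plus'.
      - apply is_lim_seq_mult'; [exact Hlim|apply is_lim_seq_const].
      - apply is_lim_seq_mult'; [apply is_lim_seq_const|]. apply is_lim_seq_mult'; [apply is_lim_seq_const|].
        apply lim_inv_Rpower. lra. }
    refine (is_lim_seq_le (fun _ => Cmod (g z)) u (Cmod (g z)) 0 _ (is_lim_seq_const _) Hu).
    intros k. unfold u.
    assert (T := Cmod_le_minus (g z) (W (fs (ph k)) z)). rewrite Cmod_minus_sym in T.
    assert (T1 : Cmod (W (fs (ph k)) z - g z) <= H2norm (fsub (W (fs (ph k))) g) * c1).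
    { assert (PE := point_evaluation _ z (Hsub k) Hz). unfold fsub at 1 in PE.
      rewrite <- (sqrt_pow2 (Cmod _)) by apply Cmod_ge_0.
      rewrite <- (sqrt_pow2 (H2norm _)) by apply H2norm_ge_0. unfold c1.
      rewrite <- sqrt_inv, <- sqrt_mult_alt by apply pow2_ge_0. apply sqrt_le_1_alt. exact PE. }
    assert (T2 : Cmod (W (fs (ph k)) z) <= c2 * (2 * Rpower (/ (INR k + 2)) (th / 2))).
    { unfold W, Wop, WComp, fs, kf. destruct (lens_real (xs (ph k)) (xs_range (ph k))) as [_ [Hl Hm]].
      set (l := lre (xs (ph k))) in *.
      assert (N' : 1 - Cmod (lens th z) <= Cmod (1 - l * lens th z)).
      { generalize (Cmod_le_minus 1 (1 - l * lens th z)).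
        replace (1 - (1 - l * lens th z))%C with (l * lens th z)%C by ring.
        rewrite Cmod_1, Cmod_mult, Cmod_R, Rabs_pos_eq by lra. generalize (Cmod_ge_0 (lens th z)). nra. }
      rewrite !Cmod_mult, Cmod_inv by (apply Cmod_gt_0; lra). rewrite Cmod_R, (Rabs_pos_eq (sqrt _)) by apply sqrt_pos.
      unfold c2. rewrite Rmult_assoc. apply Rmult_le_compat_l; [pos|].
      rewrite Rmult_comm. apply Rmult_le_compat.
      - apply Rlt_le, Rinv_0_lt_compat. lra.
      - pos.
      - apply Rinv_le_contravar; lra.
      - replace (2 * Rpower (/ (INR k + 2)) (th / 2)) with (sqrt ((2 * Rpower (/ (INR k + 2)) (th / 2)) ^ 2))
          by (apply sqrt_pow2; generalize (Rpower_pos (/ (INR k + 2)) (th / 2)); lra).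
        apply sqrt_le_1_alt. rewrite Rpow_mult_distr, <- (Rpower_pow 2 (Rpower _ _)) by apply Rpower_pos.
        rewrite Rpower_mult. replace (th / 2 * INR 2) with th by (simpl; field).
        apply Rle_trans with (2 * (1 - l)); [simpl; nra|].
        apply Rle_trans with (2 * (2 * Rpower (1 - xs (ph k)) th)); [lra|].
        replace (2 ^ 2) with (2 * 2) by ring. rewrite Rmult_assoc. do 2 (apply Rmult_le_compat_l; [lra|]).
        apply Rle_Rpower_l; [lra|]. unfold xs. specialize (Hge k). apply le_INR in Hge. generalize (pos_INR k); intros.
        replace (1 - (1 - / (INR (ph k) + 2))) with (/ (INR (ph k) + 2)) by ring.
        split; [pos|apply Rinv_le_contravar; lra]. }
    lra. }
  set (c := Rpower 2 (- (1 / th)) / 2).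
  assert (Hc : 0 < c) by (unfold c; generalize (Rpower_pos 2 (- (1 / th))); lra).
  assert (Hlow : forall k, sqrt c <= H2norm (fsub (W (fs (ph k))) g)).
  { intros k. assert (HW : in_H2 (W (fs (ph k)))) by apply HB, Hfs.
    destruct (in_H2_ext (W (fs (ph k))) (fsub (W (fs (ph k))) g)) as [_ ->].
    - intros z Hz. unfold fsub. rewrite Hg0 by easy. ring.
    - easy.
    - rewrite <- (sqrt_pow2 (H2norm _)) by apply H2norm_ge_0. apply sqrt_le_1_alt.
      apply (weighted_lower (xs (ph k)) (xs_range (ph k)) HW). }
  assert (H := is_lim_seq_le (fun _ => sqrt c) _ (sqrt c) 0 Hlow (is_lim_seq_const _) Hlim). simpl in H.
  assert (0 < sqrt c) by now apply sqrt_lt_R0. lra.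
Qed.

End NonCompact.

(** The weight is the image of this function, so its membership follows from boundedness. *)
Lemma in_H2_one : in_H2 (fun _ => RtoC 1).
Proof.
  refine (proj1 (in_H2_of_mean _ 1 Rle_0_1 (papp_const 1) _)).
  intros r M _ _. rewrite <- rsum_const. apply rsum_le. intros. rewrite Cmod_1. lra.
Qed.

Theorem theorem6p1 (theta : R) (Htheta : 0 < theta < 1) :
  let a := (1 / 2) * (1 - 1 / theta) in
  let w := fun z : C => Cpowr (Cminus 1 (lens theta z)) a in
  in_H2 w /\
  H2_bounded (WComp w (lens theta)) /\
  ~ H2_compact (WComp w (lens theta)) /\
  (forall p : R, 0 < p -> in_Schatten p (Comp (lens theta))).
Proof.
  intros a w. change w with (wt theta). change (WComp (wt theta) (lens theta)) with (Wop theta).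
  assert (HB := weighted_bounded theta Htheta).
  split; [|split; [exact HB|split]].
  - refine (proj1 (in_H2_ext _ _ _ (proj1 HB _ in_H2_one))). intros z _. apply Cmult_1_r.
  - exact (weighted_not_compact theta Htheta).
  - intros p Hp. now apply comp_Schatten.
Qed.
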